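(* Let $d\ge 1$ and let $\ell(x)=\frac12\langle x,Mx\rangle-\langle q,x\rangle+c$ for $x\in\mathbb{R}^d$, where $M\in\mathbb{R}^{d\times d}$ is symmetric positive semidefinite, $q\in\operatorname{Span}M$ and $c\in\mathbb{R}$. For each $\varepsilon>0$ let $u_0^\varepsilon,v_0^\varepsilon\in\mathbb{R}^d$, let $(u^\varepsilon,v^\varepsilon)$ be the solution on $\mathbb{R}_{\ge0}$ of $$\frac{\mathrm{d}u}{\mathrm{d}t}=-\nabla_u\big(\ell(v\circ u)\big),\qquad\frac{\mathrm{d}v}{\mathrm{d}t}=-\nabla_v\big(\ell(v\circ u)\big),\qquad u(0)=u_0^\varepsilon,\ v(0)=v_0^\varepsilon,$$ and let $x^\varepsilon=v^\varepsilon\circ u^\varepsilon$. Assume that $u_{0,i}^\varepsilon\ne\pm v_{0,i}^\varepsilon$ for all $i\in\{1,\dots,d\}$ and $$\mu^\varepsilon:=\Big(\sum_{i=1}^d\Big[\log^2\Big|\frac{u_{0,i}^\varepsilon+v_{0,i}^\varepsilon}{2}\Big|+\log^2\Big|\frac{u_{0,i}^\varepsilon-v_{0,i}^\varepsilon}{2}\Big|\Big]\Big)^{1/2}\xrightarrow[\varepsilon\to0]{}+\infty.$$ Denote $\overline{x}^\varepsilon(s)=x^\varepsilon(\mu^\varepsilon s)$, $s\ge0$. Assume that: - $\frac{1}{\mu^\varepsilon}\log\left|\frac{u_0^\varepsilon+v_0^\varepsilon}{2}\right|$ converges as $\varepsilon\to0$ to some $\overline{w}_0^{\mathrm{pos}}\in\mathbb{R}^d_{\le0}$;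 - $\frac{1}{\mu^\varepsilon}\log\left|\frac{u_0^\varepsilon-v_0^\varepsilon}{2}\right|$ converges as $\varepsilon\to0$ to some $\overline{w}_0^{\mathrm{neg}}\in\mathbb{R}^d_{\le0}$; - there exists $a\in\operatorname{Span}M$ such that $\overline{w}_0^{\mathrm{pos}}+a<0$ and $\overline{w}_0^{\mathrm{neg}}-a<0$. Write $\overline{w}_0=\frac{\overline{w}_0^{\mathrm{pos}}-\overline{w}_0^{\mathrm{neg}}}{2}$ and $\lambda=-\frac{\overline{w}_0^{\mathrm{pos}}+\overline{w}_0^{\mathrm{neg}}}{2}$. Then $\lambda>0$, and there exists a unique Lipschitz solution $\overline{w}$ of the mirror flow with mirror potential $h(x)=\sum_{i=1}^d\lambda_i|x_i|$ and loss $\ell$ with $\overline{w}(0)=\overline{w}_0$. Let $\overline{x}$ be an associated primal variable and let $S>0$. For $s\in[0,S]$ let $K(s)$ be the set of $y\in\mathbb{R}^d$ such that for every $i$: $y_i\ge0$ if $\overline{w}_i(s)=\lambda_i$; $y_i=0$ if $\overline{w}_i(s)\in(-\lambda_i,\lambda_i)$; $y_i\le0$ if $\overline{w}_i(s)=-\lambda_i$. Then: (a) As $\varepsilon\to0$, $\nabla\ell(\overline{x}^\varepsilon(s))\to\nabla\ell(\overline{x}(s))$ in $L^2([0,S],\mathbb{R}^d,s\,\mathrm{d}s)$ and $\ell(\overline{x}^\varepsilon(s))\to\ell(\overline{x}(s))$ in $L^1([0,S],\mathbb{R},s\,\mathrm{d}s)$, where $\ell(\overline{x}(s))=\min_{y\in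 K(s)}\ell(y)$ for a.e. $s\in[0,S]$. (b) Let $\overline{y}:[0,S]\to\mathbb{R}^d$ be such that there exists a sequence $\varepsilon_k\to0$ with $\overline{x}^{\varepsilon_k}(s)\to\overline{y}(s)$ as $k\to\infty$ for a.e. $s\in[0,S]$. Then for a.e. $s\in[0,S]$, $\overline{y}(s)\in\operatorname{Argmin}_{y\in K(s)}\ell(y)$.
   Context: $\circ$ is the componentwise product of vectors; functions such as $\log$ and $|\cdot|$ are applied to vectors componentwise; vector inequalities such as $z<0$ or $\lambda>0$ are meant for all coordinates; $\mathbb{R}^d_{\le0}$ is the set of vectors with all coordinates nonpositive. $\operatorname{Span}M$ is the column span of $M$. $\operatorname{Argmin}$ denotes the set of minimizers. $L^p(I,\mathbb{R}^m,s\,\mathrm{d}s)$ is the $L^p$ space with respect to the measure of density $s$ with respect to Lebesgue measure. Mirror flow: for a proper convex lower semicontinuous $g:\mathbb{R}^d\to\mathbb{R}\cup\{+\infty\}$, a function $w:\mathbb{R}_{\ge0}\to\mathbb{R}^d$ is a solution of the mirror flow with mirror potential $g$ and loss $\ell$ if there exists $x:\mathbb{R}_{\ge0}\to\mathbb{R}^d$ such that for a.e. $t\ge0$, $w$ is differentiable at $t$ and $\frac{\mathrm{d}w}{\mathrm{d}t}(t)=-\nabla\ell(x(t))$, $w(t)\in\partial g(x(t))$ (convex subdifferential). Any such $x$ is called an associated primal variable. *)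

(* Defs.v *)
From HB Require Import structures.
From mathcomp Require Import all_boot all_order all_algebra.
From mathcomp Require Import all_classical all_reals all_analysis.
From mathcomp Require Import measurable_realfun.
Set Implicit Arguments.
Unset Strict Implicit.
Unset Printing Implicit Defensive.
Import Order.TTheory GRing.Theory Num.Theory.
Import numFieldNormedType.Exports.
Local Open Scope classical_set_scope.
Local Open Scope ring_scope.

Section vectors.
Context {R : realType} {d : nat}.
Implicit Types x y u v : 'cV[R]_d.

Definition dotp x y : R := \sum_i x i 0 * y i 0.

Definition enorm x : R := Num.sqrt (dotp x x).

Definition hadamard u v : 'cV[R]_d := map2_mx *%R u v.

Definition log_abs x : 'cV[R]_d := map_mx (fun a => ln `|a|) x.

Definition gradient (f : 'cV[R]_d -> R) x : 'cV[R]_d :=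
  \col_i 'D_(delta_mx i 0) f x.

Definition colspan (M : 'M[R]_d) : set 'cV[R]_d :=
  range (fun z : 'cV[R]_d => M *m z).

Definition psd (M : 'M[R]_d) : Prop := forall x, 0 <= dotp x (M *m x).

Definition quadratic (M : 'M[R]_d) (q : 'cV[R]_d) (c : R) x : R :=
  2^-1 * dotp x (M *m x) - dotp q x + c.

Definition Argmin (K : set 'cV[R]_d) (f : 'cV[R]_d -> R) : set 'cV[R]_d :=
  [set y | K y /\ forall z, K z -> f y <= f z].

(* [m] is the minimum (attained infimum) of [f] over [K]. *)
Definition is_min (K : set 'cV[R]_d) (f : 'cV[R]_d -> R) (m : R) : Prop :=
  (exists2 y, K y & f y = m) /\ forall y, K y -> m <= f y.

End vectors.

Notation "u \h* v" := (hadamard u v) (at level 40, left associativity) :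
  ring_scope.

Section flows.
Context {R : realType} {d : nat}.
Implicit Types (l : 'cV[R]_d -> R) (u v w x : R -> 'cV[R]_d).

(* Trajectories on the half-line are functions on [R] of which only the
   restriction to [0, +oo[ matters; "derivative at 0" is accounted for by
   continuity at 0 within [0, +oo[, which is equivalent since the right-hand
   side of the equation is continuous. *)
Definition diag_net_flow l (u0 v0 : 'cV[R]_d) u v : Prop :=
  [/\ {within `[0, +oo[, continuous u}, {within `[0, +oo[, continuous v},
      u 0 = u0, v 0 = v0 &
      forall t : R, 0 < t ->
        is_derive t 1 u (- gradient (fun a => l (v t \h* a)) (u t)) /\
        is_derive t 1 v (- gradient (fun b => l (b \h* u t)) (v t))].

Definition subdifferential (g : 'cV[R]_d -> \bar R) (z : 'cV[R]_d) :
    set 'cV[R]_d :=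
  [set w | forall y, (g z + (dotp w (y - z))%:E <= g y)%E].

(* The potential [g] is meant to be proper, convex and lower semicontinuous. *)
Definition associated_primal (g : 'cV[R]_d -> \bar R) l w x : Prop :=
  \forall t \ae (@lebesgue_measure R), 0 <= (t : R) ->
    is_derive t 1 w (- gradient l (x t)) /\ subdifferential g (x t) (w t).

Definition mirror_flow (g : 'cV[R]_d -> \bar R) l w : Prop :=
  exists x, associated_primal g l w x.

Definition weighted_l1 (lam : 'cV[R]_d) (x : 'cV[R]_d) : \bar R :=
  (\sum_i lam i 0 * `|x i 0|)%:E.

Definition lipschitz_mirror_solution (g : 'cV[R]_d -> \bar R) l
    (w0 : 'cV[R]_d) w : Prop :=
  [/\ [lipschitz w t | t in `[0, +oo[%classic], mirror_flow g l w & w 0 = w0].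

Definition sign_cone (lam w : 'cV[R]_d) : set 'cV[R]_d :=
  [set y | forall i : 'I_d,
    [/\ w i 0 = lam i 0 -> 0 <= y i 0,
        - lam i 0 < w i 0 < lam i 0 -> y i 0 = 0 &
        w i 0 = - lam i 0 -> y i 0 <= 0]].

End flows.

Section time_weighted_measure.
Context {R : realType} (S : R).
Local Notation leb := (@lebesgue_measure R).

Let weight (s : R) : R := s * \1_(`[0, S]) s.

(* The measure s ds on [0, S]. *)
Definition sds : set R -> \bar R := fun A => (\int[leb]_(s in A) (weight s)%:E)%E.

Let weight_ge0 s : 0 <= weight s.
Proof.
rewrite /weight indicE; case: (boolP (s \in _)) => [|_]; last by rewrite mulr0.
by rewrite inE/= in_itv/= mulr1 => /andP[].
Qed.

Let measurable_weight : measurable_fun setT weight.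
Proof. by apply: measurable_funM => //; exact: measurable_indic. Qed.

Let sds0 : sds set0 = 0%E. Proof. by rewrite /sds integral_set0. Qed.

Let sds_ge0 A : (0 <= sds A)%E.
Proof. by apply: integral_ge0 => s _; rewrite lee_fin weight_ge0. Qed.

Let sds_sigma_additive : semi_sigma_additive sds.
Proof.
move=> /= F mF tF mUF; rewrite /sds; apply: cvg_toP.
  apply: ereal_nondecreasing_is_cvgn => m n mn.
  apply: lee_sum_nneg_natr => // k _ _.
  by apply: integral_ge0 => /= x _; rewrite lee_fin weight_ge0.
rewrite ge0_integral_bigcup//=.
- apply: measurableT_comp; first exact: EFin_measurable.
  exact: measurable_funTS measurable_weight.
- by move=> x _; rewrite lee_fin weight_ge0.
Qed.

HB.instance Definition _ := isMeasure.Build _ _ _ sds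
  sds0 sds_ge0 sds_sigma_additive.

End time_weighted_measure.

Section Lp_convergence.
Context {dT : measure_display} {T : measurableType dT} {R : realType}.
Variables (mu : {measure set T -> \bar R}) (p : \bar R).

(* Elements of L^p are classes modulo a.e. equality: [f] need not be
   measurable itself, only a.e. equal to a measurable function. *)
Definition in_Lp (f : T -> R) : Prop :=
  exists2 g : T -> R, g \in Lfun mu p & \forall s \ae mu, f s = g s.

Definition in_Lp_vec m (f : T -> 'cV[R]_m) : Prop :=
  forall i, in_Lp (fun s => f s i 0).

Definition cvg_Lp (f_ : R -> T -> R) (f : T -> R) : Prop :=
  [/\ \forall e \near 0^'+, in_Lp (f_ e), in_Lp f &
      ('N[mu]_p[EFin \o (fun s => f_ e s - f s)%R])%E @[e --> 0^'+] --> 0%E].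

Definition cvg_Lp_vec m (f_ : R -> T -> 'cV[R]_m) (f : T -> 'cV[R]_m) : Prop :=
  [/\ \forall e \near 0^'+, in_Lp_vec (f_ e), in_Lp_vec f &
      ('N[mu]_p[EFin \o (fun s => enorm (f_ e s - f s))%R])%E @[e --> 0^'+] --> 0%E].

End Lp_convergence.

(* Main.v *)
Require Import Defs.
From mathcomp Require Import all_boot all_order all_algebra.
From mathcomp Require Import all_classical all_reals all_analysis.
From mathcomp Require Import measurable_realfun ring lra.
Set Implicit Arguments.
Unset Strict Implicit.
Unset Printing Implicit Defensive.
Import Order.TTheory GRing.Theory Num.Theory.
Import numFieldNormedType.Exports.
Local Open Scope classical_set_scope.
Local Open Scope ring_scope.

(* Integrating the equations of [u + v] and [u - v] turns the rescaled network
   into [W' = - gradient l X], where [X] is the gradient at [W] of a smooth convex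
   potential which converges, as [mu] grows, to the indicator of the box
   [|w i| <= lam i]. The limiting mirror flow is piecewise linear: [x] is a
   minimizer of [l] on the sign cone of [w] until [w] reaches a new face of the
   box. The minimum of [l] on the cone then strictly decreases; as the cone is
   determined by the set of active faces, only finitely many pieces occur.
   Uniqueness holds since, by monotonicity of the subdifferential, the energy
   [<b, M^+ b> / 2] of the difference [b] of two solutions is nonincreasing.
   The same energy, applied to the difference of [W] and a slight contraction of
   [w] towards an interior point of the box, grows at a vanishing rate, whence the
   uniform convergence of [W] to [w]. Finally, the gap
   [<X - x, M (X - x)> / 2] is the derivative on each piece of a quantity that
   involves only the potential and [W - w]; after multiplication by [s] the
   potential has no contribution at [s = 0], and the gap vanishes in L^1(s ds).
   It controls the gradients in L^2 and the losses in L^1, and by Fatou's lemma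
   the pointwise limits. *)

(** The exponentials of [mirror_map] come from [u v = ((u + v) / 2)^2 - ((u - v) / 2)^2]: both
    squares are exponentials of the integrated gradient, and dividing the exponents by [2 mu] leaves
    [W - L] and [- W - L]. [W 0] and [L] only tend to [w 0] and [lam], and [W 0] may lie outside of
    the box of [L]; an [o(1)] error, multiplied by [mu] in an exponent, can then give unbounded
    exponentials. The contraction of [w] leaves a margin that absorbs this error, and its ratio is
    fixed before [mu] grows. For the same reason the potential may blow up at time 0, where only the
    weight [s] removes it. Integrating by parts against this weight leaves the integral of the
    potential. It is of order [1 / mu]: the potential is at most [(|X| + 2) / (2 mu)] per
    coordinate, and the energy relative to a fixed interior point bounds the integral of [|X|].
    Minimizers on a cone need not be unique, but [M x] is, and as [q] lies in the span the loss
    depends on [M x] only; two primal variables are therefore compared through [M x]. *)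

Section dot_product.
Context {R : realType} {d : nat}.
Implicit Types (x y z : 'cV[R]_d) (A : 'M[R]_d) (a : R).

Lemma dotpE x y : dotp x y = (x^T *m y) 0 0.
Proof. by rewrite /dotp mxE; apply: eq_bigr => i _; rewrite mxE. Qed.

Lemma dotpC x y : dotp x y = dotp y x.
Proof. by apply: eq_bigr => i _; rewrite mulrC. Qed.

Lemma dotpDl x y z : dotp (x + y) z = dotp x z + dotp y z.
Proof. by rewrite !dotpE linearD/= mulmxDl mxE. Qed.

Lemma dotpDr x y z : dotp x (y + z) = dotp x y + dotp x z.
Proof. by rewrite !dotpE mulmxDr mxE. Qed.

Lemma dotpNl x y : dotp (- x) y = - dotp x y.
Proof. by rewrite !dotpE linearN/= mulNmx mxE. Qed.

Lemma dotpNr x y : dotp x (- y) = - dotp x y.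
Proof. by rewrite dotpC dotpNl dotpC. Qed.

Lemma dotpBl x y z : dotp (x - y) z = dotp x z - dotp y z.
Proof. by rewrite dotpDl dotpNl. Qed.

Lemma dotpBr x y z : dotp x (y - z) = dotp x y - dotp x z.
Proof. by rewrite dotpDr dotpNr. Qed.

Lemma dotpZl a x y : dotp (a *: x) y = a * dotp x y.
Proof. by rewrite !dotpE linearZ/= -scalemxAl mxE. Qed.

Lemma dotpZr a x y : dotp x (a *: y) = a * dotp x y.
Proof. by rewrite dotpC dotpZl dotpC. Qed.

Lemma dotp0l x : dotp 0 x = 0.
Proof. by rewrite dotpE trmx0 mul0mx mxE. Qed.

Lemma dotp0r x : dotp x 0 = 0.
Proof. by rewrite dotpC dotp0l. Qed.

Definition dotp_lin := (dotpDl, dotpDr, dotpNl, dotpNr, dotpZl, dotpZr).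

Lemma dotp_mulmx x A y : dotp x (A *m y) = dotp (A^T *m x) y.
Proof. by rewrite !dotpE trmx_mul trmxK mulmxA. Qed.

Lemma dotp_symC A x y : A^T = A -> dotp x (A *m y) = dotp y (A *m x).
Proof. by move=> symA; rewrite dotp_mulmx symA dotpC. Qed.

Lemma dotp_delta i y : dotp (delta_mx i 0) y = y i 0.
Proof.
rewrite /dotp (bigD1 i)//= mxE !eqxx mul1r big1 ?addr0// => j /negbTE ji.
by rewrite mxE ji mul0r.
Qed.

Lemma dotp_ge0 x : 0 <= dotp x x.
Proof. by apply: sumr_ge0 => i _; exact: sqr_ge0. Qed.

Lemma dotp_eq0 x : dotp x x = 0 -> x = 0.
Proof.
move=> /eqP; rewrite psumr_eq0 => [/allP x0|i _]; last exact: sqr_ge0.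
apply/colP => i; rewrite mxE.
have := x0 i; rewrite mem_index_enum => /(_ isT) /=.
by rewrite mulf_eq0 orbb => /eqP.
Qed.

(** * Inequalities and a generalized inverse for positive semidefinite forms *)

Section psd_form.
Variable A : 'M[R]_d.
Hypotheses (symA : A^T = A) (psdA : psd A).

Lemma psd_young t x y : 0 < t ->
  dotp x (A *m y) <= t / 2 * dotp x (A *m x) + (2 * t)^-1 * dotp y (A *m y).
Proof.
move=> t0; have := psdA (t *: x - y).
rewrite -scaleN1r mulmxDr -!scalemxAr !dotp_lin (dotp_symC y x symA).
set a := dotp x (A *m x); set b := dotp x _; set c := dotp y _ => h.
have -> : t / 2 * a + (2 * t)^-1 * c = (t ^+ 2 * a + c) / (2 * t).
  by field; rewrite gt_eqF.
rewrite ler_pdivlMr ?mulr_gt0//; nra.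
Qed.

Lemma psd_cauchy_schwarz x y :
  dotp x (A *m y) ^+ 2 <= dotp x (A *m x) * dotp y (A *m y).
Proof.
have h t : 0 <= t ^+ 2 * dotp x (A *m x) - 2 * t * dotp x (A *m y) +
    dotp y (A *m y).
  have := psdA (t *: x - y); rewrite -scaleN1r mulmxDr -!scalemxAr !dotp_lin.
  by rewrite (dotp_symC y x symA); lra.
have /=a0 := psdA x.
move: a0 h; set a := dotp x (A *m x); set b := dotp x _; set c := dotp y _.
rewrite le_eqVlt => /predU1P[<- h|a0 h]; last first.
  have := h (b / a); rewrite expr_div_n.
  have -> : b ^+ 2 / a ^+ 2 * a - 2 * (b / a) * b + c = c - b ^+ 2 / a.
    by field; rewrite gt_eqF.
  by rewrite subr_ge0 ler_pdivrMr// mulrC.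
have [->|b0] := eqVneq b 0; first by rewrite expr0n/= mul0r.
(* With [a = 0] the parabola is a line, whose value at this abscissa would be -1. *)
have := h ((c + 1) / (2 * b)); rewrite mulr0 add0r.
have -> : 2 * ((c + 1) / (2 * b)) * b = c + 1 by field.
lra.
Qed.

Lemma psd_form_eq0 x : dotp x (A *m x) = 0 -> A *m x = 0.
Proof.
move=> x0; apply: dotp_eq0.
have := psd_cauchy_schwarz (A *m x) x; rewrite x0 mulr0.
by move=> h; apply/eqP; rewrite -sqrf_eq0 eq_le h sqr_ge0.
Qed.

(* The form of [N] represents on the span of [A] the inverse of that of [A]. *)
Lemma psd_ginv : exists N : 'M[R]_d, [/\ N^T = N, psd N & A *m N *m A = A].
Proof.
have [P APA] : exists P, A *m P *m A = A.
  by exists (pinvmx A); rewrite mulmxKpV.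
have APTA : A *m P^T *m A = A.
  have := congr1 trmx APA; rewrite !trmx_mul symA mulmxA; exact.
(* [P] itself need be neither symmetric nor positive semidefinite; [P^T A P] is both, and still an
   inner inverse of [A]. *)
exists (P^T *m A *m P); split.
- by rewrite !trmx_mul trmxK symA mulmxA.
- move=> x; rewrite -mulmxA -mulmxA dotp_mulmx trmxK; exact: psdA.
- by rewrite !mulmxA APTA APA.
Qed.

End psd_form.

Lemma ler_dotp_abs x y b : (forall i, `|y i 0| <= b) ->
  `|dotp x y| <= b * \sum_i `|x i 0|.
Proof.
move=> yb; rewrite (le_trans (ler_norm_sum _ _ _))// mulr_sumr ler_sum// => i _.
by rewrite normrM mulrC ler_wpM2r.
Qed.

End dot_product.

(** * Gradients of the quadratic loss, alone and composed with a product *)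

Section gradients.
Context {R : realType} {d : nat}.
Implicit Types (x y z g : 'cV[R]_d).

(** [gradient] collects partial derivatives, so an exact expansion along each axis is enough; both
    losses met below are quadratic along the axes. *)
Lemma gradient_expansion (f : 'cV[R]_d -> R) x g (k : 'I_d -> R) :
  (forall i h, f (h *: delta_mx i 0 + x) = f x + h * g i 0 + h ^+ 2 * k i) ->
  gradient f x = g.
Proof.
move=> fE; apply/colP => i; rewrite mxE /derive; apply/cvg_lim => //.
apply: (@cvg_trans _ ((fun h : R => g i 0 + h * k i) @ 0^')).
  apply: near_eq_cvg; near=> h; have h0 : h != 0 by near: h; exact: nbhs_dnbhs_neq.
  by rewrite /= fE /GRing.scale/=; field.
have : (fun h : R => g i 0 + h * k i) @ (0 : R) --> g i 0 + 0 * k i.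
  by apply: cvgD; [exact: cvg_cst|apply: cvgM; [exact: cvg_id|exact: cvg_cst]].
by rewrite mul0r addr0; exact: cvg_within_filter.
Unshelve. all: by end_near. Qed.

Variables (M : 'M[R]_d) (q : 'cV[R]_d) (c : R).
Hypothesis symM : M^T = M.
Local Notation l := (quadratic M q c).

Lemma quadraticD x y :
  l (x + y) = l x + dotp (M *m x - q) y + 2^-1 * dotp y (M *m y).
Proof.
rewrite /quadratic mulmxDr !dotp_lin (dotp_symC x y symM) (dotpC y (M *m x)).
rewrite (dotpC (M *m x)); lra.
Qed.

Lemma gradient_quadratic x : gradient l x = M *m x - q.
Proof.
apply: (@gradient_expansion _ _ _ (fun i => 2^-1 * M i i)) => i h.
rewrite addrC quadraticD -scalemxAr !dotp_lin.
rewrite ![dotp _ (delta_mx _ _)]dotpC !dotp_delta.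
rewrite -colE !mxE; ring.
Qed.

Lemma gradient_quadratic_hadamard x y :
  gradient (fun a => l (y \h* a)) x = y \h* (M *m (y \h* x) - q).
Proof.
apply: (@gradient_expansion _ _ _ (fun i => 2^-1 * (y i 0 ^+ 2 * M i i))) => i h.
have -> : y \h* (h *: delta_mx i 0 + x) = y \h* x + (h * y i 0) *: delta_mx i 0.
  apply/colP => j; rewrite !mxE; case: eqVneq => [->|_] /=; ring.
rewrite quadraticD -scalemxAr !dotp_lin.
rewrite ![dotp _ (delta_mx _ _)]dotpC !dotp_delta -colE !mxE; ring.
Qed.

(** As [q = M z], the linear term is [<z, M x>]. This is how the loss of an arbitrary primal
    variable is identified. *)
Lemma quadratic_eqM x y : colspan M q -> M *m x = M *m y -> l x = l y.
Proof.
move=> [z _ <-] Mxy; have xyE a : dotp (M *m z) a = dotp z (M *m a).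
  by rewrite dotp_mulmx symM.
rewrite /quadratic !xyE -Mxy; congr (_ * _ - _ + _).
by rewrite (dotp_symC y x symM) Mxy.
Qed.

End gradients.

Section componentwise_limits.
Context {R : realType} {d : nat} {T : Type} {F : set_system T} {FF : Filter F}.

Lemma cvg_dotp (f g : T -> 'cV[R]_d) (a b : 'cV[R]_d) :
  (forall i, f t i 0 @[t --> F] --> a i 0) ->
  (forall i, g t i 0 @[t --> F] --> b i 0) ->
  dotp (f t) (g t) @[t --> F] --> dotp a b.
Proof.
by move=> fa gb; apply: cvg_big => [|i _]; [exact: add_continuous|exact: cvgM].
Qed.

Lemma cvg_mulmx_col (A : 'M[R]_d) (f : T -> 'cV[R]_d) (a : 'cV[R]_d) i :
  (forall i, f t i 0 @[t --> F] --> a i 0) ->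
  (A *m f t) i 0 @[t --> F] --> (A *m a) i 0.
Proof.
move=> fa; rewrite mxE; under eq_fun do rewrite mxE.
apply: cvg_big => [|j _]; first exact: add_continuous.
by apply: cvgM; [exact: cvg_cst|exact: fa].
Qed.

Lemma cvg_quadratic (M : 'M[R]_d) q c (f : T -> 'cV[R]_d) (a : 'cV[R]_d) :
  (forall i, f t i 0 @[t --> F] --> a i 0) ->
  quadratic M q c (f t) @[t --> F] --> quadratic M q c a.
Proof.
move=> fa; apply: cvgD; last exact: cvg_cst.
apply: cvgB; last by apply: cvg_dotp => // i; exact: cvg_cst.
apply: cvgM; first exact: cvg_cst.
by apply: cvg_dotp => // i; exact: cvg_mulmx_col.
Qed.

End componentwise_limits.

(** * The quadratic loss on a sign cone: existence of minimizers, optimality conditions *)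

Section cone_minimum.
Context {R : realType} {d : nat}.
Variables (M : 'M[R]_d) (z : 'cV[R]_d) (c : R).
Hypotheses (symM : M^T = M) (psdM : psd M).
Let q := M *m z.
Local Notation l := (quadratic M q c).
Variables (lam : 'cV[R]_d).
Hypothesis lam0 : forall i, 0 < lam i 0.

Definition in_box (w : 'cV[R]_d) := forall i, `|w i 0| <= lam i 0.

(** Some point of [w + Span M] has margin [delta] inside the box. The flow moves [w] within this
    affine space, so the property persists. *)
Definition interior_shift (delta : R) (w : 'cV[R]_d) :=
  exists2 a, colspan M a & forall i, `|w i 0 + a i 0| <= lam i 0 - delta.

(* The normal cone to the box meets the kernel of [M] only at the origin, because
   the box has an interior point in [w + Span M]: [l] is coercive on the cone. *)
Lemma sign_cone_coercive (delta : R) w : 0 < delta -> in_box w ->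
  interior_shift delta w ->
  exists2 B : R, 0 <= B &
    forall y, sign_cone lam w y -> l y <= l 0 -> forall i, `|y i 0| <= B.
Proof.
move=> delta0 wbox [_ [b _ <-] wa].
exists ((2^-1 * dotp b (M *m b) + 2 * dotp z (M *m z)) / delta).
  by rewrite divr_ge0 ?(ltW delta0)// addr_ge0// mulr_ge0//; exact: psdM.
move=> y Ky ly0 i.
have qy : dotp q y = dotp z (M *m y) by rewrite /q dotpC (dotp_symC _ _ symM).
have yMy : dotp y (M *m y) <= 4 * dotp z (M *m z).
  have /= := psd_young symM psdM z y (ltr0n R 2 : 0 < 2%:R).
  move: ly0; rewrite /quadratic mulmx0 !dotp0r qy mulr0 => ly0.
  rewrite invfM mulfV ?pnatr_eq0//.
  set a := dotp z (M *m z) in ly0 *; set e := dotp y (M *m y) in ly0 *.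
  set f := dotp z (M *m y) in ly0 *; lra.
(* On the cone [y j] is zero or has the sign of the end at which [w j] sits; there the shift [M b]
   points inwards by at least [delta]. *)
have term j : delta * `|y j 0| <= - ((M *m b) j 0 * y j 0).
  have [yp yz yn] := Ky j; have := wa j; have := wbox j; have := lam0 j.
  move=> l0 wl wal; move: (wl) (wal); rewrite !ler_norml => /andP[w1 w2] /andP[w3 w4].
  have [wj|wj] := eqVneq (w j 0) (lam j 0).
    have y0 := yp wj; rewrite (ger0_norm y0); nra.
  have [wj'|wj'] := eqVneq (w j 0) (- lam j 0).
    have y0 := yn wj'; rewrite (ler0_norm y0); nra.
  by rewrite yz ?normr0 ?mulr0 ?oppr0// !lt_neqAle wj w2 eq_sym wj' w1.
have : delta * `|y i 0| <= - dotp (M *m b) y.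
  rewrite /dotp -sumrN (bigD1 i)//= (le_trans (term i))// lerDl sumr_ge0// => j _.
  by rewrite (le_trans _ (term j))// mulr_ge0// ltW.
rewrite ler_pdivlMr// mulrC => /le_trans; apply.
have := psd_young symM psdM (- b) y (ltr01 : 0 < 1).
rewrite mulmxN !dotp_lin opprK mulr1 (dotpC (M *m b)) (dotp_symC y b symM).
by move=> /le_trans; apply; rewrite mul1r lerD2l ler_pdivrMl// ; lra.
Qed.

Lemma sign_cone_min (delta : R) w : 0 < delta -> in_box w -> interior_shift delta w ->
  exists2 x, sign_cone lam w x & forall y, sign_cone lam w y -> l x <= l y.
Proof.
move=> delta0 wbox ws; have [B B0 yB] := sign_cone_coercive delta0 wbox ws.
have K0 : sign_cone lam w 0 by move=> i; rewrite mxE.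
(* The cone is a product of points and half-lines; cut at size [B] it becomes a compact product of
   segments. *)
pose lo i := if w i 0 == - lam i 0 then - B else 0.
pose hi i := if w i 0 == lam i 0 then B else 0.
pose A := [set v : 'rV[R]_d | forall i, `[lo i, hi i]%classic (v ord0 i)].
have AP v : A v <-> sign_cone lam w v^T /\ forall i, `|v 0 i| <= B.
  rewrite /A /lo /hi; split => [Av|[Kv vB] i].
    split=> i; move: (Av i); have := lam0 i; rewrite /= in_itv/= ?mxE.
      move=> l0; case: eqVneq => w1; case: eqVneq => w2 /andP[v1 v2];
      by split=> [h|/andP[h1 h2]|h]; lra.
    move=> l0; rewrite ler_norml.
    by case: eqVneq => w1; case: eqVneq => w2 /andP[v1 v2]; apply/andP; split; lra.
  rewrite /= in_itv/=; have := vB i; have [] := Kv i; rewrite mxE ler_norml.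
  move=> vp v0 vn /andP[v1 v2]; have := wbox i; rewrite ler_norml => /andP[w3 w4].
  case: eqVneq => w1; case: eqVneq => w2.
  - by apply/andP; split; lra.
  - by have := vn w1; lra.
  - by have := vp w2; lra.
  - by rewrite v0 ?lexx// !lt_neqAle w2 eq_sym w1 w3.
have cA : compact A.
  by apply: (@rV_compact _ _ (fun i => `[lo i, hi i]%classic)) => i; exact: segment_compact.
have A0 : A 0 by apply/AP; rewrite trmx0; split=> // i; rewrite mxE normr0.
have [|v] := @EVT_min_rV R d (fun v => l v^T) A (ex_intro _ _ A0) cA.
  apply: continuous_subspaceT => v; apply: (@cvg_quadratic R d _ (nbhs v) _) => i.
  under eq_fun do rewrite mxE; rewrite mxE; exact: coord_continuous.
rewrite inE => /AP[Kv vB] vmin; exists v^T => // y Ky.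
(* Below the level [l 0] the bound [B] puts [y] in the compact part; above it, [y] is beaten by 0,
   which belongs to that part. *)
have [ly|ly] := leP (l y) (l 0).
  have := vmin y^T; rewrite trmxK; apply; rewrite inE; apply/AP; rewrite trmxK.
  by split=> // i; rewrite mxE yB.
rewrite (le_trans _ (ltW ly))//.
by have := vmin 0; rewrite trmx0; apply; rewrite inE.
Qed.

Lemma sign_coneD w x y (a b : R) : sign_cone lam w x -> sign_cone lam w y ->
  0 <= a -> 0 <= b -> sign_cone lam w (a *: x + b *: y).
Proof.
move=> Kx Ky a0 b0 i; have [x1 x2 x3] := Kx i; have [y1 y2 y3] := Ky i.
rewrite !mxE; split=> wi.
- by rewrite addr_ge0// mulr_ge0// ?x1 ?y1.
- by rewrite x2// y2// !mulr0 addr0.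
- have := x3 wi; have := y3 wi; nra.
Qed.

Section first_order.
Variables (w x : 'cV[R]_d).
Hypotheses (Kx : sign_cone lam w x).
Hypothesis xmin : forall y, sign_cone lam w y -> l x <= l y.

Lemma argmin_slope_ge0 y : sign_cone lam w y -> 0 <= dotp (M *m x - q) y.
Proof.
move=> Ky; rewrite leNgt; apply/negP => g0.
set g := dotp _ _ in g0; have yMy := psdM y; set e := dotp y (M *m y) in yMy.
have e1 : 0 < e + 1 by rewrite ltr_wpDl.
(* The parabola [t g + t^2 e / 2] is minimal at [- g / e]; the added 1 covers [e = 0] and keeps the
   value negative. *)
have t0 : 0 < - g / (e + 1) by rewrite divr_gt0// oppr_gt0.
have := xmin (sign_coneD Kx Ky ler01 (ltW t0)).
rewrite scale1r (quadraticD _ _ symM) -scalemxAr !dotpZr dotpZl -/e -/g.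
apply/negP; rewrite -ltNge -addrA gtrDl.
have -> : - g / (e + 1) * g + 2^-1 * (- g / (e + 1) * (- g / (e + 1) * e)) =
  - (g ^+ 2 / (e + 1)) * (1 - 2^-1 * (e / (e + 1))) by field; rewrite gt_eqF.
have ee1 : e / (e + 1) <= 1 by rewrite ler_pdivrMr// mul1r lerDl.
have g2 : 0 < g ^+ 2 / (e + 1) by rewrite divr_gt0// exprn_even_gt0//= ltr0_neq0.
by rewrite mulNr oppr_lt0 mulr_gt0//; lra.
Qed.

(** Each coordinate of [x] taken alone lies in the cone, so every product is nonnegative; [x] may
    also be shrunk towards 0, so their sum is nonpositive. *)
Lemma argmin_complementary i : (M *m x - q) i 0 * x i 0 = 0.
Proof.
set g := M *m x - q.
have Kxj j : sign_cone lam w (x j 0 *: delta_mx j 0).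
  move=> k; rewrite !mxE eqxx andbT; have [k1 k2 k3] := Kx k.
  have [kj|_] := eqVneq k j; last by rewrite mulr0.
  by rewrite -kj mulr1.
have ge0 j : 0 <= g j 0 * x j 0.
  have := argmin_slope_ge0 (Kxj j).
  by rewrite dotpZr dotpC dotp_delta mulrC.
have K0 : sign_cone lam w 0 by move=> j; rewrite mxE.
have gx : dotp g x <= 0.
  rewrite leNgt; apply/negP => gx; have e0 := psdM x.
  set e := dotp x (M *m x) in e0; set a := dotp g x in gx.
  have ea : 0 < e + a by rewrite ltr_wpDl.
  pose t := a / (e + a).
  have t1 : t <= 1 by rewrite ler_pdivrMr// mul1r lerDr.
  have Kt : sign_cone lam w ((1 - t) *: x).
    by have := sign_coneD Kx K0 (_ : 0 <= 1 - t) (lexx 0); rewrite scaler0 addr0 subr_ge0; apply.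
  have := xmin Kt; rewrite scalerBl scale1r (quadraticD _ _ symM).
  rewrite mulmxN -scalemxAr !(dotpNr, dotpNl, dotpZr, dotpZl) opprK -/e -/a.
  apply/negP; rewrite -ltNge -addrA gtrDl.
  have -> : - (t * a) + 2^-1 * (t * (t * e)) = - (t * a) * (1 - 2^-1 * (e / (e + a))).
    by rewrite /t; field; rewrite gt_eqF.
  have eea : e / (e + a) <= 1 by rewrite ler_pdivrMr// mul1r lerDl ltW.
  have ta : 0 < t * a by rewrite mulr_gt0// divr_gt0.
  by rewrite mulNr oppr_lt0 mulr_gt0//; lra.
have : dotp g x == 0 by rewrite eq_le gx sumr_ge0.
rewrite psumr_eq0// => /allP/(_ i); rewrite mem_index_enum => /(_ isT)/= /eqP; exact.
Qed.

End first_order.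

End cone_minimum.

(** * Subgradients of the weighted l1 norm and sign cones *)

Section subgradients.
Context {R : realType} {d : nat}.
Variable lam : 'cV[R]_d.
Hypothesis lam0 : forall i, 0 < lam i 0.
Implicit Types w x y : 'cV[R]_d.

Definition l1_subgradient x w :=
  forall i, `|w i 0| <= lam i 0 /\ w i 0 * x i 0 = lam i 0 * `|x i 0|.

Lemma l1_subgradient_sign_cone x w : l1_subgradient x w -> sign_cone lam w x.
Proof.
move=> xw i; have [wl wx] := xw i; have l0 := lam0 i; split => wi.
- have : 0 <= lam i 0 * x i 0 by rewrite -wi wx mulr_ge0// ltW.
  by rewrite pmulr_rge0.
- apply/eqP; rewrite -normr_le0; move: wi; rewrite -ltr_norml => wi.
  have : lam i 0 * `|x i 0| <= `|w i 0| * `|x i 0|.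
    by rewrite -wx -normrM ler_norm.
  by rewrite leNgt => h; rewrite leNgt; apply: contra h => x0; rewrite ltr_pM2r.
- have : 0 <= w i 0 * x i 0 by rewrite wx mulr_ge0// ltW.
  by rewrite wi mulNr oppr_ge0 pmulr_rle0.
Qed.

Lemma sign_cone_l1_subgradient x w : in_box lam w -> sign_cone lam w x ->
  l1_subgradient x w.
Proof.
move=> wbox Kx i; split=> //; have [xp x0 xn] := Kx i; have := wbox i.
rewrite ler_norml => /andP[w1 w2].
have [wi|wi] := eqVneq (w i 0) (lam i 0); first by rewrite wi ger0_norm ?xp.
have [wi'|wi'] := eqVneq (w i 0) (- lam i 0).
  by rewrite wi' ler0_norm ?xn// mulrN mulNr.
by rewrite x0 ?normr0 ?mulr0// !lt_neqAle wi w2 eq_sym wi' w1.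
Qed.

(** Only one coordinate is moved: to 0 and to [2 * x i 0] for the equality, by 1 in both directions
    for the bound. *)
Lemma subdifferential_weighted_l1 x w :
  subdifferential (weighted_l1 lam) x w <-> l1_subgradient x w.
Proof.
rewrite /subdifferential /weighted_l1; split => [xw i|xw y] /=; last first.
  rewrite -EFinD lee_fin dotpBr addrC -lerBrDr /dotp -!sumrB ler_sum// => i _.
  have [wl ->] := xw i; rewrite lerD2r (le_trans (ler_norm _))// normrM.
  by rewrite ler_wpM2r.
have test a : lam i 0 * `|x i 0| + w i 0 * (a - x i 0) <= lam i 0 * `|a|.
  have := xw (x + (a - x i 0) *: delta_mx i 0).
  rewrite -EFinD lee_fin [x + _ - x]addrC addKr dotpZr dotpC dotp_delta.
  rewrite (bigD1 i)//= [in leRHS](bigD1 i)//= !mxE !eqxx mulr1.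
  rewrite addrCA subrr addr0.
  under [X in _ <= _ + X]eq_bigr => j ji do
    rewrite !mxE (negbTE ji) /= mulr0 addr0.
  by rewrite addrAC lerD2r [_ * w i 0]mulrC.
have eqx : w i 0 * x i 0 = lam i 0 * `|x i 0|.
  have := test 0; have := test (2 * x i 0); rewrite normrM normr0 mulr0.
  by rewrite (ger0_norm (ler0n _ 2)); lra.
split=> //; rewrite ler_norml; have := test (x i 0 + 1); have := test (x i 0 - 1).
rewrite [x i 0 + 1 - _]addrC addKr [x i 0 - 1 - _]addrC addKr.
have l0 := ltW (lam0 i).
have := ler_wpM2l l0 (ler_normD (x i 0) 1).
have := ler_wpM2l l0 (ler_normB (x i 0) 1); rewrite normr1.
by move=> h1 h2 h3 h4; apply/andP; split; lra.
Qed.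

End subgradients.

(** * Construction of the limiting mirror flow *)

Section piecewise_linear_path.
Context {R : realType} {d : nat}.
Variables (M : 'M[R]_d) (z : 'cV[R]_d) (c : R).
Hypotheses (symM : M^T = M) (psdM : psd M).
Let q := M *m z.
Local Notation l := (quadratic M q c).
Variables (lam : 'cV[R]_d).
Hypothesis lam0 : forall i, 0 < lam i 0.

(* Between consecutive breakpoints of [a, b] the primal variable is a constant of
   size at most [B], and [w' = - gradient l x] is thus constant as well. *)
Inductive piecewise_flow (w x : R -> 'cV[R]_d) (B : R) : R -> R -> Prop :=
| piecewise_nil a : piecewise_flow w x B a a
| piecewise_cons a b e xa : a < b -> (forall s, a <= s < b -> x s = xa) ->
    (forall i, `|xa i 0| <= B) ->
    (forall s, a <= s <= b ->
       w s = w a + (s - a) *: (q - M *m xa) /\ l1_subgradient lam xa (w s)) ->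
    piecewise_flow w x B b e -> piecewise_flow w x B a e.

Lemma piecewise_flow_shift w x (B : R) w' x' (B' eta a b : R) : 0 <= a -> B <= B' ->
  (forall s, 0 <= s -> w' (s + eta) = w s) ->
  (forall s, 0 <= s -> x' (s + eta) = x s) ->
  piecewise_flow w x B a b -> piecewise_flow w' x' B' (a + eta) (b + eta).
Proof.
move=> + BB' ww' xx' p; elim: p => {a b} [a a0|a b e xa ab xaE xB wE _ IH a0].
  exact: piecewise_nil.
have sub s : s = s - eta + eta by rewrite subrK.
apply: (@piecewise_cons _ _ _ _ (b + eta) _ xa).
- by rewrite ltrD2r.
- move=> s /andP[s1 s2]; rewrite (sub s) xx' ?xaE//; lra.
- by move=> i; rewrite (le_trans (xB i)).
- move=> s /andP[s1 s2]; rewrite (sub s) !ww'; [|lra..].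
  have -> : s - eta + eta - (a + eta) = s - eta - a by ring.
  by apply: wE; lra.
- by apply: IH; lra.
Qed.

(* The pair tells whether the coordinate of [w] is at the upper, resp. lower, end
   of its interval. *)
Definition active (w : 'cV[R]_d) : {ffun 'I_d -> bool * bool} :=
  [ffun i => (w i 0 == lam i 0, w i 0 == - lam i 0)].

(** The sign cone as a function of a finite pattern: a coordinate not at its upper end forbids
    positive values, one not at its lower end negative values. *)
Definition active_cone (sg : {ffun 'I_d -> bool * bool}) (y : 'cV[R]_d) :=
  forall i, (~~ (sg i).1 -> y i 0 <= 0) /\ (~~ (sg i).2 -> 0 <= y i 0).

Lemma active_coneE w y : in_box lam w ->
  active_cone (active w) y <-> sign_cone lam w y.
Proof.
move=> wbox; split=> Ky i; have := Ky i; rewrite ?ffunE /=; have l0 := lam0 i.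
  move=> [y1 y2]; split => [wi|/andP[wi1 wi2]|wi].
  - by apply: y2; rewrite wi -subr_eq0 opprK gt_eqF ?addr_gt0.
  - by apply/eqP; rewrite eq_le y1 ?y2 ?(gt_eqF wi1) ?(lt_eqF wi2).
  - by apply: y1; rewrite wi eq_sym -subr_eq0 opprK gt_eqF ?addr_gt0.
move=> [yp y0 yn]; have [wi|wi] := eqVneq (w i 0) (lam i 0).
  by split=> // _; exact: yp.
have [wi'|wi'] := eqVneq (w i 0) (- lam i 0).
  by split=> // _; exact: yn.
have := wbox i; rewrite ler_norml => /andP[w1 w2].
by rewrite y0 ?lexx// !lt_neqAle wi w2 eq_sym wi' w1.
Qed.

(** Its cardinal, at [v] the current minimum of the loss, is the termination measure of the
    construction. *)
Definition better (v : R) : {set {ffun 'I_d -> bool * bool}} :=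
  [set sg | `[< exists2 y, active_cone sg y & l y < v >]].

Section step.
Variables (w x : 'cV[R]_d).
Hypotheses (wbox : in_box lam w) (Kx : sign_cone lam w x).
Hypothesis xmin : forall y, sign_cone lam w y -> l x <= l y.
Let r := q - M *m x.

Lemma velocity_complementary i : r i 0 * x i 0 = 0.
Proof.
have := argmin_complementary symM psdM Kx xmin i.
by rewrite -opprB mxE mulNr => /eqP; rewrite oppr_eq0 => /eqP.
Qed.

Lemma velocity_slope y : sign_cone lam w y -> dotp r y <= 0.
Proof.
by move=> /(argmin_slope_ge0 symM psdM Kx xmin); rewrite -opprB dotpNl oppr_ge0.
Qed.

(** The unit vector belongs to the cone and its slope is [r i 0]; thus [w] does not leave the box at
    once. *)
Lemma velocity_upper i : w i 0 = lam i 0 -> r i 0 <= 0.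
Proof.
move=> wi; have l0 := lam0 i.
have := @velocity_slope (delta_mx i 0); rewrite dotpC dotp_delta; apply.
move=> j; rewrite !mxE eqxx andbT; have [->|_] := eqVneq j i; last by [].
rewrite wi; split => //; last by move=> h; lra.
by rewrite ltxx andbF.
Qed.

Lemma velocity_lower i : w i 0 = - lam i 0 -> 0 <= r i 0.
Proof.
move=> wi; have l0 := lam0 i.
have := @velocity_slope (- delta_mx i 0).
rewrite dotpC dotpNl dotp_delta oppr_le0; apply.
move=> j; rewrite !mxE eqxx andbT; have [->|_] := eqVneq j i; last by rewrite oppr0.
rewrite wi; split => /=; [by move=> h; lra|by rewrite ltxx|by rewrite oppr_le0].
Qed.

(** By complementarity only coordinates where [x] vanishes move, so [<w, x>] is unchanged and [x]
    stays valid while [w] is in the box. *)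
Lemma velocity_l1_subgradient (s : R) : in_box lam (w + s *: r) ->
  l1_subgradient lam x (w + s *: r).
Proof.
move=> sbox i; split=> //; rewrite !mxE mulrDl.
have [_ ->] := sign_cone_l1_subgradient wbox Kx i.
have := velocity_complementary i; rewrite !mxE -mulrA => ->.
by rewrite mulr0 addr0.
Qed.

Lemma first_hit : r != 0 -> exists eta : R, [/\ 0 < eta,
  forall s, 0 <= s <= eta -> in_box lam (w + s *: r) &
  exists i, (0 < r i 0 /\ (w + eta *: r) i 0 = lam i 0) \/
            (r i 0 < 0 /\ (w + eta *: r) i 0 = - lam i 0)].
Proof.
move=> r0; have [i0 ri0] : exists i, r i 0 != 0.
  apply/existsP; apply: contraNT r0 => /existsPn r0.
  by apply/eqP/colP => i; rewrite [RHS]mxE; apply/eqP; have := r0 i; rewrite negbK.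
have wrE s j : (w + s *: r) j 0 = w j 0 + s * r j 0.
  by rewrite mxE; congr (_ + _); rewrite mxE.
(* Time at which a moving coordinate reaches the end of its interval towards which it moves. *)
pose tau i := if 0 < r i 0 then (lam i 0 - w i 0) / r i 0
              else (lam i 0 + w i 0) / - r i 0.
have tau0 i : r i 0 != 0 -> 0 < tau i.
  rewrite /tau => ri; have := wbox i; rewrite ler_norml => /andP[w1 w2].
  case: (ltP 0 (r _ 0)) => [r1|r1].
    rewrite divr_gt0// subr_gt0 lt_neqAle w2 andbT; apply/eqP => /velocity_upper.
    by rewrite leNgt r1.
  rewrite divr_gt0//; last by rewrite oppr_gt0 lt_neqAle ri r1.
  rewrite -ltrBlDl sub0r lt_neqAle w1 andbT eq_sym; apply/eqP => /velocity_lower r2.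
  by move: ri; rewrite eq_le r1 r2.
have [i ri imin] := @arg_minP _ _ _ i0 (fun i => r i 0 != 0) tau ri0.
exists (tau i); split; first exact: tau0.
  move=> s /andP[s0 s1] j; rewrite wrE; have := wbox j.
  rewrite !ler_norml => /andP[w1 w2].
  have [->|rj] := eqVneq (r j 0) 0; first by rewrite mulr0 addr0 w1.
  have := le_trans s1 (imin j rj); rewrite /tau; case: (ltP 0 (r _ 0)) => [r1|r1].
    by rewrite ler_pdivlMr// => sr; apply/andP; split; nra.
  rewrite ler_pdivlMr; last by rewrite oppr_gt0 lt_neqAle rj r1.
  by move=> sr; apply/andP; split; nra.
exists i; rewrite wrE.
rewrite /tau; case: (ltP 0 (r _ 0)) => [r1|r1]; [left|right]; split=> //.
- by field; rewrite gt_eqF.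
- by rewrite lt_neqAle ri r1.
- by field.
Qed.

End step.

Lemma piecewise_flow_glue (w x : 'cV[R]_d) (eta : R) w1 x1 (B L : R) :
  let r := q - M *m x in
  0 < eta -> (forall s, 0 <= s <= eta -> l1_subgradient lam x (w + s *: r)) ->
  w1 0 = w + eta *: r -> 0 <= L ->
  (forall s t : R, 0 <= s -> 0 <= t -> `|w1 s - w1 t| <= L * `|s - t|) ->
  (forall S : R, 0 <= S -> piecewise_flow w1 x1 B 0 S) ->
  exists w2 x2 (B2 L2 : R), [/\ w2 0 = w, 0 <= L2,
    forall s t : R, 0 <= s -> 0 <= t -> `|w2 s - w2 t| <= L2 * `|s - t| &
    forall S : R, 0 <= S -> piecewise_flow w2 x2 B2 0 S].
Proof.
move=> r eta0 subg w10 L0 lip pf.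
(* At [eta] both branches of [w2] agree; [x2] must already take its next value, as pieces fix [x] on
   half-open intervals. *)
pose w2 s := if s <= eta then w + s *: r else w1 (s - eta).
pose x2 s := if s < eta then x else x1 (s - eta).
pose B2 := Num.max B (\sum_i `|x i 0|).
pose L2 := Num.max L `|r|.
have w2eta s : 0 <= s -> w2 (s + eta) = w1 s.
  rewrite /w2 le_eqVlt => /predU1P[<-|s0]; first by rewrite add0r lexx w10.
  by rewrite ifF ?addrK//; apply/negbTE; rewrite -ltNge ltrDr.
have xB i : `|x i 0| <= B2.
  rewrite le_max; apply/orP; right; rewrite (bigD1 i)//= lerDl.
  by apply: sumr_ge0 => *.
have L20 : 0 <= L2 by rewrite le_max L0.
exists w2, x2, B2, L2; split=> //.
- by rewrite /w2 ltW// scale0r addr0.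
- have lin s t : 0 <= s -> s <= t -> t <= eta -> `|w2 s - w2 t| <= L2 * (t - s).
    move=> s0 st te; rewrite /w2 te (le_trans st te) opprD addrACA subrr add0r.
    rewrite -scalerBl normrZ mulrC -[`|s - t|]normrN opprB ger0_norm ?subr_ge0//.
    by rewrite ler_wpM2r ?subr_ge0// le_max lexx orbT.
  have lip1 s t : eta <= s -> s <= t -> `|w2 s - w2 t| <= L2 * (t - s).
    move=> es st; rewrite -[s](subrK eta) -[t](subrK eta) !w2eta ?subr_ge0//.
      rewrite (le_trans (lip _ _ _ _)) ?subr_ge0// ?(le_trans es)//.
      rewrite -normrN ger0_norm; last lra.
      rewrite ler_pM//; [lra|by rewrite le_max lexx|lra].
    by rewrite (le_trans es).
  have key s t : 0 <= s -> s <= t -> `|w2 s - w2 t| <= L2 * (t - s).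
    move=> s0 st; have [te|te] := leP t eta; first exact: lin.
    have [se|se] := leP s eta; last exact: lip1 (ltW se) st.
    rewrite -(subrKA (w2 eta)) (le_trans (ler_normD _ _))//.
    rewrite (le_trans (lerD (lin _ _ s0 se _) (lip1 _ _ _ (ltW te))))//.
    by rewrite -mulrDr; apply: ler_wpM2l => //; lra.
  move=> s t s0 t0; have [st|st] := leP s t.
    by rewrite (distrC s) ger0_norm ?subr_ge0// key.
  by rewrite distrC (ger0_norm (_ : 0 <= s - t)) ?key// ?subr_ge0 ltW.
(* The first piece ends at [eta], or earlier at [S] if [S] comes first. *)
- have piece b : 0 < b -> b <= eta -> forall e, piecewise_flow w2 x2 B2 b e ->
      piecewise_flow w2 x2 B2 0 e.
    move=> b0 be e; apply: (@piecewise_cons _ _ _ _ _ _ x) => //.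
      by move=> s /andP[s0 sb]; rewrite /x2 (lt_le_trans sb be).
    move=> s /andP[s0 sb]; rewrite /w2 (le_trans sb be) (ltW eta0).
    by rewrite scale0r addr0 subr0; split=> //; apply: subg; rewrite s0 (le_trans sb be).
  move=> S; rewrite le_eqVlt => /predU1P[<-|S0]; first exact: piecewise_nil.
  have [Se|eS] := leP S eta; first by apply: (piece S) => //; exact: piecewise_nil.
  apply: (piece eta) => //; rewrite -[eta]add0r -[S](subrK eta).
  apply: (@piecewise_flow_shift w1 x1 B) => //.
  + by rewrite le_max lexx.
  + by move=> s s0; rewrite /x2 ifF ?addrK//; apply/negbTE; rewrite -leNgt lerDr.
  + by apply: pf; rewrite subr_ge0 ltW.
Qed.

Lemma piecewise_flow_exists (delta : R) w0 : 0 < delta -> in_box lam w0 ->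
  interior_shift M lam delta w0 ->
  exists w x (B L : R), [/\ w 0 = w0, 0 <= L,
    forall s t : R, 0 <= s -> 0 <= t -> `|w s - w t| <= L * `|s - t| &
    forall S : R, 0 <= S -> piecewise_flow w x B 0 S].
Proof.
move=> delta0 w0box w0int.
have [x Kx xmin] := sign_cone_min z c symM psdM lam0 delta0 w0box w0int.
(* Induction on the number of patterns whose cone reaches a loss strictly below the current
   minimum. *)
move: {2}_.+1 (ltnSn #|better (l x)|) => n.
elim: n w0 x w0box w0int Kx xmin => [|n IH] w x wbox wint Kx xmin // cx.
pose r := q - M *m x.
have [r0|r0] := eqVneq r 0.
  have xw : l1_subgradient lam x w by exact: sign_cone_l1_subgradient.
  exists (fun=> w), (fun=> x), (\sum_i `|x i 0|), 0; split=> //.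
    by move=> s t _ _; rewrite subrr normr0 mul0r.
  move=> S; rewrite le_eqVlt => /predU1P[<-|S0]; first exact: piecewise_nil.
  apply: (@piecewise_cons _ _ _ _ S _ x) => //; last exact: piecewise_nil.
    by move=> i; rewrite (bigD1 i)//= lerDl sumr_ge0.
  by move=> s _; rewrite -/r r0 scaler0 addr0.
have [eta [eta0 ebox [i hit]]] := first_hit wbox Kx xmin r0.
have subg s : 0 <= s <= eta -> l1_subgradient lam x (w + s *: r).
  by move=> /ebox; exact: velocity_l1_subgradient.
have etain : 0 <= eta <= eta by rewrite lexx ltW.
pose w1 := w + eta *: r.
(* The displacement [eta *: r] lies in Span M: the same interior point of the box serves for
   [w1]. *)
have w1int : interior_shift M lam delta w1.
  case: wint => _ [b _ <-] wb; exists (M *m (b - eta *: (z - x))).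
    by exists (b - eta *: (z - x)).
  move=> j; have -> : w1 j 0 + (M *m (b - eta *: (z - x))) j 0 =
      w j 0 + (M *m b) j 0; last exact: wb.
    by rewrite mulmxBr -scalemxAr mulmxBr !mxE; ring.
have [x1 Kx1 x1min] :=
  sign_cone_min z c symM psdM lam0 delta0 (ebox _ etain) w1int.
have Kx' : sign_cone lam w1 x by apply: l1_subgradient_sign_cone (subg _ etain).
(* Otherwise [x] would be optimal on the new cone too, and its velocity could not have pushed
   outwards the coordinate that has just hit. *)
have lt1 : l x1 < l x.
  rewrite lt_neqAle x1min// andbT; apply/eqP => eqx.
  have xmin' y : sign_cone lam w1 y -> l x <= l y by rewrite -eqx; exact: x1min.
  have ui := velocity_upper Kx' xmin' (i := i).
  have li := velocity_lower Kx' xmin' (i := i).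
  by case: hit => [[ri /ui]|[ri /li]]; rewrite leNgt ri.
have [|w' [x' [B [L [w'0 L0 lip pf]]]]] :=
  IH w1 x1 (ebox _ etain) w1int Kx1 x1min.
  rewrite ltnS in cx; apply: leq_trans cx; apply: proper_card; apply/properP; split.
    apply/fintype.subsetP => sg; rewrite !finset.in_set => /asboolP[y sy ly].
    by apply/asboolP; exists y => //; exact: lt_trans ly lt1.
  (* The pattern of [w1] leaves the set: its cone reaches [l x1] and nothing below. *)
  exists (active w1); rewrite !finset.in_set.
    by apply/asboolP; exists x1 => //; exact/(active_coneE _ (ebox _ etain)).
  apply/asboolP => -[y /(active_coneE _ (ebox _ etain)) Ky].
  by rewrite ltNge x1min.
exact: piecewise_flow_glue eta0 subg w'0 L0 lip pf.
Qed.

End piecewise_linear_path.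

(** * Algebra of Lipschitz functions on a segment *)

Section lipschitz_on_segments.
Context {R : realType}.
Variables (a b : R).
Implicit Types f g : R -> R.

Definition seg_lipschitz f := exists2 L : R, 0 <= L &
  forall s t, a <= s -> s <= t -> t <= b -> `|f t - f s| <= L * (t - s).

Lemma seg_lipschitz_cst k : seg_lipschitz (fun=> k).
Proof. by exists 0 => // s t _ _ _; rewrite subrr normr0 mul0r. Qed.

Lemma seg_lipschitz_id : seg_lipschitz id.
Proof. by exists 1 => // s t _ st _; rewrite mul1r ger0_norm// subr_ge0. Qed.

Lemma seg_lipschitzD f g : seg_lipschitz f -> seg_lipschitz g ->
  seg_lipschitz (fun t => f t + g t).
Proof.
move=> [L L0 Lf] [K K0 Kg]; exists (L + K); first exact: addr_ge0.
move=> s t as_ st tb; rewrite opprD addrACA mulrDl (le_trans (ler_normD _ _))//.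
by rewrite lerD ?Lf ?Kg.
Qed.

Lemma seg_lipschitz_bounded f : seg_lipschitz f ->
  exists2 B, 0 <= B & forall t, a <= t <= b -> `|f t| <= B.
Proof.
move=> [L L0 Lf]; exists (L * `|b - a| + `|f a|); first by rewrite addr_ge0 ?mulr_ge0.
move=> t /andP[at_ tb]; rewrite -[f t](subrK (f a)) (le_trans (ler_normD _ _))//.
rewrite lerD2r (le_trans (Lf a t _ _ _))// ler_wpM2l// (le_trans _ (ler_norm _))//.
by rewrite lerD2r.
Qed.

Lemma seg_lipschitzM f g : seg_lipschitz f -> seg_lipschitz g ->
  seg_lipschitz (fun t => f t * g t).
Proof.
move=> lf lg; have [Bf Bf0 fB] := seg_lipschitz_bounded lf.
have [Bg Bg0 gB] := seg_lipschitz_bounded lg.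
case: lf lg => [L L0 Lf] [K K0 Kg]; exists (L * Bg + Bf * K).
  by rewrite addr_ge0 ?mulr_ge0.
move=> s t as_ st tb.
have -> : f t * g t - f s * g s = (f t - f s) * g t + f s * (g t - g s) by ring.
rewrite (le_trans (ler_normD _ _))// !normrM mulrDl lerD//.
- rewrite mulrAC ler_pM ?Lf ?gB// tb (le_trans as_)//.
- by rewrite -mulrA ler_pM ?Kg ?fB// as_ (le_trans st).
Qed.

Lemma seg_lipschitz_sum n (f : 'I_n -> R -> R) :
  (forall i, seg_lipschitz (f i)) -> seg_lipschitz (fun t => \sum_i f i t).
Proof.
move=> fl; suff h (r : seq 'I_n) : seg_lipschitz (fun t => \sum_(i <- r) f i t) by [].
elim: r => [|i r IH].
  by under eq_fun do rewrite big_nil; exact: seg_lipschitz_cst.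
by under eq_fun do rewrite big_cons; exact: seg_lipschitzD.
Qed.

Lemma seg_lipschitz_dotp d (f g : R -> 'cV[R]_d) :
  (forall i, seg_lipschitz (fun t => f t i 0)) ->
  (forall i, seg_lipschitz (fun t => g t i 0)) ->
  seg_lipschitz (fun t => dotp (f t) (g t)).
Proof. by move=> fl gl; apply: seg_lipschitz_sum => i; exact: seg_lipschitzM. Qed.

Lemma seg_lipschitz_mulmx d (A : 'M[R]_d) (f : R -> 'cV[R]_d) i :
  (forall i, seg_lipschitz (fun t => f t i 0)) ->
  seg_lipschitz (fun t => (A *m f t) i 0).
Proof.
move=> fl; under eq_fun do rewrite mxE; apply: seg_lipschitz_sum => j.
by apply: seg_lipschitzM => //; exact: seg_lipschitz_cst.
Qed.

Lemma seg_lipschitz_continuous f : seg_lipschitz f ->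
  {within `[a, b], continuous f}.
Proof.
move=> [L L0 Lf]; apply/subspace_continuousP => x; rewrite /= in_itv/= => /andP[ax xb].
apply/cvgrPdist_le => /= e e0.
have L1 : 0 < L + 1 by rewrite ltr_wpDl.
near=> y.
have yab : y \in `[a, b] by near: y; exact: withinT.
have xy : `|x - y| <= e / (L + 1).
  near: y; apply: cvg_within; apply/nbhs_ballP.
  by exists (e / (L + 1)) => [|y /ltW//]; rewrite /= divr_gt0.
move: yab; rewrite in_itv/= => /andP[ay yb].
have key : `|f x - f y| <= L * `|x - y|.
  have [le_xy|/ltW le_yx] := leP x y.
    by rewrite distrC (le_trans (Lf _ _ _ _ _))// distrC ger0_norm// subr_ge0.
  by rewrite (le_trans (Lf _ _ _ _ _))// ger0_norm// subr_ge0.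
rewrite (le_trans key)// (le_trans (ler_wpM2l L0 xy))//.
rewrite mulrCA ger_pMr// ler_pdivrMr// mul1r lerDl//.
Unshelve. all: by end_near. Qed.

End lipschitz_on_segments.

(** * Monotonicity from the sign of the derivative almost everywhere *)

Section lipschitz_monotonicity.
Context {R : realType}.
Implicit Types (f : R -> R) (a b t : R).
Local Notation leb := (@lebesgue_measure R).

Lemma derive_le0_right_growth f t df eps : is_derive t 1 f df -> df <= 0 ->
  0 < eps -> \forall h \near 0^'+, f (t + h) - f t <= eps * h.
Proof.
move=> [fd fE] df0 eps0; have : h^-1 *: (f (h *: 1 + t) - f t) @[h --> 0^'] --> df.
  by rewrite -fE; exact: fd.
move=> /cvgrPdist_lt/(_ _ eps0)[r /= r0 H].
near=> h.
have h0 : 0 < h by near: h; exact: nbhs_right_gt.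
have : `|df - h^-1 *: (f (h *: 1 + t) - f t)| < eps.
  apply: H; last by rewrite gt_eqF.
  by rewrite /ball_/= sub0r normrN gtr0_norm//; near: h; exact: nbhs_right_lt.
rewrite ltr_norml /GRing.scale/= mulr1 addrC => /andP[h1 _].
have : h^-1 * (f (h + t) - f t) <= eps by lra.
by rewrite mulrC ler_pdivrMr// [t + h]addrC.
Unshelve. all: by end_near. Qed.

Section growth_measure.
Variables (U : set R) (a : R).
Hypothesis oU : open U.

Let m t := fine (leb (U `&` `[a, t])).

Let mfin t : leb (U `&` `[a, t]) \is a fin_num.
Proof.
rewrite ge0_fin_numE//; apply: (@le_lt_trans _ _ (leb `[a, t])).
  rewrite le_measure ?inE//; first by apply: measurableI => //; exact: open_measurable.
rewrite lebesgue_measure_itv; case: ifP => // _; exact: ltry.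
Qed.

Let mD s t : a <= s -> s <= t ->
  (leb (U `&` `[a, t]) = leb (U `&` `[a, s]) + leb (U `&` `]s, t]))%E.
Proof.
move=> as_ st; rewrite -measureU//; last 3 first.
- by apply: measurableI => //; exact: open_measurable.
- by apply: measurableI => //; exact: open_measurable.
- rewrite setIACA setIid (_ : _ `&` `]s, t] = set0) ?setI0// -subset0 => x /=.
  by rewrite !in_itv/= => -[/andP[_ xs] /andP[]]; rewrite ltNge xs.
rewrite -setIUr (@itv_bndbnd_setU _ _ _ (BRight s))// bnd_simp.
Qed.

Lemma growth_measure_le s t : a <= s -> s <= t -> 0 <= m t - m s <= t - s.
Proof.
move=> as_ st; have mst := mD as_ st.
have fst : leb (U `&` `]s, t]) \is a fin_num.
  by have := mfin t; rewrite mst fin_numD => /andP[].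
have -> : m t - m s = fine (leb (U `&` `]s, t])).
  by rewrite /m mst fineD// addrC addKr.
rewrite fine_ge0//= -lee_fin fineK//.
apply: (@le_trans _ _ (leb `]s, t])).
  by rewrite le_measure ?inE//; apply: measurableI => //; exact: open_measurable.
rewrite lebesgue_measure_itv/=; case: ifP => // _.
by rewrite lee_fin subr_ge0.
Qed.

Lemma growth_measure_subset s t : a <= s -> s < t -> `]s, t] `<=` U ->
  m t - m s = t - s.
Proof.
move=> as_ st stU; have mst := mD as_ (ltW st).
have Ust : U `&` `]s, t] = `]s, t]%classic by exact/setIidr.
rewrite Ust in mst.
have : leb `]s, t]%classic = (t - s)%:E by rewrite lebesgue_measure_itv/= lte_fin st.
move=> lst; rewrite /m mst lst fineD// addrC addKr//.
Qed.

End growth_measure.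

(* The null set where the derivative is not controlled is covered by an open set
   [U] of small measure, and [f t - eps * t - L * |U `&` [a, t]|] has no minimum
   on [a, b[. *)
Lemma seg_lipschitz_ae_nincr f a b : a <= b -> seg_lipschitz a b f ->
  (\forall t \ae leb, a <= t <= b -> exists2 df, is_derive t 1 f df & df <= 0) ->
  f b <= f a.
Proof.
move=> ab lf aef; have [L L0 Lf] := lf; apply/ler_addgt0Pr => e e0.
(* The tilt will cost [eps * (b - a)] and the covering set at most [L * eps]; the 1 keeps the
   denominator positive. *)
pose eps := e / (b - a + L + 1).
have den0 : 0 < b - a + L + 1 by lra.
have eps0 : 0 < eps by rewrite divr_gt0.
case: aef => N [mN N0 subN].
have [|U [oU NU Ueps]] := lebesgue_regularity_outer mN _ eps0.
  apply: (@le_lt_trans _ _ (0 : \bar R)); last exact: ltry.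
  by rewrite le_eqVlt; apply/orP; left; apply/eqP; exact: N0.
have lebU : (leb U < eps%:E)%E.
  have UN0 : leb (U `&` N) = 0%E.
    by apply: (subset_measure0 _ mN) N0; [apply: measurableI => //; exact: open_measurable|].
  have -> : leb U = (leb (U `\` N) + leb (U `&` N))%E.
    exact: (measureDI leb (open_measurable oU) mN).
  by rewrite UN0 adde0.
pose m t := fine (leb (U `&` `[a, t])).
have mle s t : a <= s -> s <= t -> 0 <= m t - m s <= t - s.
  exact: growth_measure_le.
pose g t := f t + (- eps * t + - L * m t).
have [|c cab gmin] := @EVT_min R g a b ab.
  apply/seg_lipschitz_continuous/seg_lipschitzD => //; apply: seg_lipschitzD.
    by apply: seg_lipschitzM; [exact: seg_lipschitz_cst|exact: seg_lipschitz_id].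
  apply: seg_lipschitzM; first exact: seg_lipschitz_cst.
  exists 1 => // s t as_ st tb; have /andP[m1 m2] := mle s t as_ st.
  by rewrite mul1r ger0_norm.
have [ac cb] : a <= c /\ c <= b by move: cab; rewrite in_itv => /andP.
have cE : c = b.
  apply/eqP; rewrite eq_le cb leNgt; apply/negP => {}cb.
  (* Half of the tilt is spent on the derivative bound; the other half makes [g] strictly smaller at
     [c + h]. *)
  suff [h h0 [hb hg]] : exists2 h, 0 < h & c + h <= b /\
      f (c + h) - f c <= L * (m (c + h) - m c) + eps / 2 * h.
    have hab : c + h \in `[a, b] by rewrite in_itv/= hb (le_trans ac) ?lerDl ?ltW.
    have := gmin _ hab; rewrite /g => gle; have := mulr_gt0 eps0 h0; lra.
  (* Inside [U] the measure grows at full rate and pays for the Lipschitz bound; outside, the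
     derivative at [c] is controlled. *)
  have [Uc|Uc] := pselect (U c).
    have /nbhs_ballP[r r0 rU] : nbhs c U by exact: open_nbhs_nbhs.
    pose h := Num.min (r / 2) (b - c).
    have h0 : 0 < h by rewrite lt_min divr_gt0//= subr_gt0.
    have hr : h < r by rewrite gt_min ltr_pdivrMr ?ltr_pMr ?ltr1n.
    have hb : c + h <= b by rewrite -lerBrDl ge_min lexx orbT.
    exists h => //; split=> //.
    rewrite growth_measure_subset//; last first.
    - move=> x /=; rewrite in_itv/= => /andP[cx xh]; apply: rU.
      by rewrite /ball/= distrC gtr0_norm; lra.
    - by rewrite ltrDl.
    rewrite (le_trans (ler_norm _))// (le_trans (Lf _ _ _ _ _))//; first lra.
    by rewrite lerDl mulr_ge0 ?divr_ge0// ltW.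
  have : ~ N c by move=> /NU.
  move=> /(contra_notP (subN c))/(_ _)[|df fdf df0].
    by rewrite ac ltW.
  near (0 : R)^'+ => h; have h0 : 0 < h by near: h; exact: nbhs_right_gt.
  exists h => //; split.
    rewrite -lerBrDl ltW//; near: h; apply: nbhs_right_lt.
    by rewrite subr_gt0.
  have ch : c <= c + h by rewrite lerDl ltW.
  have /andP[mh _] := mle c (c + h) ac ch.
  rewrite -[leLHS]add0r lerD ?mulr_ge0//.
  near: h; apply: derive_le0_right_growth fdf df0 _; exact: divr_gt0.
have ga : g b <= g a by rewrite -cE gmin// in_itv/= lexx.
have mb : m b <= eps.
  have Ub : (leb (U `&` `[a, b]) < eps%:E)%E.
    apply: le_lt_trans lebU; apply: (le_measure leb); rewrite ?inE//.
    - by apply: measurableI => //; exact: open_measurable.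
    - exact: open_measurable.
  by rewrite -lee_fin fineK ?ltW// ge0_fin_numE// (lt_trans Ub)// ltry.
have m0 : 0 <= m a by rewrite fine_ge0.
have : eps * (b - a + L + 1) = e by rewrite divfK// gt_eqF.
have := mulr_ge0 L0 m0; have := ler_wpM2l L0 mb.
move: ga; rewrite /g; lra.
Unshelve. all: by end_near. Qed.

End lipschitz_monotonicity.

#[local] Instance lebesgue_ae_filter (R : realType) :
  Filter (nbhs (almost_everywhere (@lebesgue_measure R))).
Proof. exact: (ae_filter_ringOfSetsType (@lebesgue_measure R)). Qed.

(** * Coordinatewise calculus of vector-valued paths *)

Section derivatives_of_vectors.
Context {R : realType} {d : nat}.
Implicit Types (f g : R -> 'cV[R]_d) (A : 'M[R]_d) (t : R).

Definition col_derive t f (df : 'cV[R]_d) :=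
  forall i, is_derive t 1 (fun s => f s i 0) (df i 0).

Lemma is_derive_colP t f df : is_derive t 1 f df <-> col_derive t f df.
Proof.
split=> [[fd fE] i|fd].
  have fid := (derivable_mxP _ _ _).1 fd i 0.
  by apply: DeriveDef => //; rewrite -fE derive_mx// mxE.
have fd' : derivable f t 1.
  by apply/derivable_mxP => i j; rewrite (ord1 j); case: (fd i).
apply: DeriveDef => //; rewrite derive_mx//; apply/colP => i; rewrite mxE.
by case: (fd i).
Qed.

Lemma col_derive_cst t (a : 'cV[R]_d) : col_derive t (fun=> a) 0.
Proof. by move=> i; rewrite mxE; exact: is_derive_cst. Qed.

Lemma col_deriveD t f g df dg : col_derive t f df -> col_derive t g dg ->
  col_derive t (fun s => f s + g s) (df + dg).
Proof.
move=> fd gd i; under eq_fun do rewrite mxE.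
by rewrite mxE; apply: is_deriveD.
Qed.

Lemma col_deriveN t f df : col_derive t f df -> col_derive t (fun s => - f s) (- df).
Proof.
move=> fd i; under eq_fun do rewrite mxE.
by rewrite mxE; apply: is_deriveN.
Qed.

Lemma col_deriveB t f g df dg : col_derive t f df -> col_derive t g dg ->
  col_derive t (fun s => f s - g s) (df - dg).
Proof. by move=> fd /col_deriveN; exact: col_deriveD. Qed.

Lemma is_derive_bigsum n (h : 'I_n -> R -> R) (dh : 'I_n -> R) t :
  (forall i, is_derive t 1 (h i) (dh i)) ->
  is_derive t 1 (fun s => \sum_i h i s) (\sum_i dh i).
Proof.
move=> hd; rewrite (_ : (fun s => _) = \sum_i h i); first exact: is_derive_sum.
by apply/funext => s; rewrite fct_sumE.
Qed.

Lemma col_derive_mulmx t A f df : col_derive t f df ->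
  col_derive t (fun s => A *m f s) (A *m df).
Proof.
move=> fd i; under eq_fun do rewrite mxE.
rewrite mxE; apply: is_derive_bigsum => j.
exact: (@is_deriveZ _ _ _ (fun s => f s j 0) (A i j) t 1 (df j 0)).
Qed.

Lemma is_derive_dotp t f g df dg : col_derive t f df -> col_derive t g dg ->
  is_derive t 1 (fun s => dotp (f s) (g s)) (dotp df (g t) + dotp (f t) dg).
Proof.
move=> fd gd; rewrite /dotp -big_split/=; apply: is_derive_bigsum => i.
have := fd i; have := gd i => gdi fdi.
apply: (is_derive_eq (is_deriveM fdi gdi)).
by rewrite /GRing.scale/= addrC; congr (_ + _); rewrite mulrC.
Qed.

Lemma seg_lipschitz_ae_const (f : R -> R) (a b : R) : a <= b ->
  seg_lipschitz a b f ->
  (\forall t \ae (@lebesgue_measure R), a <= t <= b -> is_derive t 1 f 0) ->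
  f b = f a.
Proof.
move=> ab fl fd; apply/eqP; rewrite eq_le; apply/andP; split.
  apply: seg_lipschitz_ae_nincr => //.
  by apply: filterS fd => t ft /ft; exists 0.
rewrite -lerN2; apply: (@seg_lipschitz_ae_nincr _ (fun t => - f t)) => //.
  under eq_fun do rewrite -mulN1r.
  by apply: seg_lipschitzM => //; exact: seg_lipschitz_cst.
apply: filterS fd => t ft /ft {}ft; exists 0 => //.
by rewrite -oppr0; exact: is_deriveN.
Qed.

Lemma lipschitz_seg_lipschitz f i (b : R) : [lipschitz f t | t in `[0, +oo[%classic] ->
  seg_lipschitz 0 b (fun t => f t i 0).
Proof.
move=> [K [_ fK]].
(* The hypothesis gives the bound only for constants strictly above [K], which may be negative. *)
have K1 : K < `|K| + 1 by rewrite ltr_pwDr// ler_norm.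
exists (`|K| + 1) => [|s t s0 st tb]; first by rewrite addr_ge0.
have /(_ (t, s)) := fK _ K1; rewrite /= !in_itv/= !andbT => H.
have {H} := H (conj (le_trans s0 st) s0).
rewrite (ger0_norm (_ : 0 <= t - s)) ?subr_ge0//; apply: le_trans.
rewrite [leRHS]/Num.Def.normr/= mx_normrE.
by apply: le_trans (le_bigmax _ _ (i, 0)); rewrite !mxE.
Qed.

End derivatives_of_vectors.

(** * Uniqueness of the mirror flow *)

Section uniqueness.
Context {R : realType} {d : nat}.
Variables (M : 'M[R]_d) (z : 'cV[R]_d) (c : R).
Hypotheses (symM : M^T = M) (psdM : psd M).
Let q := M *m z.
Local Notation l := (quadratic M q c).

(** On Span M, [N] undoes [M]. Hence [<b, N b> / 2] has derivative [<b, y>] along [b' = M y]. *)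
Lemma dotp_ginv (N : 'M[R]_d) b y : N^T = N -> M *m N *m M = M ->
  b = M *m (N *m b) -> dotp b (N *m (M *m y)) = dotp b y.
Proof.
move=> symN MNM bE; rewrite [in LHS]bE dotpC dotp_mulmx symM.
by rewrite !mulmxA MNM dotpC (dotp_symC (N *m b) y symM) -bE dotpC.
Qed.

Lemma mirror_flow_unique (h : 'cV[R]_d -> R) w0 w w' :
  lipschitz_mirror_solution (EFin \o h) l w0 w ->
  lipschitz_mirror_solution (EFin \o h) l w0 w' ->
  forall t : R, 0 <= t -> w' t = w t.
Proof.
move=> [wl [x wx] w00] [wl' [x' wx'] w00'] T T0.
have [N [symN psdN MNM]] := psd_ginv symM psdM.
pose b t := w' t - w t.
have bl (e : R) i : seg_lipschitz 0 e (fun t => b t i 0).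
  under eq_fun do rewrite mxE mxE -mulN1r.
  apply: seg_lipschitzD; first exact: lipschitz_seg_lipschitz.
  apply: seg_lipschitzM; first exact: seg_lipschitz_cst.
  exact: lipschitz_seg_lipschitz.
have b0 : b 0 = 0 by rewrite /b w00 w00' subrr.
have bd : \forall t \ae (@lebesgue_measure R), 0 <= t ->
    col_derive t b (- (M *m (x' t - x t))) /\ 0 <= dotp (b t) (x' t - x t).
  apply: filterS2 wx wx' => t H H' t0.
  have [/is_derive_colP wd xw] := H t0; have [/is_derive_colP wd' xw'] := H' t0.
  split.
    have := col_deriveB wd' wd; rewrite !gradient_quadratic//.
    by congr col_derive; rewrite mulmxBr; apply/colP => i; rewrite !mxE; ring.
  have := xw (x' t); have := xw' (x t); rewrite /= -!EFinD !lee_fin.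
  by rewrite /b !(dotpBl, dotpBr); lra.
have bspan t : 0 <= t -> b t = M *m (N *m b t).
  move=> t0; apply/colP => i; apply/eqP; rewrite -subr_eq0; apply/eqP.
  (* [1 - M N] annihilates Span M, where the velocity of [b] lies. *)
  pose k s := ((1%:M - M *m N) *m b s) i 0.
  have kE s : k s = b s i 0 - (M *m (N *m b s)) i 0.
    by rewrite /k mulmxBl mul1mx -mulmxA !mxE.
  rewrite -kE (@seg_lipschitz_ae_const _ k 0 t)//.
  - by rewrite kE b0 !mulmx0 !mxE subrr.
  - by apply: seg_lipschitz_mulmx.
  - apply: filterS bd => s bs /andP[/bs[/(col_derive_mulmx (1%:M - M *m N)) bds _] _].
    have := bds i; rewrite mulmxN mulmxA mulmxBl mul1mx MNM subrr mul0mx oppr0.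
    by rewrite mxE.
have : dotp (b T) (N *m b T) <= dotp (b 0) (N *m b 0).
  apply: (@seg_lipschitz_ae_nincr _ (fun t => dotp (b t) (N *m b t))) => //.
    by apply: seg_lipschitz_dotp => // i; exact: seg_lipschitz_mulmx.
  apply: filterS bd => t + /andP[t0 _] => /(_ t0)[bdt mon].
  have := is_derive_dotp bdt (col_derive_mulmx N bdt).
  rewrite (dotp_symC _ _ symN) !mulmxN !dotpNr.
  rewrite (dotp_ginv _ symN MNM (bspan _ t0)) => dd.
  by exists (- dotp (b t) (x' t - x t) - dotp (b t) (x' t - x t)) => //; lra.
rewrite b0 dotp0l => bT.
have NbT : N *m b T = 0.
  by apply: psd_form_eq0 => //; apply/eqP; rewrite eq_le bT psdN.
by apply/eqP; rewrite -subr_eq0 -/(b T) (bspan T T0) NbT mulmx0.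
Qed.

End uniqueness.

(** * Integration against [s ds] *)

Section time_weighted_integrals.
Context {R : realType} (S : R).
Local Notation leb := (@lebesgue_measure R).
Implicit Types f g : R -> R.

(** Copy of the density in [sds], convertible to it. *)
Let weight (s : R) : R := s * \1_(`[0, S]) s.

Let weight_ge0 s : 0 <= weight s.
Proof.
rewrite /weight indicE; case: (boolP (s \in _)) => [|_]; last by rewrite mulr0.
by rewrite inE/= in_itv/= mulr1 => /andP[].
Qed.

Let measurable_weight : measurable_fun setT weight.
Proof. by apply: measurable_funM => //; exact: measurable_indic. Qed.

Import HBNNSimple.

Let sintegral_sds (h : {nnsfun R >-> R}) :
  sintegral (sds S) h = (\int[leb]_s (h s * weight s)%:E)%E.
Proof.
have mh r : measurable (h @^-1` [set r] : set (measurableTypeR R)).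
  exact: (measurable_funPTI h (measurable_set1 r)).
have mhw r : measurable_fun setT
    (fun s => (r * \1_(h @^-1` [set r]) s)%:E * (weight s)%:E)%E.
  apply: emeasurable_funM; last exact/measurable_EFinP.
  by apply/measurable_EFinP; exact: measurable_funM.
have hw0 r s : (0 <= (r * \1_(h @^-1` [set r]) s)%:E * (weight s)%:E)%E.
  by rewrite mule_ge0 ?lee_fin ?weight_ge0//; exact: nnfun_muleindic_ge0.
transitivity (\int[leb]_s (\sum_(r \in range h)
    ((r * \1_(h @^-1` [set r]) s)%:E * (weight s)%:E)))%E; last first.
  apply: eq_integral => s _; rewrite [RHS]EFinM (fimfunE h s) -fsumEFin//.
  by rewrite ge0_mule_fsuml// => r; exact: nnfun_muleindic_ge0.
rewrite ge0_integral_fsum// sintegralE; apply: eq_fsbigr => r rh.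
have r0 : 0 <= r by move: rh; rewrite inE => -[t _ <-].
under eq_integral do rewrite EFinM -muleA.
rewrite ge0_integralZl//; last 2 first.
- apply: emeasurable_funM; last exact/measurable_EFinP.
  by apply/measurable_EFinP; exact: measurable_indic.
- by move=> s _; rewrite mule_ge0 ?lee_fin ?weight_ge0.
congr (_ * _)%E; transitivity (\int[leb]_(s in h @^-1` [set r]) (weight s)%:E)%E => //.
rewrite [LHS]integral_mkcond; apply: eq_integral => s _.
by rewrite muleC epatch_indic.
Qed.

(* [f] need not be measurable: its integral is a supremum over simple functions
   below [f]. *)
Lemma sds_integral_le f g : (forall s, 0 <= f s) ->
  measurable_fun `[0, S] (fun s => s * g s) ->
  (forall s, 0 <= s <= S -> 0 <= g s) ->
  (\forall s \ae leb, 0 <= s <= S -> f s <= g s) ->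
  (\int[sds S]_s (f s)%:E <= \int[leb]_(s in `[0%R, S]) (s * g s)%:E)%E.
Proof.
move=> f0 mg g0 fg; rewrite ge0_integralTE; last by move=> s; rewrite lee_fin.
apply: ge_ereal_sup => _ [h /= hf <-]; rewrite [leLHS](sintegral_sds h).
rewrite [leRHS]integral_mkcond; apply: ae_ge0_le_integral => //.
- by move=> s _; rewrite lee_fin mulr_ge0// weight_ge0.
- by apply/measurable_EFinP; apply: measurable_funM => //; exact: (measurable_funP h).
- move=> s _; apply: erestrict_ge0 => {}s /=; rewrite in_itv/= => s0S.
  by rewrite lee_fin mulr_ge0 ?g0//; case/andP: s0S.
- by apply/(measurable_restrictT _ _).1 => //; exact/measurable_EFinP.
- apply: filterS fg => s fgs _; rewrite /weight patchE indicE.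
  case: ifPn => [sS|_]; last by rewrite !mulr0.
  rewrite mulr1 lee_fin mulrC; move: sS; rewrite inE/= in_itv/= => sS.
  rewrite ler_wpM2l ?(le_trans _ (fgs sS)) -?lee_fin//.
  by case/andP: sS.
Qed.

(** [sds S] has a density with respect to Lebesgue measure, and this density vanishes off
    [[0, S]]. *)
Lemma sds_ae (P : R -> Prop) : (\forall s \ae leb, 0 <= s <= S -> P s) ->
  \forall s \ae sds S, P s.
Proof.
move=> [N [mN N0 subN]].
have mC : measurable (~` `[0, S] : set (measurableTypeR R)) by exact: measurableC.
exists (N `|` ~` `[0, S]); split.
- exact: measurableU.
- transitivity (\int[leb]_(s in N `|` ~` `[0%R, S]) (weight s)%:E)%E => //.
  rewrite (ae_eq_integral (cst 0%E)) ?integral0//; first exact: measurableU.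
    by apply/measurable_EFinP; exact: measurable_funTS.
  exists N; split => // s /=; rewrite /weight => h; apply: contrapT => Ns; apply: h.
  by move=> [//|sS]; rewrite indicE memNset ?mulr0.
- move=> s /= nPs; have [sS|] := pselect (`[0, S]%classic s); last by right.
  by left; apply: subN => /= h; apply/nPs/h; move: sS; rewrite /= in_itv.
Qed.

Lemma sds_finite (B : R) : 0 <= B -> (\int[sds S]_s B%:E < +oo)%E.
Proof.
move=> B0; have [S0|S0] := leP 0 S; last first.
  apply: (@le_lt_trans _ _ 0%E) => //.
  apply: (le_trans (@sds_integral_le (fun=> B) (fun=> B) _ _ _ _)) => //.
    exact: measurable_funM.
    exact: nearW.
  by rewrite set_itv_ge ?integral_set0// bnd_simp -ltNge.
apply: (@le_lt_trans _ _ (\int[leb]_(s in `[0%R, S]) (S * B)%:E)%E).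
  apply: (le_trans (@sds_integral_le (fun=> B) (fun=> B) _ _ _ _)) => //.
    exact: measurable_funM.
    exact: nearW.
  apply: ge0_le_integral => //.
  - by move=> s; rewrite /= in_itv/= => /andP[s0 _]; rewrite lee_fin mulr_ge0.
  - by apply/measurable_EFinP; exact: measurable_funM.
  - by move=> s; rewrite /= in_itv/= => /andP[s0 sS]; rewrite lee_fin ler_wpM2r.
rewrite integral_cst//= lebesgue_measure_itv/=; case: ifP => _.
  by rewrite -EFinB -EFinM ltry.
by rewrite mule0.
Qed.

Lemma in_Lp_sds (p : R) f g B : 1 <= p -> measurable_fun setT g ->
  (forall s, `|g s| <= B) ->
  (\forall s \ae leb, 0 <= s <= S -> f s = g s) -> in_Lp (sds S) p%:E f.
Proof.
move=> p1 mg gB fg; exists g; last exact: sds_ae.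
have p0 : 0 <= p by rewrite (le_trans _ p1).
rewrite inE; apply/andP; split; first by rewrite inE.
rewrite inE /finite_norm unlock; apply: poweR_lty.
have B0 : 0 <= B by apply: le_trans (gB 0).
apply: (le_lt_trans _ (sds_finite (powR_ge0 B p))).
apply: ge0_le_integral => //.
- by move=> s _; exact: poweR_ge0.
- apply: (@measurableT_comp _ _ _ _ _ _ (fun x => x `^ p)%E) => //.
    exact: measurable_poweR.
  by apply: measurableT_comp => //; exact/measurable_EFinP.
- by move=> s _; rewrite /= lee_fin ge0_ler_powR// nnegrE.
Qed.

Lemma cvge_to0 {T : Type} {F : set_system T} {FF : Filter F} (u : T -> \bar R) :
  (forall t, 0 <= u t)%E ->
  (forall eta : R, 0 < eta -> \forall t \near F, (u t <= eta%:E)%E) ->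
  u @ F --> 0%E.
Proof.
move=> u0 Fu; have ufin t (eta : R) : (u t <= eta%:E)%E -> u t \is a fin_num.
  by move=> ut; rewrite ge0_fin_numE//; exact: (le_lt_trans ut (ltry _)).
apply/fine_cvgP; split; first by apply: filterS (Fu _ ltr01) => t; exact: ufin.
apply/cvgrPdist_le => eta eta0; apply: filterS (Fu _ eta0) => t ut /=.
by rewrite sub0r normrN ger0_norm ?fine_ge0// -lee_fin fineK// (ufin _ _ ut).
Qed.

Lemma cvg_Lnorm0 (p : R) (f_ : R -> R -> R) : 0 < p ->
  (forall eta : R, 0 < eta -> \forall e \near 0^'+,
     (\int[sds S]_s (`|f_ e s| `^ p)%:E <= eta%:E)%E) ->
  ('N[sds S]_p%:E[EFin \o f_ e])%E @[e --> 0^'+] --> 0%E.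
Proof.
move=> p0 fp; apply: cvge_to0 => [e|eta eta0]; first exact: Lnorm_ge0.
apply: filterS (fp _ (powR_gt0 p eta0)) => e fe; rewrite unlock /=.
have -> : eta%:E = ((eta `^ p)%:E `^ p^-1)%E.
  by rewrite poweR_EFin -powRrM divff ?gt_eqF// powRr1// ltW.
apply: gt0_ler_poweR => //.
- by rewrite invr_ge0 ltW.
- by rewrite in_itv/= leey andbT; apply: integral_ge0 => s _; rewrite lee_fin powR_ge0.
- by rewrite in_itv/= leey andbT lee_fin powR_ge0.
Qed.

End time_weighted_integrals.

(** * One-dimensional estimates for the smoothed potential *)

Section smoothed_potential.
Context {R : realType}.
Implicit Types m L w x t : R.

(* [dual_potential m L] is a convex function of slope [mirror_map m L]; as
   [m] grows it tends to 0 on ]-L, L[ and to +oo outside of [-L, L]. *)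
Definition mirror_map m L w := expR (2 * m * (w - L)) - expR (2 * m * (- w - L)).

Definition dual_potential m L w :=
  (expR (2 * m * (w - L)) + expR (2 * m * (- w - L))) / (2 * m).

Lemma expR_tangent (a b : R) : expR a * (1 + (b - a)) <= expR b.
Proof.
have -> : expR b = expR a * expR (b - a) by rewrite -expRD addrC subrK.
by rewrite ler_wpM2l ?expR_ge0// expR_ge1Dx.
Qed.

Lemma dual_potential_tangent m L w t : 0 < m ->
  mirror_map m L w * (t - w) <= dual_potential m L t - dual_potential m L w.
Proof.
move=> m0; rewrite /mirror_map /dual_potential -mulrBl ler_pdivlMr ?mulr_gt0//.
have := expR_tangent (2 * m * (w - L)) (2 * m * (t - L)).
have := expR_tangent (2 * m * (- w - L)) (2 * m * (- t - L)).
set a := expR _; set b := expR _; set c := expR _; set e := expR _.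
have -> : 2 * m * (- t - L) - 2 * m * (- w - L) = - (2 * m * (t - w)) by ring.
have -> : 2 * m * (t - L) - 2 * m * (w - L) = 2 * m * (t - w) by ring.
set h := 2 * m * (t - w) => h1 h2.
have -> : (c - a) * (t - w) * (2 * m) = (c - a) * h by rewrite /h; ring.
lra.
Qed.

Lemma dual_potential_ge0 m L w : 0 < m -> 0 <= dual_potential m L w.
Proof. by move=> m0; rewrite divr_ge0 ?addr_ge0 ?expR_ge0// mulr_ge0// ltW. Qed.

(** Beyond [L |x|] the conjugate has an entropy-like term of order [1 / m]; the quadratic is a crude
    bound for it that still vanishes with [m]. *)
Lemma dual_potential_fenchel m L w x : 0 < m ->
  w * x <= dual_potential m L w + L * `|x| + x ^+ 2 / m.
Proof.
have key (b y : R) : 0 <= y -> y * b <= expR b + 2 * y ^+ 2.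
  move=> y0; have [b0|b0] := leP b 0.
    by have := expR_ge0 b; have := sqr_ge0 y; nra.
  have : (1 + b / 2) ^+ 2 <= expR b.
    have -> : expR b = expR (b / 2) ^+ 2 by rewrite expr2 -expRD -splitr.
    rewrite lerXn2r ?nnegrE ?expR_ge0 ?expR_ge1Dx//; lra.
  have := sqr_ge0 (b / 2 - y); nra.
move=> m0; have m20 : 0 < 2 * m by rewrite mulr_gt0.
rewrite -(ler_pM2r m20) [leRHS]mulrDl [X in _ <= X + _]mulrDl.
rewrite [dual_potential m L w * _]divfK ?gt_eqF//.
have -> : x ^+ 2 / m * (2 * m) = 2 * x ^+ 2 by field; rewrite gt_eqF.
have [x0|x0] := leP 0 x.
  have := key (2 * m * (w - L)) x x0; have := expR_ge0 (2 * m * (- w - L)).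
  by rewrite ger0_norm//; lra.
have := key (2 * m * (- w - L)) (- x); have := expR_ge0 (2 * m * (w - L)).
rewrite ltr0_norm// oppr_ge0 sqrrN => h1 /(_ (ltW x0)); lra.
Qed.

Lemma dual_potential_box m L t : 0 < m -> `|t| <= L -> dual_potential m L t <= m^-1.
Proof.
move=> m0; rewrite ler_norml => /andP[t1 t2].
rewrite /dual_potential ler_pdivrMr ?mulr_gt0//.
have -> : m^-1 * (2 * m) = 1 + 1 by field; rewrite gt_eqF.
by rewrite lerD// -[leRHS]expR0 ler_expR; nra.
Qed.

(** One of the two exponentials is at most 1, which makes their sum comparable to their
    difference. *)
Lemma dual_potential_le m L w : 0 < m -> 0 <= L ->
  dual_potential m L w <= (`|mirror_map m L w| + 2) / (2 * m).
Proof.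
move=> m0 L0; rewrite /dual_potential /mirror_map ler_pM2r ?invr_gt0 ?mulr_gt0//.
set a := expR _; set b := expR _.
have [w0|w0] := leP 0 w.
  have : b <= 1 by rewrite -[leRHS]expR0 ler_expR; nra.
  by have := ler_norm (a - b); lra.
have : a <= 1 by rewrite -[leRHS]expR0 ler_expR; nra.
by have := ler_norm (b - a); rewrite distrC; lra.
Qed.

Lemma mirror_map_ge0 m L w : 0 < m -> 0 <= w -> 0 <= mirror_map m L w.
Proof. by move=> m0 w0; rewrite subr_ge0 ler_expR; nra. Qed.

Lemma mirror_map_le0 m L w : 0 < m -> w <= 0 -> mirror_map m L w <= 0.
Proof. by move=> m0 w0; rewrite subr_le0 ler_expR; nra. Qed.

Lemma mirror_map_small m L w r : 0 < m -> `|w| <= L - r ->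
  `|mirror_map m L w| <= expR (- (2 * m * r)).
Proof.
move=> m0; rewrite ler_norml => /andP[w1 w2]; rewrite /mirror_map.
have h1 : expR (2 * m * (w - L)) <= expR (- (2 * m * r)) by rewrite ler_expR; nra.
have h2 : expR (2 * m * (- w - L)) <= expR (- (2 * m * r)) by rewrite ler_expR; nra.
have := expR_ge0 (2 * m * (w - L)); have := expR_ge0 (2 * m * (- w - L)).
by rewrite ler_norml => h3 h4; apply/andP; split; lra.
Qed.

(* Fenchel's inequality for [dual_potential], used at both [z] (with weight
   [k]) and [x] (with weight [1 - k]), absorbs the potential of [W]. *)
Lemma coord_dissipation m L W o w ws x z lam k del B :
  0 < m -> 0 <= k <= 1 -> 0 < del -> `|w| <= lam -> w * x = lam * `|x| ->
  `|ws| <= lam - del -> `|o| <= k * del / 2 -> `|L - lam| <= k * del / 2 ->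
  `|x| <= B ->
  (W + o - ((1 - k) * w + k * ws)) *
    (k * z - mirror_map m L W + (1 - k) * x) <=
  k * ((`|z| + B) * (2 * lam + 2 * del)) + (1 + z ^+ 2 + B ^+ 2) / m.
Proof.
move=> m0 /andP[k0 k1] del0 wl wx wsl ol Ll xB.
set th := (1 - k) * w + k * ws; have lam0 : 0 <= lam by apply: le_trans wl.
have [w1 w2] : - lam <= w /\ w <= lam by move: wl; rewrite ler_norml => /andP.
have [s1 s2] : - (lam - del) <= ws /\ ws <= lam - del by move: wsl; rewrite ler_norml => /andP.
have [p1 p2] : - (k * del / 2) <= o /\ o <= k * del / 2 by move: ol; rewrite ler_norml => /andP.
have [L1 L2] : - (k * del / 2) <= L - lam /\ L - lam <= k * del / 2.
  by move: Ll; rewrite ler_norml => /andP.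
have k1' : 0 <= 1 - k by lra.
(* The contraction gains a margin [k * del]; one half pays for [o], the other for [L - lam]. *)
have th1 : th <= lam - k * del by rewrite /th; nra.
have th2 : - (lam - k * del) <= th by rewrite /th; nra.
have thL : `|th - o| <= L by rewrite ler_norml; apply/andP; split; lra.
have A1 := dual_potential_tangent L W (th - o) m0.
have A2 := dual_potential_box m0 thL.
have A3 := ler_wpM2l k0 (dual_potential_fenchel L W z m0).
have A4 := ler_wpM2l k1' (dual_potential_fenchel L W x m0).
have kdel : k * del <= del by rewrite ger_pMl.
have thn : `|o - th| <= lam + del.
  have kd0 := mulr_ge0 k0 (ltW del0); clear A1 A2 A3 A4 wx.
  by rewrite ler_norml; apply/andP; split; lra.
have A5 : (o - th) * z <= (lam + del) * `|z|.
  by rewrite (le_trans (ler_norm _))// normrM ler_wpM2r.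
(* As [w x = lam |x|], the terms of order one cancel and what is left is proportional to [k]. *)
have A6 : (1 - k) * ((o - th) * x + L * `|x|) <= k * (B * (2 * lam + 2 * del)).
  clear A1 A2 A3 A4 A5 thn thL; have x0 := normr_ge0 x.
  have ox : o * x <= k * del / 2 * `|x|.
    by rewrite (le_trans (ler_norm _))// normrM ler_wpM2r.
  have wsx : - ws * x <= lam * `|x|.
    rewrite (le_trans (ler_norm _))// normrM normrN ler_wpM2r//; lra.
  have Lx : (L - lam) * `|x| <= k * del / 2 * `|x| by rewrite ler_wpM2r.
  have -> : (o - th) * x = o * x - (1 - k) * (lam * `|x|) + k * (- ws * x).
    by rewrite -wx /th; ring.
  have H := ler_wpM2l k0 wsx.
  have S1 : o * x - (1 - k) * (lam * `|x|) + k * (- ws * x) + L * `|x| <=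
    k * (`|x| * (2 * lam + del)) by lra.
  have S2 : k * (`|x| * (2 * lam + del)) <= k * (B * (2 * lam + 2 * del)).
    by rewrite ler_wpM2l// ler_pM//; lra.
  have S3 : 0 <= k * (B * (2 * lam + 2 * del)).
    by rewrite mulr_ge0//; apply: mulr_ge0; [exact: le_trans xB|lra].
  apply: (@le_trans _ _ ((1 - k) * (k * (B * (2 * lam + 2 * del))))).
    by rewrite ler_wpM2l// (le_trans S1).
  by rewrite ler_piMl//; lra.
have A7 : k * (L * `|z|) <= k * ((lam + del) * `|z|).
  by rewrite ler_wpM2l// ler_wpM2r//; clear - L2 kdel del0; lra.
have A8 := ler_wpM2l k0 A5.
have m1 : 0 < m^-1 by rewrite invr_gt0.
have A9 : k * (z ^+ 2 / m) <= z ^+ 2 / m.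
  by rewrite ler_piMl// divr_ge0 ?sqr_ge0 ?ltW.
have A10 : (1 - k) * (x ^+ 2 / m) <= B ^+ 2 / m.
  apply: (@le_trans _ _ (x ^+ 2 / m)).
    by rewrite ler_piMl ?(divr_ge0 (sqr_ge0 _) (ltW m0))//; clear - k0; lra.
  by rewrite ler_pM2r// -real_normK ?num_real// ler_sqr ?nnegrE// (le_trans _ xB).
have -> : (1 + z ^+ 2 + B ^+ 2) / m = m^-1 + z ^+ 2 / m + B ^+ 2 / m.
  by rewrite !mulrDl mul1r.
set X := mirror_map m L W in A1 *; set P := dual_potential m L W in A1 A3 A4.
have -> : (W + o - th) * (k * z - X + (1 - k) * x) =
  k * (W * z) + k * ((o - th) * z) + X * (th - o - W) + (1 - k) * (W * x) +
  (1 - k) * ((o - th) * x) by ring.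
lra.
Qed.

(** The tangent inequality is tested at [ws - o] moved by [del / 2] in the direction of the sign of
    [mirror_map m L W]. This point is still within [L] of 0, and the move produces the negative
    term. *)
Lemma coord_coercive m L W o ws z lam del :
  0 < m -> 0 < del -> `|ws| <= lam - del -> `|o| <= del / 4 ->
  `|L - lam| <= del / 4 ->
  (W + o - ws) * (z - mirror_map m L W) <=
  (1 + z ^+ 2) / m + `|z| * (2 * lam + 2 * del) -
    del / 2 * `|mirror_map m L W|.
Proof.
move=> m0 del0 wsl ol Ll.
have [s1 s2] : - (lam - del) <= ws /\ ws <= lam - del by move: wsl; rewrite ler_norml => /andP.
have [p1 p2] : - (del / 4) <= o /\ o <= del / 4 by move: ol; rewrite ler_norml => /andP.
have [L1 L2] : - (del / 4) <= L - lam /\ L - lam <= del / 4 by move: Ll; rewrite ler_norml => /andP.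
set X := mirror_map m L W.
have A1 : X * (ws - o - W) + del / 2 * `|X| <= m^-1 - dual_potential m L W.
  have [X0|X0] := leP 0 X.
    have h : `|ws - o + del / 2| <= L by rewrite ler_norml; apply/andP; split; lra.
    have := dual_potential_tangent L W (ws - o + del / 2) m0.
    by have := dual_potential_box m0 h; rewrite -/X ger0_norm//; lra.
  have h : `|ws - o - del / 2| <= L by rewrite ler_norml; apply/andP; split; lra.
  have := dual_potential_tangent L W (ws - o - del / 2) m0.
  by have := dual_potential_box m0 h; rewrite -/X ltr0_norm//; lra.
have A2 := dual_potential_fenchel L W z m0.
have A3 : (o - ws) * z <= (lam + del) * `|z|.
  rewrite (le_trans (ler_norm _))// normrM ler_wpM2r// ler_norml.
  by apply/andP; split; lra.
have A4 : L * `|z| <= (lam + del) * `|z| by rewrite ler_wpM2r//; lra.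
have -> : (1 + z ^+ 2) / m = m^-1 + z ^+ 2 / m by rewrite mulrDl mul1r.
have -> : (W + o - ws) * (z - X) = W * z + (o - ws) * z + X * (ws - o - W) by ring.
lra.
Qed.

End smoothed_potential.

(** * Growth and integrals controlled by pointwise derivatives *)

Section growth.
Context {R : realType}.
Implicit Types (f g G : R -> R) (a b K : R).
Local Notation leb := (@lebesgue_measure R).

Lemma derive_le0_nincr f a b : a <= b -> {within `[a, b], continuous f} ->
  (forall s, a < s < b -> exists2 df, is_derive s 1 f df & df <= 0) ->
  f b <= f a.
Proof.
move=> ab cf fd; apply: (@ler0_derive1_le_cc _ f a b) => //.
- by move=> s; rewrite in_itv/= => /fd[df []].
- by move=> s; rewrite in_itv/= => /fd[df [_ <-]]; rewrite derive1E.
- by rewrite in_itv/= lexx ab.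
- by rewrite in_itv/= lexx ab.
Qed.

Lemma derive_le_growth f a b K : a <= b -> {within `[a, b], continuous f} ->
  (forall s, a < s < b -> exists2 df, is_derive s 1 f df & df <= K) ->
  f b - f a <= K * (b - a).
Proof.
move=> ab cf fd.
have : f b - K * b <= f a - K * a; last by lra.
apply: (@derive_le0_nincr (fun s => f s - K * s)) => //.
  move=> s; apply: cvgB; first exact: cf.
  by apply: cvgM; [exact: cvg_cst|apply: continuous_subspaceT => x; exact: cvg_id].
move=> s /fd[df fdf dfK]; exists (df - K *: 1).
  exact: (is_deriveB fdf (@is_deriveZ _ _ _ id K s 1 1 (is_derive_id s 1))).
by rewrite /GRing.scale/= mulr1 subr_le0.
Qed.

Lemma derive_eq0_const f a b : a <= b -> {within `[a, b], continuous f} ->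
  (forall s, a < s < b -> is_derive s 1 f 0) -> f b = f a.
Proof.
move=> ab cf fd; apply/eqP; rewrite eq_le; apply/andP; split.
  by apply: derive_le0_nincr => // s /fd; exists 0.
rewrite -lerN2; apply: (@derive_le0_nincr (fun s => - f s)) => //.
  by move=> s; apply: cvgN; exact: cf.
by move=> s /fd fs; exists 0 => //; rewrite -oppr0; exact: is_deriveN.
Qed.

(** The primitive of [f] minus [G] is nonincreasing. The interval is half-open, like those on which
    the primal variable is constant. *)
Lemma integral_le_growth f G a b : a <= b -> {within `[a, b], continuous f} ->
  {within `[a, b], continuous G} ->
  (forall s, a < s < b -> exists2 dG, is_derive s 1 G dG & f s <= dG) ->
  (\int[leb]_(s in `[a, b[) (f s)%:E <= (G b - G a)%:E)%E.
Proof.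
rewrite le_eqVlt => /predU1P[<-|ab] cf cG Gd.
  by rewrite set_itv_ge ?integral_set0 ?subrr// bnd_simp ltxx.
have fi : leb.-integrable `[a, b] (EFin \o f).
  by apply: continuous_compact_integrable => //; exact: segment_compact.
rewrite integral_itv_bndo_bndc; last first.
  by apply: measurable_funS (measurable_int _ fi) => //; exact: subset_itv_co_cc.
pose P x := (\int[leb]_(t in `[a, x]) f t)%R.
have cP : {within `[a, b], continuous P}.
  by apply: parameterized_integral_continuous => //; exact: ltW.
have : P b - G b <= P a - G a.
  apply: (@derive_le0_nincr (fun s => P s - G s)) => //; first exact: ltW.
    by move=> s; apply: cvgB; [exact: cP|exact: cG].
  move=> s /andP[as_ sb]; have [|dG Gs fdG] := Gd s; first by rewrite as_.
  have cfs : {for s, continuous f}.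
    have /continuous_within_itvP[//|+ _ _] := cf.
    by apply; rewrite in_itv/= as_.
  have [Pd PE] := continuous_FTC1_closed sb fi as_ cfs.
  exists (f s - dG); last by rewrite subr_le0.
  apply: (is_deriveB _ Gs).
  by apply: DeriveDef; [exact: Pd|rewrite -derive1E; exact: PE].
have -> : P a = 0 by rewrite /P set_itv1 Rintegral_set1.
rewrite sub0r => PG.
rewrite -[leLHS]fineK; last exact: integrable_fin_num.
by rewrite lee_fin; move: PG; rewrite /P /Rintegral /=; lra.
Qed.

End growth.

Section spans.
Context {R : realType} {d : nat} (M : 'M[R]_d).
Implicit Types x y : 'cV[R]_d.

Lemma colspanD x y : colspan M x -> colspan M y -> colspan M (x + y).
Proof. by move=> [a _ <-] [b _ <-]; exists (a + b) => //; rewrite mulmxDr. Qed.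

Lemma colspanZ (k : R) x : colspan M x -> colspan M (k *: x).
Proof. by move=> [a _ <-]; exists (k *: a) => //; rewrite scalemxAr. Qed.

Lemma colspanB x y : colspan M x -> colspan M y -> colspan M (x - y).
Proof. by move=> Mx My; rewrite -scaleN1r; apply/colspanD/colspanZ. Qed.

Lemma colspan0 : colspan M 0.
Proof. by exists 0 => //; rewrite mulmx0. Qed.

Lemma colspan_ginv (N : 'M[R]_d) x : M *m N *m M = M -> colspan M x ->
  x = M *m (N *m x).
Proof. by move=> MNM [a _ <-]; rewrite !mulmxA MNM. Qed.

End spans.

(** * Derivatives and limits of the exponential maps *)

Section smoothed_derivatives.
Context {R : realType}.

Lemma is_derive_expR_affine (f : R -> R) (s df k c : R) : is_derive s 1 f df ->
  is_derive s 1 (fun t => expR (k * (f t - c))) (expR (k * (f s - c)) * (k * df)).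
Proof.
move=> fd; have gd : is_derive s 1 (fun t => k * (f t - c)) (k * df).
  have fcd := is_deriveB fd (is_derive_cst c s 1).
  apply: (is_derive_eq (@is_deriveZ _ _ _ _ k s 1 _ fcd)).
  by rewrite subr0.
exact: (@is_derive1_comp R expR (fun t => k * (f t - c)) s _ _ (is_derive_expR _) gd).
Qed.

Lemma is_derive_dual_potential m L (f : R -> R) (s df : R) : 0 < m ->
  is_derive s 1 f df ->
  is_derive s 1 (fun t => dual_potential m L (f t)) (mirror_map m L (f s) * df).
Proof.
move=> m0 fd; have d1 := is_derive_expR_affine (2 * m) L fd.
have d2 := is_derive_expR_affine (2 * m) L (is_deriveN fd).
rewrite /dual_potential.
under eq_fun do rewrite mulrC.
apply: (is_derive_eq (@is_deriveZ _ _ _ _ (2 * m)^-1 s 1 _ (is_deriveD d1 d2))).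
rewrite /GRing.scale/= /mirror_map.
set a := expR _; set b := expR _.
by field; rewrite gt_eqF.
Qed.

Lemma cvg_expR_affine (T : Type) (F : set_system T) {FF : Filter F} (k c : R)
    (f : T -> R) (y : R) : f @ F --> y ->
  expR (k * (f t - c)) @[t --> F] --> expR (k * (y - c)).
Proof.
move=> fy; apply: (cvg_comp (fun t => k * (f t - c)) expR); last exact: continuous_expR.
by apply: cvgM; [exact: cvg_cst|apply: cvgB => //; exact: cvg_cst].
Qed.

Lemma cvg_mirror_map (T : Type) (F : set_system T) {FF : Filter F} m L
    (f : T -> R) (y : R) : f @ F --> y ->
  mirror_map m L (f t) @[t --> F] --> mirror_map m L y.
Proof.
by move=> fy; apply: cvgB; apply: cvg_expR_affine => //; exact: cvgN.
Qed.

Lemma cvg_dual_potential (T : Type) (F : set_system T) {FF : Filter F} m L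
    (f : T -> R) (y : R) : f @ F --> y ->
  dual_potential m L (f t) @[t --> F] --> dual_potential m L y.
Proof.
move=> fy; apply: cvgM; last exact: cvg_cst.
by apply: cvgD; apply: cvg_expR_affine => //; exact: cvgN.
Qed.

End smoothed_derivatives.

(** * Half the squared norm on Span M that is dual to the seminorm of [M] *)

Section dual_norm.
Context {R : realType} {d : nat}.
Variables (M N : 'M[R]_d).
Hypotheses (symM : M^T = M) (psdM : psd M).
Hypotheses (symN : N^T = N) (psdN : psd N) (MNM : M *m N *m M = M).
Implicit Types b y : 'cV[R]_d.

Definition dual_energy b := 2^-1 * dotp b (N *m b).

Lemma dual_energy_ge0 b : 0 <= dual_energy b.
Proof. by rewrite mulr_ge0// psdN. Qed.

Lemma is_derive_dual_energy (s : R) (b : R -> 'cV[R]_d) y :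
  colspan M (b s) -> col_derive s b (M *m y) ->
  is_derive s 1 (fun t => dual_energy (b t)) (dotp (b s) y).
Proof.
move=> bspan bd; have h := is_derive_dotp bd (col_derive_mulmx N bd).
apply: (is_derive_eq (@is_deriveZ _ _ _ _ 2^-1 s 1 _ h)).
rewrite (dotp_symC _ _ symN) (dotp_ginv symM y symN MNM (colspan_ginv MNM bspan)).
by rewrite /GRing.scale/=; field.
Qed.

(** Cauchy-Schwarz for [N] between [b] and [M e_i], since [<M e_i, N b> = b_i] and
    [<M e_i, N M e_i> = M_ii]. *)
Lemma dual_energy_coord b i : colspan M b ->
  b i 0 ^+ 2 <= 2 * M i i * dual_energy b.
Proof.
move=> bspan; have bE := colspan_ginv MNM bspan.
have := psd_cauchy_schwarz symN psdN (M *m delta_mx i 0) b.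
have -> : dotp (M *m delta_mx i 0) (N *m b) = b i 0.
  by rewrite -{1}symM -dotp_mulmx -bE dotp_delta.
have -> : dotp (M *m delta_mx i 0) (N *m (M *m delta_mx i 0)) = M i i.
  rewrite -{1}symM -dotp_mulmx !mulmxA MNM dotp_delta -colE mxE//.
by rewrite /dual_energy => /le_trans; apply; lra.
Qed.

Lemma cvg_dual_energy (T : Type) (F : set_system T) {FF : Filter F}
    (b : T -> 'cV[R]_d) (y : 'cV[R]_d) :
  (forall i, b t i 0 @[t --> F] --> y i 0) ->
  dual_energy (b t) @[t --> F] --> dual_energy y.
Proof.
move=> bF; apply: cvgM; first exact: cvg_cst.
by apply: cvg_dotp => // i; exact: cvg_mulmx_col.
Qed.

End dual_norm.

(** * The smoothed flow compared with the limiting one, for fixed [m] *)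

Section smoothed_flow.
Context {R : realType} {d : nat}.
Variables (M : 'M[R]_d) (z : 'cV[R]_d).
Hypotheses (symM : M^T = M) (psdM : psd M).
Let q := M *m z.
Variable N : 'M[R]_d.
Hypotheses (symN : N^T = N) (psdN : psd N) (MNM : M *m N *m M = M).
Variables (lam : 'cV[R]_d) (w x : R -> 'cV[R]_d) (B delta : R) (ws : 'cV[R]_d).
Hypothesis delta0 : 0 < delta.
Hypothesis wcont : forall i, {within `[0, +oo[, continuous (fun s => w s i 0)}.
Hypothesis wflow : forall S : R, 0 <= S -> piecewise_flow M z lam w x B 0 S.
Hypothesis wsspan : colspan M (ws - w 0).
Hypothesis wsint : forall i, `|ws i 0| <= lam i 0 - delta.

Definition mirror_col m (L v : 'cV[R]_d) : 'cV[R]_d :=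
  \col_i mirror_map m (L i 0) (v i 0).

(** The rescaled network in integrated variables. [W 0] is left free, as it only tends to [w 0]; the
    offset is carried along as [o]. *)
Definition smoothed_flow m (L : 'cV[R]_d) (W : R -> 'cV[R]_d) :=
  [/\ 0 < m, forall i, 0 <= L i 0,
      forall i, {within `[0, +oo[, continuous (fun s => W s i 0)} &
      forall s, 0 < s -> col_derive s W (M *m (z - mirror_col m L (W s)))].

Lemma piece_derive (v : R -> 'cV[R]_d) (r : 'cV[R]_d) a b s : a < s < b ->
  (forall t, a <= t <= b -> v t = v a + (t - a) *: r) -> col_derive s v r.
Proof.
move=> /andP[as_ sb] vE i.
apply: (@near_eq_is_derive _ _ _ (fun t => v a i 0 + (t - a) * r i 0)).
  near=> t; rewrite [v t]vE; first by rewrite !mxE.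
  have : t \in `]a, b[ by near: t; apply: near_in_itvoo; rewrite in_itv/= as_.
  by rewrite in_itv/= => /andP[/ltW-> /ltW->].
have h := is_deriveB (is_derive_id s 1) (is_derive_cst a s 1).
have h2 := is_deriveM h (is_derive_cst (r i 0) s 1).
apply: (is_derive_eq (is_deriveD (is_derive_cst (v a i 0) s 1) h2)).
by rewrite /GRing.scale/= subr0 mulr0 !add0r mulr1.
Unshelve. all: by end_near. Qed.

Lemma within_segment (f : R -> R) a b : 0 <= a ->
  {within `[0, +oo[, continuous f} -> {within `[a, b], continuous f}.
Proof.
move=> a0; apply: continuous_subspaceW => s /=.
by rewrite !in_itv/= andbT => /andP[/(le_trans a0)].
Qed.

Lemma smoothed_flow_continuous m L W (a e : R) i : smoothed_flow m L W ->
  0 <= a -> {within `[a, e], continuous (fun s => mirror_col m L (W s) i 0)}.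
Proof.
move=> [m0 L0 cW dW] a0 s.
rewrite (_ : (fun t => _) = fun t => mirror_map m (L i 0) (W t i 0)).
  by apply: cvg_mirror_map; exact: within_segment.
by apply/funext => t; rewrite mxE.
Qed.

Lemma piecewise_span a c : 0 <= a -> piecewise_flow M z lam w x B a c ->
  a <= c /\ colspan M (w c - w a).
Proof.
move=> + p; elim: p => {a c} [a _|a b c xa ab xE xB wE _ IH a0].
  by rewrite subrr; split=> //; exact: colspan0.
have [bc cb] := IH (le_trans a0 (ltW ab)); split; first by rewrite (le_trans (ltW ab)).
rewrite -(subrKA (w b)); apply: colspanD => //.
have [|-> _] := wE b; first by rewrite (ltW ab) lexx.
rewrite addrC addKr; apply: colspanZ; exists (z - xa) => //.
by rewrite mulmxBr.
Qed.

Lemma path_span s : 0 <= s -> colspan M (w s - w 0).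
Proof. by move=> s0; have [] := piecewise_span (lexx 0) (wflow s0). Qed.

(** [a < c] rules out the empty path, which says nothing about [w]. *)
Lemma piecewise_box a c : 0 <= a -> piecewise_flow M z lam w x B a c ->
  a < c -> in_box lam (w a) /\ in_box lam (w c).
Proof.
move=> + p; elim: p => {a c} [a _|a b c xa ab xE xB wE p IH a0 ac].
  by rewrite ltxx.
have b0 := le_trans a0 (ltW ab); have [bc _] := piecewise_span b0 p.
split=> i.
  by have [|_ /(_ i)[]] := wE a; first by rewrite lexx ltW.
move: bc; rewrite le_eqVlt => /predU1P[<-|bc]; last by have [] := IH b0 bc.
by have [|_ /(_ i)[]] := wE b; first by rewrite lexx ltW.
Qed.

Lemma path_box s : 0 <= s -> in_box lam (w s).
Proof.
rewrite le_eqVlt => /predU1P[<-|s0].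
  by have [] := piecewise_box (lexx 0) (wflow ler01) ltr01.
by have [] := piecewise_box (lexx 0) (wflow (ltW s0)) s0.
Qed.

Section given_smoothing.
Variables (m : R) (L : 'cV[R]_d) (W : R -> 'cV[R]_d).
Hypothesis smW : smoothed_flow m L W.
Let X s := mirror_col m L (W s).
Let o := w 0 - W 0.

Lemma smoothed_span s : 0 <= s -> colspan M (W s - W 0).
Proof.
have [_ _ cW dW] := smW; move=> s0; pose D := 1%:M - M *m N.
have DM : D *m M = 0 by rewrite mulmxBl mul1mx MNM subrr.
suff DW : D *m W s = D *m W 0.
  exists (N *m (W s - W 0)) => //.
  apply/eqP; rewrite eq_sym -subr_eq0 mulmxA -{1}[W s - W 0]mul1mx -mulmxBl.
  by rewrite -/D mulmxBr DW subrr.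
apply/colP => i.
apply: (@derive_eq0_const _ (fun t => (D *m W t) i 0)) => //.
  by move=> t; apply: cvg_mulmx_col => j; exact: within_segment.
move=> t /andP[t0 _]; have := col_derive_mulmx D (dW _ t0) i.
by rewrite mulmxA DM mul0mx mxE.
Qed.

Section comparison.
Variable k : R.
Hypothesis k01 : 0 <= k <= 1.
Hypothesis oL : forall i, `|o i 0| <= k * delta / 2 /\ `|L i 0 - lam i 0| <= k * delta / 2.
(** Adding [o] makes both trajectories start at [w 0], so that [b] stays in Span M even if
    [W 0 - w 0] does not lie there. *)
Let b s := W s + o - ((1 - k) *: w s + k *: ws).

Let bE s i : b s i 0 = W s i 0 + o i 0 - ((1 - k) * w s i 0 + k * ws i 0).
Proof. by rewrite /b /o !mxE. Qed.

Let bfunE i :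
  (fun s => b s i 0) = fun s => W s i 0 + o i 0 - ((1 - k) * w s i 0 + k * ws i 0).
Proof. by apply/funext => s; rewrite bE. Qed.

Let b_continuous a e i : 0 <= a -> {within `[a, e], continuous (fun s => b s i 0)}.
Proof.
have [_ _ cW _] := smW; move=> a0; rewrite bfunE => s.
apply: cvgB; first by apply: cvgD; [exact: within_segment|exact: cvg_cst].
apply: cvgD; last exact: cvg_cst.
by apply: cvgM; [exact: cvg_cst|exact: within_segment].
Qed.

Let b_span s : 0 <= s -> colspan M (b s).
Proof.
move=> s0; have -> : b s = (W s - W 0) - (1 - k) *: (w s - w 0) - k *: (ws - w 0).
  by apply/colP => i; rewrite !mxE; ring.
apply: colspanB; last exact: colspanZ.
by apply: colspanB; [exact: smoothed_span|apply: colspanZ; exact: path_span].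
Qed.

Let C1 := \sum_i (`|z i 0| + B) * (2 * lam i 0 + 2 * delta).
Let C2 := \sum_i (1 + z i 0 ^+ 2 + B ^+ 2).

(** The contraction contributes the rate [k * C1], the smoothing [C2 / m]. *)
Lemma dual_energy_growth a c : 0 <= a -> piecewise_flow M z lam w x B a c ->
  dual_energy N (b c) - dual_energy N (b a) <= (k * C1 + C2 / m) * (c - a).
Proof.
have [m0 L0 cW dW] := smW.
move=> + p; elim: p => {a c} [a _|a e c xa ae xE xB wE p IH a0].
  by rewrite !subrr mulr0.
have e0 : 0 <= e by rewrite (le_trans a0)// ltW.
have {}IH := IH e0.
suff : dual_energy N (b e) - dual_energy N (b a) <= (k * C1 + C2 / m) * (e - a).
  by move: IH; lra.
apply: (@derive_le_growth _ (fun s => dual_energy N (b s))); first exact: ltW.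
  by move=> s; apply: cvg_dual_energy => i; apply: b_continuous.
move=> s /andP[as_ se]; have s0 : 0 < s by exact: le_lt_trans as_.
pose y := k *: z - X s + (1 - k) *: xa.
have wd : col_derive s w (M *m (z - xa)).
  rewrite mulmxBr; apply: (@piece_derive _ _ a e); first by rewrite as_.
  by move=> t /wE[].
have bd : col_derive s b (M *m y).
  move=> i; have Wi := dW _ s0 i; have wi := wd i.
  rewrite bfunE.
  have h1 := is_deriveD Wi (is_derive_cst (o i 0) s 1).
  have h2 := is_deriveD (@is_deriveZ _ _ _ _ (1 - k) s 1 _ wi) (is_derive_cst (k * ws i 0) s 1).
  apply: (is_derive_eq (is_deriveB h1 h2)).
  rewrite !addr0 /y /GRing.scale/=.
  have -> : k *: z - X s + (1 - k) *: xa = (z - X s) - (1 - k) *: (z - xa).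
    by apply/colP => j; rewrite !mxE; ring.
  by rewrite [in RHS]mulmxBr -scalemxAr !mxE.
exists (dotp (b s) y); first exact: is_derive_dual_energy (b_span (ltW s0)) bd.
have ses : a <= s <= e by rewrite !ltW.
have [_ sub] := wE _ ses.
rewrite /dotp /C1 /C2 mulr_sumr mulr_suml -big_split/= ler_sum// => i _.
have [wl wx] := sub i; have [ol Ll] := oL i.
have := coord_dissipation (W s i 0) (z i 0) m0 k01 delta0 wl wx (wsint i) ol Ll (xB i).
by rewrite bE /y !mxE; apply: le_trans.
Qed.

(** The summands account for the offset, the contraction and the energy of [b], which is [k ^+ 2]
    times that of [ws - w 0] at the start. *)
Lemma comparison_bound s i : 0 <= s ->
  `|W s i 0 - w s i 0| <= k * delta / 2 + 2 * k * lam i 0 +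
    Num.sqrt (2 * M i i *
      (k ^+ 2 * dual_energy N (ws - w 0) + (k * C1 + C2 / m) * s)).
Proof.
move=> s0; have [ol _] := oL i; have [k0 k1] := andP k01.
have Vs : dual_energy N (b s) <=
    k ^+ 2 * dual_energy N (ws - w 0) + (k * C1 + C2 / m) * s.
  have := dual_energy_growth (lexx 0) (wflow s0); rewrite subr0 lerBlDl.
  move=> /le_trans; apply; rewrite lerD2r.
  have -> : b 0 = (- k) *: (ws - w 0) by apply/colP => j; rewrite !mxE; ring.
  by rewrite /dual_energy -scalemxAr !dotp_lin; nra.
have lw : `|w s i 0| <= lam i 0.
  exact: path_box.
have wsl : `|ws i 0| <= lam i 0 by rewrite (le_trans (wsint i))// lerBlDr lerDl ltW.
have Mii : 0 <= M i i.
  have := psdM (delta_mx i 0); by rewrite dotp_delta -colE mxE.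
have bi : `|b s i 0| <= Num.sqrt (2 * M i i *
      (k ^+ 2 * dual_energy N (ws - w 0) + (k * C1 + C2 / m) * s)).
  rewrite -sqrtr_sqr ler_wsqrtr//.
  apply: (le_trans (dual_energy_coord symM symN psdN MNM i (b_span s0))).
  by rewrite ler_wpM2l// mulr_ge0.
have -> : W s i 0 - w s i 0 = - o i 0 + (k * ws i 0 + (- k) * w s i 0) + b s i 0.
  by rewrite bE; ring.
rewrite (le_trans (ler_normD _ _))// lerD//.
rewrite (le_trans (ler_normD _ _))// normrN lerD//.
rewrite (le_trans (ler_normD _ _))// !normrM normrN (ger0_norm k0).
have := ler_wpM2l k0 lw; have := ler_wpM2l k0 wsl; lra.
Qed.

End comparison.

Section loss_gap.
Hypothesis oL : forall i, `|o i 0| <= delta / 4 /\ `|L i 0 - lam i 0| <= delta / 4.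
Local Notation leb := (@lebesgue_measure R).

Let b s := W s + o - ws.
Let F s := \sum_i dual_potential m (L i 0) (W s i 0).
Let C3 := \sum_i ((1 + z i 0 ^+ 2) / m + `|z i 0| * (2 * lam i 0 + 2 * delta)).
(** Its derivative dominates [F / 2], the term left by integrating [s F'] by parts: [F] is bounded
    through [|X|], and [|X|] through the decrease of the energy. *)
Let corr s := (4 * m)^-1 *
  (2 * d%:R * s + 2 / delta * (C3 * s - dual_energy N (b s))).

Definition boundary s := - 2^-1 * (s * F s) + corr s.

(** Bregman divergence of the loss between [X s] and [y]. *)
Definition gap (s : R) y := 2^-1 * dotp (X s - y) (M *m (X s - y)).

Let bE s i : b s i 0 = W s i 0 + (o i 0 - ws i 0).
Proof. by rewrite /b /o !mxE; ring. Qed.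

Let bfunE i : (fun s => b s i 0) = fun s => W s i 0 + (o i 0 - ws i 0).
Proof. by apply/funext => s; rewrite bE. Qed.

Let b_span s : 0 <= s -> colspan M (b s).
Proof.
move=> s0; have -> : b s = (W s - W 0) - (ws - w 0).
  by apply/colP => i; rewrite !mxE; ring.
by apply: colspanB => //; exact: smoothed_span.
Qed.

(** The comparison with the fixed point [ws], that is, [k = 1] in the previous one; integrated in
    time it bounds [|X|] in L^1. *)
Lemma dual_energy_coercive (s : R) : 0 < s -> exists2 dE : R,
  is_derive s 1 (fun t => dual_energy N (b t)) dE &
  dE <= C3 - delta / 2 * \sum_i `|X s i 0|.
Proof.
have [m0 L0 cW dW] := smW; move=> s0; exists (dotp (b s) (z - X s)).
  apply: (is_derive_dual_energy symM symN MNM (b_span (ltW s0))).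
  move=> i; rewrite bfunE; have Wi := dW _ s0 i.
  apply: (is_derive_eq (is_deriveD Wi (is_derive_cst (o i 0 - ws i 0) s 1))).
  by rewrite addr0.
rewrite /dotp /C3 mulr_sumr -sumrB ler_sum// => i _; have [ol Ll] := oL i.
have := coord_coercive (W s i 0) (z i 0) m0 delta0 (wsint i) ol Ll.
by rewrite bE /X !mxE !addrA.
Qed.

(* On a piece, the loss gap is an exact derivative. *)
Lemma gap_primitive (s : R) y : 0 < s -> col_derive s w (M *m (z - y)) ->
  dotp (M *m (z - y)) y = 0 ->
  is_derive s 1 (fun t => - 2^-1 * F t + dotp (W t - w t) (y - 2^-1 *: z)) (gap s y).
Proof.
have [m0 L0 cW dW] := smW; move=> s0 wd yw.
have Fd : is_derive s 1 F (dotp (X s) (M *m (z - X s))).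
  apply: is_derive_bigsum => i; rewrite mxE.
  exact: is_derive_dual_potential (dW _ s0 i).
have Wwd := col_deriveB (dW _ s0) wd.
have h := is_derive_dotp Wwd (col_derive_cst s (y - 2^-1 *: z)).
apply: (is_derive_eq (is_deriveD (@is_deriveZ _ _ _ _ (- 2^-1) s 1 _ Fd) h)).
rewrite dotp0r addr0 /gap /GRing.scale/=.
have e1 : M *m (z - X s) - M *m (z - y) = M *m y - M *m X s.
  by rewrite !mulmxBr; apply/colP => i; rewrite !mxE; ring.
move: yw; rewrite e1 !mulmxBr !dotp_lin.
rewrite !(dotpC (M *m _)) (dotp_symC z (X s) symM) (dotp_symC z y symM).
rewrite (dotp_symC y (X s) symM); lra.
Qed.

Lemma gap_continuous y (a c : R) : 0 <= a -> {within `[a, c], continuous (fun s => s * gap s y)}.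
Proof.
have [m0 L0 cW dW] := smW; move=> a0 s.
have cX i : X t i 0 @[t --> nbhs (s : subspace `[a, c])] --> X s i 0.
  exact: (@smoothed_flow_continuous m L W a c i smW a0 s).
have cXy i : (X t - y) i 0 @[t --> nbhs (s : subspace `[a, c])] --> (X s - y) i 0.
  rewrite !mxE (_ : (fun t => _) = fun t => X t i 0 - y i 0).
    by apply: cvgB; [move: (cX i); rewrite /X mxE|exact: cvg_cst].
  by apply/funext => t; rewrite !mxE.
apply: cvgM; first by apply: continuous_subspaceT => t; exact: cvg_id.
apply: cvgM; first exact: cvg_cst.
by apply: cvg_dotp => // i; exact: cvg_mulmx_col.
Qed.

Lemma potential_continuous (a c : R) : 0 <= a -> {within `[a, c], continuous F}.
Proof.
have [m0 L0 cW dW] := smW; move=> a0 s; apply: cvg_big => [|i _]; first exact: add_continuous.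
by apply: cvg_dual_potential; exact: within_segment.
Qed.

Lemma piece_gap_integral (a c : R) y (eta : R) : 0 <= a -> a < c ->
  (forall s, a <= s <= c ->
    w s = w a + (s - a) *: (q - M *m y) /\ l1_subgradient lam y (w s)) ->
  (forall s, a <= s <= c -> `|dotp (W s - w s) (y - 2^-1 *: z)| <= eta) ->
  (\int[leb]_(s in `[a, c[) (s * gap s y)%:E <=
   (boundary c - boundary a + 2 * c * eta)%:E)%E.
Proof.
have [m0 L0 cW dW] := smW; move=> a0 ac wE yeta.
have c0 : 0 < c by exact: le_lt_trans ac.
pose E s := - 2^-1 * F s + dotp (W s - w s) (y - 2^-1 *: z).
(* The derivative of [s * E s] exceeds [s * gap s y] by [E s]; [eta * s] compensates the inner
   product in [E], and [corr] its potential. *)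
pose G s := s * E s + eta * s + corr s.
have ain : a <= a <= c by rewrite lexx ltW.
have cin : a <= c <= c by rewrite lexx ltW.
(* [<w, y>] is the weighted norm of [y] at both ends of the piece, so the velocity is orthogonal to
   [y]. *)
have yw : dotp (M *m (z - y)) y = 0.
  have e1 : dotp (w c) y = dotp (w a) y.
    apply: eq_bigr => i _; have [_ /(_ i)[_ ->]] := wE _ cin.
    by have [_ /(_ i)[_ ->]] := wE _ ain.
  have [wcE _] := wE _ cin; move: e1; rewrite wcE dotpDl dotpZl /q -mulmxBr.
  move=> e1; have /eqP : (c - a) * dotp (M *m (z - y)) y = 0 by lra.
  by rewrite mulf_eq0 subr_eq0 gt_eqF//= => /eqP.
apply: (@le_trans _ _ (G c - G a)%:E).
  apply: integral_le_growth; first exact: ltW.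
  - exact: gap_continuous.
  - have ct : {within `[a, c], continuous (fun s => s : R)}.
      by apply: continuous_subspaceT => t; exact: cvg_id.
    move=> s; apply: cvgD; first apply: cvgD.
    + apply: cvgM; first exact: ct.
      apply: cvgD; first by apply: cvgM; [exact: cvg_cst|exact: potential_continuous].
      apply: cvg_dotp => i; last exact: cvg_cst.
      rewrite mxE [X in _ + X]mxE (_ : (fun t => _) = fun t => W t i 0 - w t i 0).
        by apply: cvgB; exact: within_segment.
      by apply/funext => t; rewrite !mxE.
    + by apply: cvgM; [exact: cvg_cst|exact: ct].
    + apply: cvgM; first exact: cvg_cst.
      apply: cvgD; first by apply: cvgM; [exact: cvg_cst|exact: ct].
      apply: cvgM; first exact: cvg_cst.
      apply: cvgB; first by apply: cvgM; [exact: cvg_cst|exact: ct].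
      apply: cvg_dual_energy => i; rewrite bE bfunE.
      by apply: cvgD; [exact: within_segment|exact: cvg_cst].
  - move=> s /andP[as_ sc]; have s0 : 0 < s by exact: le_lt_trans as_.
    have wd : col_derive s w (M *m (z - y)).
      rewrite mulmxBr; apply: (@piece_derive _ _ a c); first by rewrite as_.
      by move=> t /wE[].
    have Ed := gap_primitive s0 wd yw.
    have [dE bd dEle] := dual_energy_coercive s0.
    have idd := is_derive_id s (1 : R).
    have h1 := is_deriveM idd Ed.
    have h2 := @is_deriveZ _ _ _ _ eta s 1 _ idd.
    have h3 := is_deriveB (@is_deriveZ _ _ _ _ C3 s 1 _ idd) bd.
    have h4 := is_deriveD (@is_deriveZ _ _ _ _ (2 * d%:R) s 1 _ idd)
      (@is_deriveZ _ _ _ _ (2 / delta) s 1 _ h3).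
    have h5 := is_deriveD (is_deriveD h1 h2)
      (@is_deriveZ _ _ _ _ (4 * m)^-1 s 1 _ h4).
    exists (s * gap s y + E s + eta + (4 * m)^-1 * (2 * d%:R + 2 / delta * (C3 - dE))).
      apply: (is_derive_eq h5); rewrite /GRing.scale/= -/(E s); ring.
    rewrite -!addrA lerDl.
    have ses : a <= s <= c by rewrite !ltW.
    have := yeta _ ses; rewrite ler_norml => /andP[ye _].
    have XC : \sum_i `|X s i 0| <= 2 / delta * (C3 - dE).
      have -> : \sum_i `|X s i 0| = 2 / delta * (delta / 2 * \sum_i `|X s i 0|).
        by field; rewrite gt_eqF.
      by apply: ler_wpM2l; [rewrite divr_ge0// ltW|lra].
    have FX : 2^-1 * F s <= (4 * m)^-1 * (2 * d%:R + \sum_i `|X s i 0|).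
      have -> : (4 * m)^-1 * (2 * d%:R + \sum_i `|X s i 0|) =
          2^-1 * \sum_i (`|X s i 0| + 2) / (2 * m).
        rewrite -mulr_suml big_split/= sumr_const card_ord -mulr_natr.
        by field; rewrite gt_eqF.
      rewrite ler_wpM2l ?invr_ge0// ler_sum// => i _.
      by rewrite /X mxE; exact: dual_potential_le.
    have m4 : 0 <= (4 * m)^-1 by rewrite invr_ge0 mulr_ge0// ltW.
    have := ler_wpM2l m4 XC; rewrite /E; lra.
rewrite lee_fin /G /E /boundary.
have := yeta _ ain; have := yeta _ cin; rewrite !ler_norml => /andP[y1 y2] /andP[y3 y4].
have := ler_wpM2l (ltW c0) y2; have := ler_wpM2l a0 y3.
have eta0 : 0 <= eta by rewrite (le_trans _ (yeta _ ain)).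
lra.
Qed.

Lemma gap_ge0 s y : 0 <= gap s y.
Proof. by rewrite mulr_ge0//; exact: psdM. Qed.

Lemma gap_measurable (a c : R) : 0 <= a -> piecewise_flow M z lam w x B a c ->
  measurable_fun `[a, c[ (fun s => s * gap s (x s)).
Proof.
move=> + p; elim: p => {a c} [a _|a e c xa ae xE xB wE p IH a0].
  by rewrite set_itv_ge ?bnd_simp ?ltxx//; exact: measurable_fun_set0.
have e0 := le_trans a0 (ltW ae); have [ec _] := piecewise_span e0 p.
rewrite (@itv_bndbnd_setU _ _ _ (BLeft e)) ?bnd_simp ?(ltW ae)//.
apply/measurable_funU => //; split; last exact: IH.
apply: (@eq_measurable_fun _ _ R R _ (fun s : R => s * gap s xa)).
  by move=> s; rewrite inE/= in_itv/= => /xE ->.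
apply: (@measurable_funS _ _ _ _ `[a, e]) => //; first exact: subset_itv_co_cc.
by apply: subspace_continuous_measurable_fun => //; exact: gap_continuous.
Qed.

(** The potential at 0 is multiplied by [s = 0]; the potential and the energy at [S] enter with a
    favourable sign. What is left is of order [1 / m]. *)
Lemma boundary_bound S : 0 <= S -> boundary S - boundary 0 <=
  (4 * m)^-1 * (2 * d%:R * S + 2 / delta * (C3 * S + dual_energy N (ws - w 0))).
Proof.
have [m0 _ _ _] := smW; move=> S0; rewrite /boundary /corr.
have b0 : dual_energy N (b 0) = dual_energy N (ws - w 0).
  have -> : b 0 = - (ws - w 0) by apply/colP => i; rewrite !mxE; ring.
  by rewrite /dual_energy mulmxN dotpNl dotpNr opprK.
rewrite b0; have F0 : 0 <= S * F S.
  by rewrite mulr_ge0// sumr_ge0// => i _; exact: dual_potential_ge0.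
have m4 : 0 <= (4 * m)^-1 by rewrite invr_ge0 mulr_ge0// ltW.
have d4 : 0 <= 2 / delta by rewrite divr_ge0// ltW.
have := mulr_ge0 m4 (mulr_ge0 d4 (dual_energy_ge0 psdN (b S))).
rewrite !mul0r !mulr0 !add0r; lra.
Qed.

End loss_gap.

End given_smoothing.

Local Notation leb := (@lebesgue_measure R).

(** The values of [boundary] telescope over the pieces. Their number [n] is chosen before the
    smoothing, so the error is uniform in it. *)
Lemma gap_integral (a c : R) : 0 <= a -> piecewise_flow M z lam w x B a c ->
  exists n : nat, forall m L W (eta : R), smoothed_flow m L W ->
  (forall i, `|(w 0 - W 0) i 0| <= delta / 4 /\ `|L i 0 - lam i 0| <= delta / 4) ->
  (forall s (y : 'cV[R]_d), a <= s <= c -> (forall i, `|y i 0| <= B) ->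
     `|dotp (W s - w s) (y - 2^-1 *: z)| <= eta) -> 0 <= eta ->
  (\int[leb]_(s in `[a, c[) (s * gap m L W s (x s))%:E <=
   (boundary m L W c - boundary m L W a + n%:R * (2 * c * eta))%:E)%E.
Proof.
move=> + p; elim: p => {a c} [a _|a e c xa ae xE xB wE p IH a0].
  exists 0%N => m L W eta smW oL weta eta0.
  by rewrite set_itv_ge ?integral_set0 ?bnd_simp ?ltxx// subrr mul0r addr0.
have e0 := le_trans a0 (ltW ae); have [ec _] := piecewise_span e0 p.
have [n {}IH] := IH e0; exists n.+1 => m L W eta smW oL weta eta0.
have gm := gap_measurable smW a0 (piecewise_cons ae xE xB wE p).
rewrite (@itv_bndbnd_setU _ _ _ (BLeft e)) ?bnd_simp ?(ltW ae)//.
rewrite ge0_integral_setU//=; last 3 first.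
- by apply/measurable_EFinP; rewrite -itv_bndbnd_setU ?bnd_simp // ltW.
- move=> s [] /=; rewrite in_itv/= => /andP[s1 _].
    by rewrite lee_fin mulr_ge0 ?gap_ge0// (le_trans a0).
  by rewrite lee_fin mulr_ge0 ?gap_ge0// (le_trans e0).
- apply/disj_set2P; rewrite -subset0 => s [] /=; rewrite !in_itv/=.
  by move=> /andP[_ se] /andP[]; rewrite leNgt se.
have -> : (boundary m L W c - boundary m L W a + n.+1%:R * (2 * c * eta))%:E =
  ((boundary m L W e - boundary m L W a + 2 * c * eta)%:E +
   (boundary m L W c - boundary m L W e + n%:R * (2 * c * eta))%:E)%E.
  by rewrite -EFinD -natr1; congr (_%:E); ring.
apply: leeD; last first.
  apply: IH => // s y /andP[s1 s2] yB; apply: weta => //.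
  by rewrite (le_trans (ltW ae)).
apply: (@le_trans _ _ (boundary m L W e - boundary m L W a + 2 * e * eta)%:E); last first.
  by rewrite lee_fin lerD2l ler_wpM2r// ler_wpM2l.
under eq_integral => s do [rewrite inE/= in_itv/= => /xE ->].
apply: piece_gap_integral => // s /andP[s1 s2]; apply: weta => //.
by rewrite s1 (le_trans s2).
Qed.

End smoothed_flow.

(** * Uniform convergence of [W] and vanishing of the gap as [m] grows *)

Section asymptotics.
Context {R : realType} {d : nat}.
Variables (M : 'M[R]_d) (z : 'cV[R]_d).
Hypotheses (symM : M^T = M) (psdM : psd M).
Variables (lam : 'cV[R]_d) (w x : R -> 'cV[R]_d) (B delta : R) (ws : 'cV[R]_d).
Hypotheses (B0 : 0 <= B) (delta0 : 0 < delta).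
Hypothesis wcont : forall i, {within `[0, +oo[, continuous (fun s => w s i 0)}.
Hypothesis wflow : forall S : R, 0 <= S -> piecewise_flow M z lam w x B 0 S.
Hypothesis wsspan : colspan M (ws - w 0).
Hypothesis wsint : forall i, `|ws i 0| <= lam i 0 - delta.
Variables (T : Type) (F : set_system T) (FF : Filter F).
Variables (m_ : T -> R) (L_ : T -> 'cV[R]_d) (W_ : T -> R -> 'cV[R]_d).
Hypothesis sm : \forall e \near F, smoothed_flow M z (m_ e) (L_ e) (W_ e).
Hypothesis m_oo : m_ e @[e --> F] --> +oo.
Hypothesis L_lam : forall i, L_ e i 0 @[e --> F] --> lam i 0.
Hypothesis W_w0 : forall i, W_ e 0 i 0 @[e --> F] --> w 0 i 0.
Local Notation leb := (@lebesgue_measure R).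

Let lam0 i : 0 <= lam i 0.
Proof.
have : 0 <= lam i 0 - delta by apply: le_trans (wsint i).
by rewrite subr_ge0; apply: le_trans; exact: ltW.
Qed.

Lemma offsets_vanish (r : R) : 0 < r -> \forall e \near F,
  forall i, `|(w 0 - W_ e 0) i 0| <= r /\ `|L_ e i 0 - lam i 0| <= r.
Proof.
move=> r0; apply: filter_forall => i.
have h1 : \forall e \near F, `|w 0 i 0 - W_ e 0 i 0| <= r.
  by have /cvgrPdist_le := W_w0 (i := i); apply.
have h2 : \forall e \near F, `|lam i 0 - L_ e i 0| <= r.
  by have /cvgrPdist_le := L_lam (i := i); apply.
by apply: filterS2 h1 h2 => e ? ?; rewrite !mxE (distrC (L_ _ _ _)).
Qed.

Lemma uniform_convergence (S eta : R) : 0 <= S -> 0 < eta ->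
  \forall e \near F, forall s, 0 <= s <= S ->
    forall i, `|W_ e s i 0 - w s i 0| <= eta.
Proof.
move=> S0 eta0; have [N [symN psdN MNM]] := psd_ginv symM psdM.
pose E0 := dual_energy N (ws - w 0).
pose C1 := \sum_i (`|z i 0| + B) * (2 * lam i 0 + 2 * delta).
pose C2 := \sum_i (1 + z i 0 ^+ 2 + B ^+ 2).
have E00 : 0 <= E0 by exact: dual_energy_ge0.
have C10 : 0 <= C1.
  by apply: sumr_ge0 => i _; rewrite mulr_ge0 ?addr_ge0 ?mulr_ge0// ltW.
have C20 : 0 <= C2.
  by apply: sumr_ge0 => i _; rewrite !addr_ge0 ?sqr_ge0.
suff : \forall e \near F, forall i s, 0 <= s <= S -> `|W_ e s i 0 - w s i 0| <= eta.
  by apply: filterS => e He s sS i; exact: He.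
apply: filter_forall => i.
have Mii : 0 <= M i i by have := psdM (delta_mx i 0); rewrite dotp_delta -colE mxE.
pose A1 := delta / 2 + 2 * lam i 0.
pose A2 := 2 * M i i * (E0 + C1 * S) + 1.
have A10 : 0 < A1 by rewrite ltr_pwDl ?divr_gt0 ?mulr_ge0.
have A20 : 0 < A2 by rewrite ltr_wpDl// mulr_ge0 ?addr_ge0 ?mulr_ge0.
(* [k] makes the terms free of [m] at most [eta / 2] outside of the root and [eta ^+ 2 / 8] inside;
   only then is [m] taken large, for another [eta ^+ 2 / 8]. *)
pose k := Num.min 1 (Num.min (eta / 2 / A1) (eta ^+ 2 / 8 / A2)).
have k0 : 0 < k by rewrite !lt_min ltr01 !divr_gt0// exprn_gt0.
have k1 : k <= 1 by rewrite ge_min lexx.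
have kA1 : k * A1 <= eta / 2.
  by rewrite -ler_pdivlMr// !ge_min lexx orbT.
have kA2 : k * A2 <= eta ^+ 2 / 8.
  by rewrite -ler_pdivlMr// !ge_min lexx !orbT.
have k01 : 0 <= k <= 1 by rewrite ltW.
pose A3 := 2 * M i i * (C2 * S).
have A30 : 0 <= A3 by rewrite !mulr_ge0.
have kd0 : 0 < k * delta / 2 by rewrite divr_gt0// mulr_gt0.
have mlarge : \forall e \near F, 8 * A3 / eta ^+ 2 <= m_ e.
  by have /cvgryPge := m_oo; apply.
near=> e => s /andP[s0 sS].
have se : smoothed_flow M z (m_ e) (L_ e) (W_ e) by near: e.
have oL : forall i, `|(w 0 - W_ e 0) i 0| <= k * delta / 2 /\
    `|L_ e i 0 - lam i 0| <= k * delta / 2.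
  by near: e; exact: offsets_vanish.
have := comparison_bound symM psdM symN psdN MNM delta0 wcont wflow wsspan
  wsint se k01 oL i s0.
move=> /le_trans; apply.
have m0 : 0 < m_ e by case: se.
have me : 8 * A3 / eta ^+ 2 <= m_ e by near: e.
rewrite [leRHS](splitr eta) lerD//.
  by rewrite (le_trans _ kA1)// /A1; lra.
rewrite -/E0 -/C1 -/C2 -[leRHS]ger0_norm ?divr_ge0// ?(ltW eta0)// -sqrtr_sqr.
apply: ler_wsqrtr.
have h1 : 2 * M i i * (k ^+ 2 * E0 + k * C1 * s) <= k * A2.
  have h0 : k ^+ 2 * E0 + k * C1 * s <= k * (E0 + C1 * S).
    rewrite mulrDr lerD//; first by rewrite expr2 -mulrA ler_piMl// mulr_ge0// ltW.
    by rewrite -mulrA ler_wpM2l ?(ltW k0)// ler_wpM2l.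
  have h1 := ler_wpM2l (mulr_ge0 (ler0n R 2) Mii) h0.
  by apply: (le_trans h1); rewrite /A2; lra.
have h2 : A3 / m_ e <= eta ^+ 2 / 8.
  have : 8 * A3 <= m_ e * eta ^+ 2 by rewrite -ler_pdivrMr ?exprn_gt0.
  by rewrite ler_pdivrMr//; lra.
have h3 : 2 * M i i * (C2 / m_ e * s) <= A3 / m_ e.
  have -> : A3 / m_ e = 2 * M i i * (C2 / m_ e * S) by rewrite /A3; ring.
  by rewrite ler_wpM2l ?mulr_ge0// ler_wpM2l// divr_ge0// ltW.
have -> : (eta / 2) ^+ 2 = eta ^+ 2 / 8 + eta ^+ 2 / 8 by field.
lra.
Unshelve. all: by end_near. Qed.

Lemma gap_vanishes (S eta : R) : 0 <= S -> 0 < eta -> \forall e \near F,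
  (\int[leb]_(s in `[0%R, S])
     (s * gap M (m_ e) (L_ e) (W_ e) s (x s))%:E <= eta%:E)%E.
Proof.
move=> S0 eta0; have [N [symN psdN MNM]] := psd_ginv symM psdM.
have [n Hn] := gap_integral symM psdM symN MNM delta0 wcont wsspan wsint
  (lexx 0) (wflow S0).
pose Cz := \sum_i (B + `|z i 0|).
have Cz0 : 0 <= Cz by apply: sumr_ge0 => i _; rewrite addr_ge0.
pose E0 := dual_energy N (ws - w 0).
(* Dominates the corresponding constant of [boundary_bound], which depends on [m], as soon as
   [m >= 1]. *)
pose C3 := \sum_i (1 + z i 0 ^+ 2 + `|z i 0| * (2 * lam i 0 + 2 * delta)).
pose A1 := n%:R * (2 * S) * Cz + 1.
(* One half of [eta] pays for the [n] pieces, the other for the boundary term. *)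
pose eta' := eta / 2 / A1.
have A10 : 0 < A1 by rewrite ltr_wpDl// !mulr_ge0.
have eta'0 : 0 < eta' by rewrite !divr_gt0.
pose A2 := 2 * d%:R * S + 2 / delta * (C3 * S + E0).
have E00 : 0 <= E0 by exact: dual_energy_ge0.
have C30 : 0 <= C3.
  apply: sumr_ge0 => i _; rewrite addr_ge0 ?addr_ge0 ?sqr_ge0//.
  by rewrite mulr_ge0// addr_ge0// mulr_ge0// ltW.
have d20 : 0 <= 2 / delta by rewrite divr_ge0// ltW.
have CE : 0 <= C3 * S + E0 by rewrite addr_ge0// mulr_ge0.
have A20 : 0 <= A2 by apply: addr_ge0; [rewrite !mulr_ge0|exact: mulr_ge0].
have m1 : \forall e \near F, 1 <= m_ e by have /cvgryPge := m_oo; apply.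
have mlarge : \forall e \near F, A2 / eta <= m_ e by have /cvgryPge := m_oo; apply.
have d40 : 0 < delta / 4 by rewrite divr_gt0.
near=> e.
have se : smoothed_flow M z (m_ e) (L_ e) (W_ e) by near: e.
have oL : forall i, `|(w 0 - W_ e 0) i 0| <= delta / 4 /\ `|L_ e i 0 - lam i 0| <= delta / 4.
  by near: e; exact: offsets_vanish.
have We : forall s, 0 <= s <= S -> forall i, `|W_ e s i 0 - w s i 0| <= eta'.
  by near: e; exact: uniform_convergence.
have gm := gap_measurable se (lexx 0) (wflow S0).
rewrite -integral_itv_bndo_bndc; last exact/measurable_EFinP.
apply: (le_trans (Hn _ _ _ (eta' * Cz) se oL _ _)).
- move=> s y sS yB; rewrite dotpC.
  rewrite (le_trans (@ler_dotp_abs _ _ _ _ eta' _))//.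
    by move=> i; rewrite !mxE; exact: We.
  rewrite ler_wpM2l ?(ltW eta'0)// ler_sum// => i _; rewrite !mxE.
  rewrite (le_trans (ler_normB _ _))// lerD// normrM ger0_norm ?invr_ge0//.
  by rewrite ler_piMl// invf_le1// ler1n.
- by rewrite mulr_ge0// ltW.
have m0 : 0 < m_ e by case: se.
rewrite lee_fin [leRHS](splitr eta) lerD//.
  apply: (le_trans (boundary_bound psdN lam w ws delta0 se S0)).
  have m4 : 0 < 4 * m_ e by rewrite mulr_gt0.
  have me1 : 1 <= m_ e by near: e.
  have me : A2 <= m_ e * eta by rewrite -ler_pdivrMr//; near: e.
  rewrite ler_pdivrMl// (@le_trans _ _ A2)//; last first.
    by have := mulr_gt0 m0 eta0; lra.
  rewrite /A2 lerD2l ler_wpM2l// lerD2r ler_wpM2r// ler_sum// => i _.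
  by rewrite lerD2r ler_pdivrMr// ler_peMr// addr_ge0// sqr_ge0.
have -> : n%:R * (2 * S * (eta' * Cz)) = eta' * (n%:R * (2 * S) * Cz) by ring.
have -> : eta / 2 = eta' * A1 by rewrite divfK// gt_eqF.
by rewrite ler_wpM2l ?(ltW eta'0)// lerDl.
Unshelve. all: by end_near. Qed.

End asymptotics.

(** * Primitives on the half-line and scalar linear equations *)

Section primitives.
Context {R : realType}.
Implicit Types f g : R -> R.
Local Notation leb := (@lebesgue_measure R).

Lemma halfline_primitive f : {within `[0, +oo[, continuous f} ->
  exists G : R -> R, [/\ G 0 = 0, {within `[0, +oo[, continuous G} &
    forall t : R, 0 < t -> is_derive t 1 G (f t)].
Proof.
move=> cf; pose G x := (\int[leb]_(t in `[0, x]) f t)%R.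
have fi b : leb.-integrable `[0%R, b] (EFin \o f).
  by apply: continuous_compact_integrable; [exact: segment_compact|exact: within_segment].
have Gd (t : R) : 0 < t -> is_derive t 1 G (f t).
  move=> t0; have tt1 : t < t + 1 by rewrite ltrDl.
  have ct : {for t, continuous f}.
    have /continuous_within_itvcyP[+ _] := cf.
    by apply; rewrite in_itv/= t0.
  have [Gt GE] := continuous_FTC1_closed tt1 (fi (t + 1)) t0 ct.
  by apply: DeriveDef; [exact: Gt|rewrite -derive1E; exact: GE].
exists G; split => //; first by rewrite /G set_itv1 Rintegral_set1.
apply/continuous_within_itvcyP; split.
  move=> t; rewrite in_itv/= andbT => /Gd[Gt _].
  exact/differentiable_continuous/derivable1_diffP.
have := parameterized_integral_continuous ler01 (fi 1).
by move=> /(continuous_within_itvP _ ltr01)[].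
Qed.

Lemma cvg_right_scale f (k y : R) : 0 < k -> f @ 0^'+ --> y ->
  f (k * s) @[s --> 0^'+] --> y.
Proof.
move=> k0 /cvgrPdist_lt fy; apply/cvgrPdist_lt => e e0.
have [r /= r0 H] := fy _ e0.
near=> s; have s0 : 0 < s by near: s; exact: nbhs_right_gt.
apply: H; last by rewrite mulr_gt0.
rewrite /ball_/= sub0r normrN gtr0_norm ?mulr_gt0// mulrC -ltr_pdivlMr//.
by near: s; apply: nbhs_right_lt; exact: divr_gt0.
Unshelve. all: by end_near. Qed.

Lemma linear_ode_exp f g G (sg b : R) : 0 <= b ->
  {within `[0, b], continuous f} -> {within `[0, b], continuous G} -> G 0 = 0 ->
  (forall t : R, 0 < t -> is_derive t 1 G (g t)) ->
  (forall t : R, 0 < t -> is_derive t 1 f (sg * (f t * g t))) ->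
  f b = f 0 * expR (sg * G b).
Proof.
move=> b0 cf cG G0 Gd fd.
(* Integrating factor; the [- 0] fits the form of [is_derive_expR_affine]. *)
pose k t := f t * expR (- sg * (G t - 0)).
have : k b = k 0.
  apply: derive_eq0_const => //.
    move=> s; apply: cvgM; first exact: cf.
    apply: (cvg_comp (fun t => - sg * (G t - 0)) expR); last exact: continuous_expR.
    apply: cvgM; first exact: cvg_cst.
    by apply: cvgB; [exact: cG|exact: cvg_cst].
  move=> t /andP[t0 _].
  apply: (is_derive_eq (is_deriveM (fd t t0) (is_derive_expR_affine (- sg) 0 (Gd t t0)))).
  by rewrite /GRing.scale/=; ring.
rewrite /k G0 !subr0 mulr0 expR0 mulr1 => <-.
by rewrite -mulrA -expRD mulNr addNr expR0 mulr1.
Qed.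

End primitives.

(** * Reduction of the diagonal network to the smoothed flow *)

Section diagonal_network.
Context {R : realType} {d : nat}.
Variables (M : 'M[R]_d) (z : 'cV[R]_d) (c : R).
Hypotheses (symM : M^T = M) (psdM : psd M).
Let q := M *m z.
Local Notation l := (quadratic M q c).

Lemma hadamardC (u v : 'cV[R]_d) : u \h* v = v \h* u.
Proof. by apply/colP => i; rewrite !mxE mulrC. Qed.

Lemma col_continuous (D : set R) (u : R -> 'cV[R]_d) : {within D, continuous u} ->
  forall i, {within D, continuous (fun t => u t i 0)}.
Proof.
move=> cu i t; apply: (cvg_comp u (fun x : 'cV[R]_d => x i 0)); first exact: cu.
exact: coord_continuous.
Qed.

(* The halves of [u + v] and [u - v] obey linear equations with opposite rates,
   so the dynamics are driven by the integral of the gradient alone. *)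
Lemma diag_net_smoothed_flow (u0 v0 : 'cV[R]_d) u v (mu : R) :
  diag_net_flow l u0 v0 u v -> 0 < mu ->
  (forall i, u0 i 0 <> v0 i 0 /\ u0 i 0 <> - v0 i 0) ->
  let A := mu^-1 *: log_abs (2^-1 *: (u0 + v0)) in
  let A' := mu^-1 *: log_abs (2^-1 *: (u0 - v0)) in
  let L := - (2^-1 *: (A + A')) in
  (forall i, 0 <= L i 0) ->
  exists W : R -> 'cV[R]_d, [/\ W 0 = 2^-1 *: (A - A'), smoothed_flow M z mu L W &
    forall s, 0 <= s -> v (mu * s) \h* u (mu * s) = mirror_col mu L (W s)].
Proof.
move=> [cu cv u00 v00 uvd] mu0 uv0 A A' L L0.
pose x t := v t \h* u t; pose g t := M *m x t - q.
have cui := col_continuous cu; have cvi := col_continuous cv.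
have ud (t : R) : 0 < t -> col_derive t u (- (v t \h* g t)).
  move=> t0; have [/is_derive_colP + _] := uvd t t0.
  by rewrite gradient_quadratic_hadamard.
have vd (t : R) : 0 < t -> col_derive t v (- (u t \h* g t)).
  move=> t0; have [_ /is_derive_colP] := uvd t t0.
  rewrite (_ : (fun b => l (b \h* u t)) = fun b => l (u t \h* b)).
    by rewrite gradient_quadratic_hadamard// (hadamardC (u t) (v t)).
  by apply/funext => b; rewrite hadamardC.
have cg i : {within `[0, +oo[, continuous (fun t => g t i 0)}.
  rewrite (_ : (fun t => _) = fun t => (M *m x t) i 0 - q i 0); last first.
    by apply/funext => t; rewrite !mxE.
  move=> t; apply: cvgB; last exact: cvg_cst.
  apply: cvg_mulmx_col => j; rewrite mxE.
  rewrite (_ : (fun t => _) = fun t => v t j 0 * u t j 0); last first.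
    by apply/funext => s; rewrite mxE.
  by apply: cvgM; [exact: cvi|exact: cui].
have /choice[G GP] : forall i, exists G : R -> R, [/\ G 0 = 0,
    {within `[0, +oo[, continuous G} &
    forall t : R, 0 < t -> is_derive t 1 G (g t i 0)].
  by move=> i; exact: halfline_primitive.
pose W s := 2^-1 *: (A - A') - mu^-1 *: \col_i G i (mu * s).
have WE s i : W s i 0 = (2^-1 *: (A - A')) i 0 - mu^-1 * G i (mu * s).
  by rewrite !mxE.
(* The product is the difference of the squares of the half-sum and the half-difference; squaring
   removes their signs, whence the absolute values. *)
have xE (t : R) i : 0 <= t -> x t i 0 =
    expR (2 * ln `|(2^-1 *: (u0 + v0)) i 0| - 2 * G i t) -
    expR (2 * ln `|(2^-1 *: (u0 - v0)) i 0| + 2 * G i t).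
  move=> t0; have [G0 cG Gd] := GP i.
  have pE : 2^-1 * (u t i 0 + v t i 0) = (2^-1 *: (u0 + v0)) i 0 * expR (-1 * G i t).
    transitivity (2^-1 * (u 0 i 0 + v 0 i 0) * expR (-1 * G i t)); last first.
      by rewrite u00 v00 !mxE.
    apply: (@linear_ode_exp _ (fun t => 2^-1 * (u t i 0 + v t i 0)) (fun t => g t i 0)) => //.
    - move=> s; apply: cvgM; first exact: cvg_cst.
      by apply: cvgD; apply: within_segment.
    - exact: within_segment.
    - move=> s s0; have h := is_deriveD (ud s s0 i) (vd s s0 i).
      apply: (is_derive_eq (@is_deriveZ _ _ _ _ 2^-1 s 1 _ h)).
      by rewrite /GRing.scale/= ![(- (_ \h* _)) _ _]mxE ![(_ \h* _) _ _]mxE; ring.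
  have mE : 2^-1 * (u t i 0 - v t i 0) = (2^-1 *: (u0 - v0)) i 0 * expR (1 * G i t).
    transitivity (2^-1 * (u 0 i 0 - v 0 i 0) * expR (1 * G i t)); last first.
      by rewrite u00 v00 !mxE.
    apply: (@linear_ode_exp _ (fun t => 2^-1 * (u t i 0 - v t i 0)) (fun t => g t i 0)) => //.
    - move=> s; apply: cvgM; first exact: cvg_cst.
      by apply: cvgB; apply: within_segment.
    - exact: within_segment.
    - move=> s s0; have h := is_deriveB (ud s s0 i) (vd s s0 i).
      apply: (is_derive_eq (@is_deriveZ _ _ _ _ 2^-1 s 1 _ h)).
      by rewrite /GRing.scale/= ![(- (_ \h* _)) _ _]mxE ![(_ \h* _) _ _]mxE; ring.
  have [n1 n2] := uv0 i.
  have expln (a y : R) : a != 0 -> expR (2 * ln `|a| + 2 * y) = (a * expR y) ^+ 2.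
    move=> a0; rewrite -mulrDr expRM_natl expRD lnK ?posrE ?normr_gt0//.
    by rewrite !exprMn real_normK ?num_real.
  rewrite -mulrN !expln; last 2 first.
  - rewrite !mxE mulf_neq0 ?invr_neq0// subr_eq0; exact/eqP.
  - rewrite !mxE mulf_neq0 ?invr_neq0// addr_eq0; exact/eqP.
  by rewrite -[- G i t]mulN1r -[G i t in X in _ - X]mul1r -pE -mE mxE; field.
have XE (s : R) : 0 <= s -> v (mu * s) \h* u (mu * s) = mirror_col mu L (W s).
  move=> s0; apply/colP => i; rewrite -/(x (mu * s)) xE ?mulr_ge0 ?(ltW mu0)//.
  rewrite [RHS]mxE /mirror_map WE /L /A /A' !mxE.
  by congr (expR _ - expR _); field; rewrite gt_eqF.
have Wd (s : R) : 0 < s -> forall i, is_derive s 1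
    (fun s => (2^-1 *: (A - A')) i 0 - mu^-1 * G i (mu * s)) (- g (mu * s) i 0).
  move=> s0 i; have [_ _ Gd] := GP i.
  have h1 := @is_deriveZ _ _ _ _ mu s 1 _ (is_derive_id s (1 : R)).
  have h2 := @is_derive1_comp R (G i) _ s _ _ (Gd _ (mulr_gt0 mu0 s0)) h1.
  have h3 := @is_deriveZ _ _ _ _ mu^-1 s 1 _ h2.
  apply: (is_derive_eq (is_deriveB (is_derive_cst _ s 1) h3)).
  by rewrite /GRing.scale/= sub0r; field; rewrite gt_eqF.
exists W; split.
- by apply/colP => i; rewrite WE mulr0; have [-> _ _] := GP i; rewrite mulr0 subr0.
- split=> //.
  + move=> i; rewrite (_ : (fun s => _) = fun s =>
        (2^-1 *: (A - A')) i 0 - mu^-1 * G i (mu * s)); last first.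
      by apply/funext => s; exact: WE.
    apply/continuous_within_itvcyP; split.
      move=> s; rewrite in_itv/= andbT => s0.
      by have [Ws _] := Wd s s0 i; exact/differentiable_continuous/derivable1_diffP.
    apply: cvgB; first exact: cvg_cst.
    apply: cvgM; first exact: cvg_cst.
    rewrite mulr0; have [_ /continuous_within_itvcyP[_ G0] _] := GP i.
    exact: cvg_right_scale.
  + move=> s s0 i; have := Wd s s0 i.
    rewrite (_ : (fun s => _) = fun s => W s i 0); last by apply/funext => t; rewrite WE.
    have -> : (M *m (z - mirror_col mu L (W s))) i 0 = - g (mu * s) i 0 => //.
    by rewrite mulmxBr -XE ?(ltW s0)// /g /x !mxE; ring.
- by move=> s /XE.
Qed.

End diagonal_network.

(** * Properties of the limiting flow off its breakpoints *)

Section piecewise_consequences.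
Context {R : realType} {d : nat}.
Variables (M : 'M[R]_d) (z : 'cV[R]_d) (c : R).
Hypotheses (symM : M^T = M) (psdM : psd M).
Let q := M *m z.
Local Notation l := (quadratic M q c).
Local Notation leb := (@lebesgue_measure R).
Variables (lam : 'cV[R]_d) (w x : R -> 'cV[R]_d) (B : R).

(** By the last clause, coordinates on a face of the box do not move; [complementary_min] deduces
    optimality on the cone from it. *)
Definition regular_time (t : R) :=
  [/\ col_derive t w (M *m (z - x t)), l1_subgradient lam (x t) (w t),
      forall i, `|x t i 0| <= B &
      forall i, `|w t i 0| = lam i 0 -> (M *m (z - x t)) i 0 = 0].

Lemma piecewise_regular (a e : R) : 0 <= a -> piecewise_flow M z lam w x B a e ->
  exists bs : seq R, forall t, a <= t <= e -> t \notin bs -> regular_time t.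
Proof.
move=> + p; elim: p => {a e} [a _|a b e xa ab xE xB wE _ IH a0].
  by exists [:: a] => t; rewrite inE -eq_le => /eqP -> /eqP.
have [bs Hbs] := IH (le_trans a0 (ltW ab)); exists [:: a, b & bs] => t.
move=> /andP[at_ te]; rewrite !inE !negb_or => /and3P[ta tb tbs].
have [bt|tb'] := leP b t; first by apply: Hbs => //; rewrite bt.
have at' : a < t by rewrite lt_neqAle eq_sym ta.
have xt : x t = xa by apply: xE; rewrite at_.
have tin : a <= t <= b by rewrite at_ ltW.
have [wt sub] := wE t tin.
split; rewrite ?xt//.
  rewrite mulmxBr; apply: (@piece_derive _ _ w _ a b); first by rewrite at'.
  by move=> s /wE[].
(* The coordinate is affine on the piece, stays in its interval and is at an end of it at an
   interior time: it is constant. *)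
move=> i wti; set r := (M *m (z - xa)) i 0.
have wi s : a <= s <= b -> w s i 0 = w t i 0 + (s - t) * r.
  move=> /wE[-> _]; rewrite wt /r mulmxBr !mxE; ring.
have ain : a <= a <= b by rewrite lexx ltW.
have bin : a <= b <= b by rewrite lexx ltW.
have [wa _] := (wE a ain).2 i; have [wb _] := (wE b bin).2 i.
move: wa wb; rewrite (wi a ain) (wi b bin) !ler_norml => /andP[a1 a2] /andP[b1 b2].
have [w0|w0] := leP 0 (w t i 0).
  by move: wti; rewrite ger0_norm// => wti; apply/eqP; rewrite eq_le; apply/andP; split; nra.
by move: wti; rewrite ltr0_norm// => wti; apply/eqP; rewrite eq_le; apply/andP; split; nra.
Qed.

Lemma ae_notin_seq (bs : seq R) : \forall t \ae leb, t \notin bs.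
Proof.
have cbs : countable [set` bs] by apply: finite_set_countable; exact: finite_seq.
exists [set` bs]; split.
- exact: countable_measurable.
- exact: countable_lebesgue_measure0.
- by move=> t /= /negP; rewrite negbK.
Qed.

Lemma piecewise_ae_regular : (forall S : R, 0 <= S -> piecewise_flow M z lam w x B 0 S) ->
  \forall t \ae leb, 0 <= t -> regular_time t.
Proof.
move=> pf; have H n : \forall t \ae leb, 0 <= t <= n%:R -> regular_time t.
  have [bs Hbs] := piecewise_regular (lexx 0) (pf _ (ler0n R n)).
  by apply: filterS (ae_notin_seq bs) => t tbs tn; exact: Hbs.
apply: filterS (ae_foralln H) => t Ht t0.
by apply: (Ht (Num.trunc t).+1); rewrite t0 ltW// truncnS_gt.
Qed.

(** [phi] can be arbitrary because [x] is a step function. *)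
Lemma piecewise_measurable (phi : 'cV[R]_d -> R) (a e : R) : 0 <= a ->
  piecewise_flow M z lam w x B a e -> measurable_fun `[a, e[ (fun s => phi (x s)).
Proof.
move=> + p; elim: p => {a e} [a _|a b e xa ab xE xB wE p IH a0].
  by rewrite set_itv_ge ?bnd_simp ?ltxx//; exact: measurable_fun_set0.
have b0 := le_trans a0 (ltW ab); have [be _] := piecewise_span b0 p.
rewrite (@itv_bndbnd_setU _ _ _ (BLeft b)) ?bnd_simp ?(ltW ab)//.
apply/measurable_funU => //; split; last exact: IH.
apply: (@eq_measurable_fun _ _ R R _ (fun=> phi xa)) => //.
by move=> s; rewrite inE/= in_itv/= => /xE ->.
Qed.

Lemma piecewise_bounded (phi : 'cV[R]_d -> R) (a e : R) :
  piecewise_flow M z lam w x B a e ->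
  exists2 C : R, 0 <= C & forall s, a <= s < e -> `|phi (x s)| <= C.
Proof.
elim=> {a e} [a|a b e xa ab xE xB wE p [C C0 IH]].
  by exists 0 => // s /andP[/le_lt_trans h /h]; rewrite ltxx.
exists (Num.max C `|phi xa|) => [|s /andP[as_ se]]; first by rewrite le_max C0.
have [bs|sb] := leP b s; first by rewrite le_max IH// bs.
by rewrite xE ?as_// le_max lexx orbT.
Qed.

(* The velocity only moves inactive coordinates, which the cone annihilates. *)
Lemma complementary_min v y : in_box lam v -> sign_cone lam v y ->
  (forall i, `|v i 0| = lam i 0 -> (M *m (z - y)) i 0 = 0) ->
  forall y', sign_cone lam v y' -> l y <= l y'.
Proof.
move=> vbox Ky comp y' Ky'.
have vel y1 : sign_cone lam v y1 -> dotp (M *m (z - y)) y1 = 0.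
  move=> Ky1; rewrite /dotp big1// => i _.
  have [vi|vi] := eqVneq `|v i 0| (lam i 0); first by rewrite comp// mul0r.
  have [_ y10 _] := Ky1 i; rewrite y10 ?mulr0//.
  by rewrite -ltr_norml lt_neqAle vi vbox.
have -> : y' = y + (y' - y) by rewrite addrC subrK.
rewrite (quadraticD _ _ symM) -addrA lerDl addr_ge0//; last first.
  by rewrite mulr_ge0//; exact: psdM.
have -> : M *m y - q = - (M *m (z - y)) by rewrite mulmxBr opprB.
by rewrite dotpNl dotpBr !vel// subr0 oppr0.
Qed.

End piecewise_consequences.

(** * Membership in L^p of the weighted measure *)

Section segment_functions.
Context {R : realType}.
Local Notation leb := (@lebesgue_measure R).

Lemma in_Lp_segment (S p : R) (f k : R -> R) C : 1 <= p ->
  measurable_fun `[0, S[ k -> (forall s, 0 <= s < S -> `|k s| <= C) -> 0 <= C ->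
  (\forall s \ae leb, 0 <= s <= S -> f s = k s) -> in_Lp (sds S) p%:E f.
Proof.
move=> p1 mk kC C0 fk.
apply: (@in_Lp_sds _ S p f (k \_ `[0, S[) C) => //.
- exact/(measurable_restrictT _ _).1.
- move=> s; rewrite patchE; case: ifPn => [|_]; last by rewrite normr0.
  by rewrite inE/= in_itv/= => /kC.
(* [k] is controlled on [[0, S[] only; the point [S] is negligible. *)
- apply: filterS2 fk (ae_notin_seq [:: S]) => s fks; rewrite inE => sS s0S.
  rewrite fks// patchE ifT// inE/= in_itv/=; case/andP: s0S => -> sS'.
  by rewrite lt_neqAle sS.
Qed.

Lemma in_Lp_continuous (S p : R) (f k : R -> R) : 0 < S -> 1 <= p ->
  {within `[0, S], continuous k} ->
  (\forall s \ae leb, 0 <= s <= S -> f s = k s) -> in_Lp (sds S) p%:E f.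
Proof.
move=> S0 p1 ck fk; have [|t _ tmax] := @EVT_max R (fun s => `|k s|) 0 S (ltW S0).
  by move=> s; apply: cvg_norm; exact: ck.
apply: (@in_Lp_segment S p f k `|k t|) => //.
- apply: (@measurable_funS _ _ _ _ `[0, S]) => //; first exact: subset_itv_co_cc.
  exact: subspace_continuous_measurable_fun.
- by move=> s /andP[s0 sS]; apply: tmax; rewrite in_itv/= s0 ltW.
Qed.

End segment_functions.

(** * Gradients and losses bounded by the gap *)

Section loss_estimates.
Context {R : realType} {d : nat}.
Variables (M : 'M[R]_d) (z : 'cV[R]_d) (c : R).
Hypotheses (symM : M^T = M) (psdM : psd M).
Local Notation l := (quadratic M (M *m z) c).
Implicit Types x y : 'cV[R]_d.

(** Cauchy-Schwarz for [M] against each unit vector. *)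
Lemma dotp_mulmx_trace y :
  dotp (M *m y) (M *m y) <= (\sum_i M i i) * dotp y (M *m y).
Proof.
rewrite {1}/dotp mulr_suml ler_sum// => i _.
have := psd_cauchy_schwarz symM psdM (delta_mx i 0) y.
by rewrite !dotp_delta -colE [col _ _ _ _]mxE expr2.
Qed.

(** The slope [<M (y - z), x - y>] is of the order of the square root of the gap; Young's inequality
    trades it for the gap plus an error of size [t]. *)
Lemma quadratic_gap t x y : 0 < t ->
  `|l x - l y| <= t / 2 * dotp (y - z) (M *m (y - z)) +
    (1 + t^-1) * (2^-1 * dotp (x - y) (M *m (x - y))).
Proof.
move=> t0; have -> : x = y + (x - y) by rewrite addrC subrK.
rewrite (quadraticD _ _ symM) -mulmxBr [y + _ - y]addrC addKr.
set e := x - y; rewrite dotpC (dotp_symC e (y - z) symM).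
have h1 := psd_young symM psdM (y - z) e t0.
have := psd_young symM psdM (- (y - z)) e t0.
rewrite mulmxN !(dotpNl, dotpNr) opprK => h2.
have e0 := psdM e.
set a := dotp (y - z) (M *m e) in h1 h2 *; set b := dotp e (M *m e) in h1 h2 e0 *.
have -> : (1 + t^-1) * (2^-1 * b) = 2^-1 * b + (2 * t)^-1 * b.
  by field; rewrite gt_eqF.
have -> : l y + a + 2^-1 * b - l y = a + 2^-1 * b by ring.
by rewrite ler_norml; apply/andP; split; lra.
Qed.

Lemma positive_lower_bound (f : 'I_d -> R) : (forall i, 0 < f i) ->
  exists2 delta : R, 0 < delta & forall i, delta <= f i.
Proof.
move=> f0; exists (\big[Num.min/1]_i f i); first exact/lt_bigmin.
by move=> i; exact: bigmin_le.
Qed.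

End loss_estimates.

(** * Convergence in L^p and pointwise limits *)

Section convergence.
Context {R : realType} {d : nat}.
Variables (M : 'M[R]_d) (z : 'cV[R]_d).
Hypotheses (symM : M^T = M) (psdM : psd M).
Variables (lam : 'cV[R]_d) (w x : R -> 'cV[R]_d) (B delta : R) (ws : 'cV[R]_d).
Hypotheses (B0 : 0 <= B) (delta0 : 0 < delta).
Hypothesis wcont : forall i, {within `[0, +oo[, continuous (fun s => w s i 0)}.
Hypothesis wflow : forall S : R, 0 <= S -> piecewise_flow M z lam w x B 0 S.
Hypothesis wsspan : colspan M (ws - w 0).
Hypothesis wsint : forall i, `|ws i 0| <= lam i 0 - delta.
Hypothesis lam0 : forall i, 0 < lam i 0.
Variables (m_ : R -> R) (L_ : R -> 'cV[R]_d) (W_ : R -> R -> 'cV[R]_d).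
Hypothesis sm : \forall e \near 0^'+, smoothed_flow M z (m_ e) (L_ e) (W_ e).
Hypothesis m_oo : m_ e @[e --> 0^'+] --> +oo.
Hypothesis L_lam : forall i, L_ e i 0 @[e --> 0^'+] --> lam i 0.
Hypothesis W_w0 : forall i, W_ e 0 i 0 @[e --> 0^'+] --> w 0 i 0.
Local Notation leb := (@lebesgue_measure R).
Local Notation gap_ e s := (gap M (m_ e) (L_ e) (W_ e) s (x s)).

(** Common form of both L^p estimates; [t] is the part of the bound that does not vanish with the
    gap. *)
Lemma sds_gap_le (S t C eta : R) : 0 <= S -> 0 <= t -> 0 <= C -> 0 < eta ->
  \forall e \near 0^'+, forall f : R -> R, (forall s, 0 <= f s) ->
    (\forall s \ae leb, 0 <= s <= S -> f s <= t + C * gap_ e s) ->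
    (\int[sds S]_s (f s)%:E <= (t * S ^+ 2 + eta)%:E)%E.
Proof.
move=> S0 t0 C0 eta0; have C1 : 0 < C + 1 by rewrite ltr_wpDl.
have eta'0 : 0 < eta / (C + 1) by rewrite divr_gt0.
have gv := gap_vanishes symM psdM B0 delta0 wcont wflow wsspan wsint _ sm m_oo
  L_lam W_w0 S0 eta'0.
near=> e => f f0 fg.
have se : smoothed_flow M z (m_ e) (L_ e) (W_ e) by near: e.
have gve : (\int[leb]_(s in `[0%R, S]) (s * gap_ e s)%:E <= (eta / (C + 1))%:E)%E.
  by near: e; exact: gv.
have mg : measurable_fun `[0, S] (fun s => s * gap_ e s).
  apply/measurable_fun_itv_bndo_bndcP.
  exact: (gap_measurable se (lexx 0) (wflow S0)).
have gE (s : R) : s * (t + C * gap_ e s) = s * t + C * (s * gap_ e s) by ring.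
have g0 (s : R) : 0 <= gap_ e s by exact: gap_ge0.
apply: (le_trans (@sds_integral_le _ S f (fun s => t + C * gap_ e s) f0 _ _ fg)).
- rewrite (funext gE).
  by apply: measurable_funD; apply: measurable_funM.
- by move=> s _; rewrite addr_ge0// mulr_ge0.
under eq_integral => s _ do rewrite /= gE EFinD [(C * _)%:E]EFinM.
rewrite ge0_integralD//=; last 4 first.
- by move=> s; rewrite /= in_itv/= => /andP[s0 _]; rewrite lee_fin mulr_ge0.
- by apply/measurable_EFinP; exact: measurable_funM.
- move=> s; rewrite /= in_itv/= => /andP[s0 _].
  by rewrite -EFinM lee_fin mulr_ge0// mulr_ge0.
- apply: measurable_funeM; exact/measurable_EFinP.
rewrite ge0_integralZl_EFin//; last 2 first.
- by move=> s; rewrite /= in_itv/= => /andP[s0 _]; rewrite lee_fin mulr_ge0.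
- exact/measurable_EFinP.
rewrite EFinD; apply: leeD.
  apply: (@le_trans _ _ (\int[leb]_(s in `[0%R, S]) (S * t)%:E)%E).
    apply: ge0_le_integral => //.
    - by move=> s; rewrite /= in_itv/= => /andP[s0 _]; rewrite lee_fin mulr_ge0.
    - by apply/measurable_EFinP; exact: measurable_funM.
    - by move=> s; rewrite /= in_itv/= => /andP[s0 sS]; rewrite lee_fin ler_wpM2r.
  rewrite integral_cst//= lebesgue_measure_itv/=; case: ifP => _.
    by rewrite -EFinB -EFinM lee_fin subr0 expr2 mulrAC mulrC.
  by rewrite mule0 lee_fin mulr_ge0// sqr_ge0.
apply: (@le_trans _ _ (C%:E * (eta / (C + 1))%:E)%E).
  by apply: lee_wpmul2l => //; exact: gve.
by rewrite -EFinM lee_fin mulrCA ger_pMr// ler_pdivrMr// mul1r lerDl.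
Unshelve. all: by end_near. Qed.

Section sequences.
Variables (S : R) (y : R -> 'cV[R]_d) (eps : nat -> R).
Hypothesis S0 : 0 <= S.
Hypothesis eps0 : forall k, 0 < eps k.
Hypothesis eps_cvg : eps k @[k --> \oo] --> 0.
Let X k s := mirror_col (m_ (eps k)) (L_ (eps k)) (W_ (eps k) s).

Lemma near_eps (P : R -> Prop) : (\forall e \near 0^'+, P e) ->
  \forall k \near \oo, P (eps k).
Proof.
move=> P0; have H : \forall k \near \oo, 0 < eps k -> P (eps k) := eps_cvg P0.
by apply: filterS H => k /(_ (eps0 k)).
Qed.

(** At an end of the interval [W] eventually has the sign of [w], and so has its mirror image;
    strictly inside, the mirror image is exponentially small. *)
Lemma limit_sign_cone s : 0 <= s <= S ->
  (forall i, X k s i 0 @[k --> \oo] --> y s i 0) -> sign_cone lam (w s) (y s).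
Proof.
move=> sS Xy i.
have close (r : R) : 0 < r -> \forall k \near \oo, [/\ 0 < m_ (eps k),
    `|W_ (eps k) s i 0 - w s i 0| <= r & `|L_ (eps k) i 0 - lam i 0| <= r].
  move=> r0; apply: (@near_eps (fun e => [/\ 0 < m_ e,
    `|W_ e s i 0 - w s i 0| <= r & `|L_ e i 0 - lam i 0| <= r])); near=> e.
  have We : forall s, 0 <= s <= S -> forall i, `|W_ e s i 0 - w s i 0| <= r.
    near: e; exact: (uniform_convergence symM psdM B0 delta0 wcont wflow wsspan
      wsint _ sm m_oo L_lam W_w0).
  have oe : forall i, `|(w 0 - W_ e 0) i 0| <= r /\ `|L_ e i 0 - lam i 0| <= r.
    by near: e; exact: offsets_vanish.
  have [m0 _ _ _] : smoothed_flow M z (m_ e) (L_ e) (W_ e) by near: e.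
  by split=> //; [exact: We|have [] := oe i].
have l0 := lam0 i.
have limy : limn (fun k => X k s i 0) = y s i 0 by exact: cvg_lim (Xy i).
have cX : cvgn (fun k => X k s i 0) by apply/cvg_ex; exists (y s i 0); exact: Xy.
have l20 : 0 < lam i 0 / 2 by rewrite divr_gt0.
split=> wi.
- rewrite -limy; apply: limr_ge => //.
  apply: filterS (close _ l20) => k [m0 + _]; rewrite wi ler_norml => /andP[W1 _].
  by rewrite /X mxE mirror_map_ge0//; lra.
(* One third of the distance to the ends is spent on [W], one on [L], and one remains as the margin
   of [mirror_map_small]. *)
- have r0 : 0 < (lam i 0 - `|w s i 0|) / 3.
    by rewrite divr_gt0// subr_gt0 ltr_norml.
  set r := _ / 3 in r0.
  rewrite -limy; apply: cvg_lim => //.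
  apply/cvgrPdist_le => eta eta0.
  have mk : \forall k \near \oo, (2 * r * eta)^-1 <= m_ (eps k).
    by apply: (@near_eps (fun e => (2 * r * eta)^-1 <= m_ e)); have /cvgryPge := m_oo; apply.
  apply: filterS2 (close _ r0) mk => k [m0 Wk Lk] mk.
  rewrite sub0r normrN /X mxE (le_trans (@mirror_map_small _ _ _ _ r m0 _))//.
    have := ler_distD (w s i 0) (W_ (eps k) s i 0) 0; rewrite !subr0 => h.
    by move: Lk; rewrite ler_norml => /andP[L1 L2]; rewrite /r in Wk L1 *; lra.
  have a0 : 0 < 2 * m_ (eps k) * r by rewrite mulr_gt0// mulr_gt0.
  rewrite expRN -[leRHS]invrK lef_pV2 ?posrE ?expR_gt0 ?invr_gt0//.
  apply: (@le_trans _ _ (1 + 2 * m_ (eps k) * r)); last exact: expR_ge1Dx.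
  apply: (@le_trans _ _ (2 * m_ (eps k) * r)); last by rewrite lerDr.
  have re0 : 0 < 2 * r * eta by rewrite mulr_gt0// mulr_gt0.
  move: mk; rewrite -div1r (ler_pdivrMr _ _ re0) -[eta^-1]div1r (ler_pdivrMr _ _ eta0).
  by rewrite mulrA [m_ _ * _]mulrA [m_ _ * 2]mulrC.
- rewrite -limy; apply: limr_le => //.
  apply: filterS (close _ l20) => k [m0 + _]; rewrite wi ler_norml => /andP[_ W1].
  by rewrite /X mxE mirror_map_le0//; lra.
Unshelve. all: by end_near. Qed.

Lemma limit_gradient :
  (\forall s \ae leb, 0 <= s <= S -> forall i, X k s i 0 @[k --> \oo] --> y s i 0) ->
  \forall s \ae leb, 0 <= s <= S -> M *m y s = M *m x s.
Proof.
move=> Xy.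
(* Fatou's lemma wants measurability for every [k]; the value 0 is taken at finitely many [k]
   only. *)
pose f k s := if `[< smoothed_flow M z (m_ (eps k)) (L_ (eps k)) (W_ (eps k)) >]
  then (s * gap_ (eps k) s)%:E else 0%E.
have fgap : \forall k \near \oo, forall s, f k s = (s * gap_ (eps k) s)%:E.
  by apply: filterS (near_eps sm) => k smk s; rewrite /f asboolT.
have f0 k s : `[0, S[%classic s -> (0 <= f k s)%E.
  rewrite /= in_itv/= /f => /andP[s0 _]; case: ifP => // _.
  by rewrite lee_fin mulr_ge0// gap_ge0.
have mf k : measurable_fun `[0, S[ (f k).
  rewrite /f; case: asboolP => [smk|_]; last exact: measurable_cst.
  by apply/measurable_EFinP; exact: (gap_measurable smk (lexx 0) (wflow S0)).
pose h s := limn_einf (f^~ s).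
have mh : measurable_fun `[0, S[ h.
  rewrite /h /limn_einf.
  apply: (measurableT_comp (@oppe_measurable R setT)).
  by apply: measurable_fun_limn_esup => k; exact: (measurableT_comp (@oppe_measurable R setT)).
have h0 s : `[0, S[%classic s -> (0 <= h s)%E.
  move=> sS; rewrite /h limn_einf_lim; apply: lime_ge; first exact: is_cvg_einfs.
  by apply: nearW => n; apply: le_ereal_inf_tmp => _ [k _ <-]; exact: f0.
have int0 : (\int[leb]_(s in `[0%R, S[) f k s)%E @[k --> \oo] --> 0%E.
  apply: cvge_to0 => [k|eta eta0]; first by apply: integral_ge0 => s; exact: f0.
  have gv := near_eps (gap_vanishes symM psdM B0 delta0 wcont wflow wsspan wsint
    _ sm m_oo L_lam W_w0 S0 eta0); move: gv => /(_ _) gv.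
  near=> k; have fk : forall s, f k s = (s * gap_ (eps k) s)%:E by near: k.
  under eq_integral do rewrite fk.
  rewrite integral_itv_bndo_bndc; first by near: k.
  by apply: (eq_measurable_fun (f k)) => // s _; rewrite fk.
have hint : (\int[leb]_(s in `[0%R, S[) `|h s| = 0)%E.
  apply/eqP; rewrite eq_le; apply/andP; split; last exact: integral_ge0.
  under eq_integral => s do [rewrite inE => sS; rewrite gee0_abs ?h0//].
  apply: le_trans (fatou leb _ mf f0) _ => //.
  by have [-> _] := cvg_limn_einf_sup int0.
have := (ae_eq_integral_abs leb _ mh).1 hint => /(_ (measurable_itv _)) hae.
(* At 0 the weight vanishes and gives no information; [S] is outside of the half-open domain of
   integration. *)
apply: filterS3 hae Xy (ae_notin_seq [:: 0; S]) => s hs Xys.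
rewrite !inE negb_or => /andP[s0 sS] /[dup] sin /Xys {}Xys.
have sin' : `[0, S[%classic s.
  by move: sin; rewrite /= in_itv/= => /andP[-> ss]; rewrite lt_neqAle sS.
pose v := y s - x s.
have gv : gap_ (eps k) s @[k --> \oo] --> 2^-1 * dotp v (M *m v).
  have cv i : (X k s - x s) i 0 @[k --> \oo] --> v i 0.
    rewrite (_ : (fun k => _) = fun k => X k s i 0 - x s i 0); last first.
      by apply/funext => k; rewrite !mxE.
    by rewrite !mxE; apply: cvgB; [exact: Xys|exact: cvg_cst].
  apply: cvgM; first exact: cvg_cst.
  by apply: cvg_dotp => // i; exact: cvg_mulmx_col.
have fs : f k s @[k --> \oo] --> (s * (2^-1 * dotp v (M *m v)))%:E.
  apply: (@cvg_trans _ ((fun k => (s * gap_ (eps k) s)%:E) @ \oo)).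
    by apply: near_eq_cvg; apply: filterS fgap => k ->.
  by apply: cvg_EFin; [exact: nearW|apply: cvgM; [exact: cvg_cst|exact: gv]].
have := hs sin'; rewrite /h; have [-> _] := cvg_limn_einf_sup fs => -[] /eqP.
rewrite mulf_eq0 (negbTE s0)/= mulf_eq0 invr_eq0 pnatr_eq0/= => /eqP/psd_form_eq0.
by move=> /(_ symM psdM)/eqP; rewrite mulmxBr subr_eq0 => /eqP.
Unshelve. all: by end_near. Qed.

End sequences.

Section limits.
Variable c : R.
Local Notation l := (quadratic M (M *m z) c).
Variables (xb_ : R -> R -> 'cV[R]_d) (xb : R -> 'cV[R]_d).
Hypothesis xbE : \forall e \near 0^'+, forall s : R, 0 <= s ->
  xb_ e s = mirror_col (m_ e) (L_ e) (W_ e s).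
Hypothesis Mxb : \forall s \ae leb, 0 <= s -> M *m xb s = M *m x s.

Lemma gradient_convergence S : 0 < S -> cvg_Lp_vec (sds S) 2%:E
  (fun e s => gradient l (xb_ e s)) (fun s => gradient l (xb s)).
Proof.
move=> S0; have le12 : (1 : R) <= 2 by rewrite ler1n.
have T0 : 0 <= \sum_i M i i.
  apply: sumr_ge0 => i _; have := psdM (delta_mx i 0).
  by rewrite dotp_delta -colE mxE.
split.
- apply: filterS2 sm xbE => e se xe i.
  apply: (@in_Lp_continuous _ S 2 _ (fun s =>
    (M *m mirror_col (m_ e) (L_ e) (W_ e s) - M *m z) i 0)) => //.
    move=> s; rewrite (_ : (fun s => _) = fun s =>
        (M *m mirror_col (m_ e) (L_ e) (W_ e s)) i 0 - (M *m z) i 0).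
      apply: cvgB; last exact: cvg_cst.
      apply: cvg_mulmx_col => j; exact: (@smoothed_flow_continuous _ _ _ _ _ _ _ 0 S j se (lexx 0) s).
    by apply/funext => t; rewrite !mxE.
  by apply: nearW => s /andP[s0 _]; rewrite gradient_quadratic// xe.
- move=> i; pose phi v := (M *m v - M *m z) i 0.
  have [C C0 xC] := piecewise_bounded phi (wflow (ltW S0)).
  apply: (in_Lp_segment le12 (piecewise_measurable phi (lexx 0) (wflow (ltW S0))) xC C0).
  by apply: filterS Mxb => s Ms /andP[s0 _]; rewrite gradient_quadratic// Ms.
- apply: cvg_Lnorm0 => // eta eta0.
  (* [|M e|^2] is at most the trace times [<e, M e>], and the gap is half of the latter. *)
  have T20 : 0 <= 2 * \sum_i M i i by rewrite mulr_ge0.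
  apply: filterS2 xbE (sds_gap_le (ltW S0) (lexx 0) T20 eta0) => e xe H.
  apply: (le_trans (H _ _ _)); last by rewrite mul0r add0r.
    by move=> s; exact: powR_ge0.
  apply: filterS Mxb => s Ms /andP[s0 _].
  rewrite powR_mulrn// ger0_norm ?sqrtr_ge0// sqr_sqrtr ?dotp_ge0//.
  rewrite !gradient_quadratic// Ms// xe// opprB addrA subrK -mulmxBr add0r.
  apply: (le_trans (dotp_mulmx_trace symM psdM _)).
  by rewrite /gap; set a := dotp _ _; rewrite le_eqVlt; apply/orP; left; apply/eqP; field.
Qed.

Lemma loss_convergence S : 0 < S -> cvg_Lp (sds S) 1%:E
  (fun e s => l (xb_ e s)) (fun s => l (xb s)).
Proof.
move=> S0; have lxb : \forall s \ae leb, 0 <= s -> l (xb s) = l (x s).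
  apply: filterS Mxb => s Ms s0; apply: quadratic_eqM => //; last exact: Ms.
  by exists z.
split.
- apply: filterS2 sm xbE => e se xe.
  apply: (@in_Lp_continuous _ S 1 _ (fun s =>
    l (mirror_col (m_ e) (L_ e) (W_ e s)))) => //.
    move=> s; apply: cvg_quadratic => j.
    exact: (@smoothed_flow_continuous _ _ _ _ _ _ _ 0 S j se (lexx 0) s).
  by apply: nearW => s /andP[s0 _]; rewrite xe.
- have [C C0 xC] := piecewise_bounded l (wflow (ltW S0)).
  apply: (in_Lp_segment (lexx 1) (piecewise_measurable l (lexx 0) (wflow (ltW S0))) xC C0).
  by apply: filterS lxb => s ls /andP[s0 _]; exact: ls.
- apply: cvg_Lnorm0 => // eta eta0.
  pose phi y := dotp (y - z) (M *m (y - z)).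
  have [C C0 xC] := piecewise_bounded phi (wflow (ltW S0)).
  have C1 : 0 < C + 1 by rewrite ltr_wpDl.
  (* Makes the part of the bound that does not vanish, [t / 2 * C * S ^+ 2], at most [eta / 2]. *)
  pose t := eta / ((C + 1) * S ^+ 2).
  have t0 : 0 < t by rewrite divr_gt0// mulr_gt0// exprn_gt0.
  have tC0 : 0 <= t / 2 * C by rewrite mulr_ge0// divr_ge0// ltW.
  have t10 : 0 <= 1 + t^-1 by rewrite addr_ge0// invr_ge0 ltW.
  have eta2 : 0 < eta / 2 by rewrite divr_gt0.
  apply: filterS2 xbE (sds_gap_le (ltW S0) tC0 t10 eta2) => e xe H.
  apply: (le_trans (H _ _ _)).
  - by move=> s; exact: powR_ge0.
  - apply: filterS2 lxb (ae_notin_seq [:: S]) => s ls; rewrite inE => sS /andP[s0 s1].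
    rewrite powRr1// ls// xe//; apply: (le_trans (@quadratic_gap _ _ M z c symM psdM _ _ _ t0)).
    rewrite lerD2r ler_wpM2l//; first by rewrite divr_ge0// ltW.
    by rewrite (le_trans (ler_norm _))// xC// s0 lt_neqAle sS.
  - rewrite lee_fin [leRHS](splitr eta) lerD2r.
    have -> : eta = t * ((C + 1) * S ^+ 2).
      by rewrite divfK// gt_eqF// mulr_gt0// exprn_gt0.
    have -> : t / 2 * C * S ^+ 2 = t * S ^+ 2 / 2 * C by ring.
    have -> : t * ((C + 1) * S ^+ 2) / 2 = t * S ^+ 2 / 2 * (C + 1) by ring.
    by rewrite ler_wpM2l ?lerDl// divr_ge0// mulr_ge0 ?sqr_ge0// ltW.
Qed.

End limits.

End convergence.

(** * Optimality and continuity along the limiting flow *)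

Section exact_trajectory.
Context {R : realType} {d : nat}.
Variables (M : 'M[R]_d) (z : 'cV[R]_d) (c : R).
Hypotheses (symM : M^T = M) (psdM : psd M).
Variables (lam : 'cV[R]_d) (w x : R -> 'cV[R]_d) (B : R).
Local Notation l := (quadratic M (M *m z) c).

(** [B] bounds coordinates, so its sign requires an index: [1 <= d] enters here. *)
Lemma piecewise_bound_ge0 (i : 'I_d) a e : a < e ->
  piecewise_flow M z lam w x B a e -> 0 <= B.
Proof.
move=> + p; case: p => {a e} [a|a b e xa _ _ xB _ _ _]; first by rewrite ltxx.
exact: le_trans (normr_ge0 _) (xB i).
Qed.

Lemma regular_time_argmin t y : regular_time M z lam w x B t ->
  sign_cone lam (w t) y -> M *m y = M *m x t -> Argmin (sign_cone lam (w t)) l y.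
Proof.
move=> [_ sub _ comp] Ky My; split=> //; apply: complementary_min => //.
  by move=> i; case: (sub i).
by move=> i /comp; rewrite !mulmxBr My.
Qed.

Lemma lipschitz_coord_continuous (L : R) i : 0 <= L ->
  (forall s t, 0 <= s -> 0 <= t -> `|w s - w t| <= L * `|s - t|) ->
  {within `[0, +oo[, continuous (fun s => w s i 0)}.
Proof.
(* Extension by a constant to negative times, which is continuous on the whole line. *)
move=> L0 wL; pose f t := w (Num.max 0 t) i 0.
apply: (@subspace_eq_continuous _ _ _ f).
  by move=> s; rewrite inE/= in_itv/= andbT /f => s0; rewrite max_r.
apply: continuous_subspaceT => s; apply/cvgrPdist_le => eta eta0.
have L1 : 0 < L + 1 by rewrite ltr_wpDl.
have e1 : 0 < eta / (L + 1) by exact: divr_gt0.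
near=> t.
have st : `|s - t| <= eta / (L + 1).
  by near: t; apply: cvgr_dist_le; [exact: cvg_id|exact: e1].
have m0 (r : R) : 0 <= Num.max 0 r by rewrite le_max lexx.
have mm : `|Num.max 0 s - Num.max 0 t| <= `|s - t|.
  by rewrite maxEle maxEle; case: ifP => h1; case: ifP => h2; rewrite ler_norml;
    apply/andP; split; case: (ler0P (s - t)) => h3; lra.
have le1 : `|f s - f t| <= `|w (Num.max 0 s) - w (Num.max 0 t)|.
  rewrite [leRHS]/Num.Def.normr/= mx_normrE.
  by apply: le_trans (le_bigmax _ _ (i, 0)); rewrite !mxE.
apply: (le_trans le1); apply: (le_trans (wL _ _ (m0 s) (m0 t))).
apply: (@le_trans _ _ ((L + 1) * `|s - t|)); first by rewrite ler_pM// lerDl.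
by rewrite mulrC -ler_pdivlMr.
Unshelve. all: by end_near. Qed.

End exact_trajectory.
Theorem theorem4p2 (R : realType) (d : nat) (d_ge1 : (1 <= d)%N)
  (M : 'M[R]_d) (q : 'cV[R]_d) (c : R)
  (M_sym : M^T = M) (M_psd : psd M) (q_span : colspan M q)
  (u0 v0 : R -> 'cV[R]_d) (u v : R -> R -> 'cV[R]_d)
  (uv_flow : forall e : R, 0 < e ->
    diag_net_flow (quadratic M q c) (u0 e) (v0 e) (u e) (v e))
  (uv0_neq : forall e : R, 0 < e -> forall i : 'I_d,
    u0 e i 0 <> v0 e i 0 /\ u0 e i 0 <> - v0 e i 0)
  (mu : R -> R)
  (mu_def : forall e : R, 0 < e -> mu e = Num.sqrt
    (\sum_i (ln `|(u0 e i 0 + v0 e i 0) / 2| ^+ 2 +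
             ln `|(u0 e i 0 - v0 e i 0) / 2| ^+ 2)))
  (mu_pinfty : mu e @[e --> 0^'+] --> +oo)
  (wpos wneg : 'cV[R]_d)
  (wpos_lim : (mu e)^-1 *: log_abs (2^-1 *: (u0 e + v0 e)) @[e --> 0^'+]
     --> wpos)
  (wpos_le0 : forall i, wpos i 0 <= 0)
  (wneg_lim : (mu e)^-1 *: log_abs (2^-1 *: (u0 e - v0 e)) @[e --> 0^'+]
     --> wneg)
  (wneg_le0 : forall i, wneg i 0 <= 0)
  (span_shift : exists2 a, colspan M a &
     forall i, wpos i 0 + a i 0 < 0 /\ wneg i 0 - a i 0 < 0) :
  let l := quadratic M q c in
  let xbar_ (e s : R) : 'cV[R]_d := v e (mu e * s) \h* u e (mu e * s) in
  let w0 := 2^-1 *: (wpos - wneg) in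
  let lam := - (2^-1 *: (wpos + wneg)) in
  let h := weighted_l1 lam in
  (forall i, 0 < lam i 0) /\
  exists w : R -> 'cV[R]_d,
    [/\ lipschitz_mirror_solution h l w0 w,
        forall w' : R -> 'cV[R]_d, lipschitz_mirror_solution h l w0 w' ->
          forall t : R, 0 <= t -> w' t = w t &
        forall (xbar : R -> 'cV[R]_d) (S : R),
          associated_primal h l w xbar -> 0 < S ->
          let K (s : R) := sign_cone lam (w s) in
          [/\ cvg_Lp_vec (sds S) 2%:E
                (fun e s => gradient l (xbar_ e s))
                (fun s => gradient l (xbar s)),
              cvg_Lp (sds S) 1%:E
                (fun e s => l (xbar_ e s)) (fun s => l (xbar s)),
              \forall s \ae (@lebesgue_measure R), 0 <= s <= S ->
                is_min (K s) l (l (xbar s)) &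
              forall (y : R -> 'cV[R]_d) (eps : nat -> R),
                (forall k, 0 < eps k) -> eps k @[k --> \oo] --> 0 ->
                (\forall s \ae (@lebesgue_measure R), 0 <= s <= S ->
                   xbar_ (eps k) s @[k --> \oo] --> y s) ->
                \forall s \ae (@lebesgue_measure R), 0 <= s <= S ->
                  Argmin (K s) l (y s)]].
Proof.
case: q_span => z _ zq; subst q.
move=> l xbar_ w0 lam h.
have lamE i : lam i 0 = - (wpos i 0 + wneg i 0) / 2 by rewrite !mxE; field.
have w0E i : w0 i 0 = (wpos i 0 - wneg i 0) / 2 by rewrite !mxE; field.
have lam0 i : 0 < lam i 0.
  by have [a _ /(_ i)[]] := span_shift; rewrite lamE; lra.
split=> //.
have w0box : in_box lam w0.
  by move=> i; have := wpos_le0 i; have := wneg_le0 i; rewrite lamE w0E ler_norml; lra.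
(* In terms of [w0] and [lam], the two strict inequalities on [a] say that [|w0 + a| < lam]. *)
case: span_shift => a aM wa; pose ws := w0 + a.
have wsE i : ws i 0 = w0 i 0 + a i 0 by rewrite mxE.
have [delta delta0 deltaP] : exists2 delta : R, 0 < delta &
    forall i, delta <= lam i 0 - `|ws i 0|.
  apply: positive_lower_bound => i; rewrite subr_gt0 ltr_norml wsE lamE w0E.
  by have [] := wa i; lra.
have wsint i : `|ws i 0| <= lam i 0 - delta by have := deltaP i; lra.
have shift : interior_shift M lam delta w0.
  by exists a => // i; rewrite -wsE.
have [w [x [B [L [w00 L0 wL wflow]]]]] :=
  piecewise_flow_exists z c M_sym M_psd lam0 delta0 w0box shift.
have B0 : 0 <= B.
  exact: (piecewise_bound_ge0 (Ordinal d_ge1) ltr01 (wflow _ ler01)).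
have wcont i : {within `[0, +oo[, continuous (fun s => w s i 0)}.
  exact: lipschitz_coord_continuous L0 wL.
have regular := piecewise_ae_regular wflow.
have lgrad y : - gradient l y = M *m (z - y).
  by rewrite gradient_quadratic// mulmxBr opprB.
have wsol : lipschitz_mirror_solution h l w0 w.
  split=> //.
    exists L; split; first exact: num_real.
    move=> K LK [s t] /= []; rewrite !in_itv/= !andbT => s0 t0.
    by apply: (le_trans (wL _ _ s0 t0)); rewrite ler_wpM2r// ltW.
  exists x; apply: filterS regular => t rt t0; have [wd sub _ _] := rt t0.
  by rewrite lgrad; split; [exact/is_derive_colP|exact/subdifferential_weighted_l1].
exists w; split=> // [w' w'sol t t0|xbar S xbarP S0 K].
  exact: (mirror_flow_unique M_sym M_psd wsol w'sol t0).
pose A e := (mu e)^-1 *: log_abs (2^-1 *: (u0 e + v0 e)).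
pose A' e := (mu e)^-1 *: log_abs (2^-1 *: (u0 e - v0 e)).
pose L_ e := - (2^-1 *: (A e + A' e)).
have Alim i : A e i 0 @[e --> 0^'+] --> wpos i 0.
  exact: cvg_comp wpos_lim (@coord_continuous _ _ _ _ _ _).
have A'lim i : A' e i 0 @[e --> 0^'+] --> wneg i 0.
  exact: cvg_comp wneg_lim (@coord_continuous _ _ _ _ _ _).
have L_lam i : L_ e i 0 @[e --> 0^'+] --> lam i 0.
  rewrite /lam (_ : (fun e => _) = fun e => - (2^-1 * (A e i 0 + A' e i 0))).
    by rewrite !mxE; apply: cvgN; apply: cvgM; [exact: cvg_cst|exact: cvgD].
  by apply/funext => e; rewrite !mxE.
(* The hypotheses are kept inside because positivity of [mu] and [L_] is known only near 0, while a
   choice is needed for all [e]. *)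
have [W_ W_P] : exists W_ : R -> R -> 'cV[R]_d, forall e, 0 < e -> 0 < mu e ->
    (forall i, 0 <= L_ e i 0) ->
    [/\ W_ e 0 = 2^-1 *: (A e - A' e), smoothed_flow M z (mu e) (L_ e) (W_ e) &
        forall s, 0 <= s -> xbar_ e s = mirror_col (mu e) (L_ e) (W_ e s)].
  suff H e : exists W : R -> 'cV[R]_d, 0 < e -> 0 < mu e ->
    (forall i, 0 <= L_ e i 0) ->
    [/\ W 0 = 2^-1 *: (A e - A' e), smoothed_flow M z (mu e) (L_ e) W &
        forall s, 0 <= s -> xbar_ e s = mirror_col (mu e) (L_ e) (W s)].
    by have [W_ W_P] := choice H; exists W_.
  have [[e0 m0 l0]|ne] := pselect [/\ 0 < e, 0 < mu e & forall i, 0 <= L_ e i 0].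
    have [W WP] := diag_net_smoothed_flow M_sym (uv_flow e e0) m0 (uv0_neq e e0) l0.
    by exists W.
  by exists (fun=> 0) => e0 m0 l0; case: ne.
have near_flow : \forall e \near 0^'+,
    [/\ W_ e 0 = 2^-1 *: (A e - A' e), smoothed_flow M z (mu e) (L_ e) (W_ e) &
        forall s, 0 <= s -> xbar_ e s = mirror_col (mu e) (L_ e) (W_ e s)].
  have nL : \forall e \near 0^'+, forall i, 0 <= L_ e i 0.
    apply: filter_forall => i; apply: (cvgr_ge (lam i 0)) => //; exact: L_lam.
  have nm : \forall e \near 0^'+, 0 < mu e by have /cvgryPgt := mu_pinfty; apply.
  by apply: filterS3 (nbhs_right_gt 0) nm nL => e; exact: W_P.
have sm : \forall e \near 0^'+, smoothed_flow M z (mu e) (L_ e) (W_ e).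
  by apply: filterS near_flow => e [].
have xbarE : \forall e \near 0^'+, forall s, 0 <= s ->
    xbar_ e s = mirror_col (mu e) (L_ e) (W_ e s).
  by apply: filterS near_flow => e [].
have W_w0 i : W_ e 0 i 0 @[e --> 0^'+] --> w 0 i 0.
  apply: (@cvg_trans _ ((fun e => 2^-1 * (A e i 0 - A' e i 0)) @ 0^'+)).
    by apply: near_eq_cvg; apply: filterS near_flow => e [-> _ _]; rewrite !mxE.
  by rewrite w00 !mxE; apply: cvgM; [exact: cvg_cst|exact: cvgB].
have wsspan : colspan M (ws - w 0) by rewrite w00 /ws addrC addKr.
(* [xbar] and the constructed [x] may differ, but both give the derivative of [w], so
   [M *m xbar s = M *m x s]. *)
have xbar_regular : \forall s \ae (@lebesgue_measure R), 0 <= s ->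
    [/\ M *m xbar s = M *m x s, sign_cone lam (w s) (xbar s) &
        regular_time M z lam w x B s].
  apply: filterS2 xbarP regular => s xs rs s0; have [wd sub] := xs s0.
  have rgs := rs s0; have [wd' _ _ _] := rgs; split=> //.
    move: wd; rewrite lgrad => wd; move/is_derive_colP: wd' => wd'.
    have := @derive_val _ _ _ _ _ _ _ wd; rewrite (@derive_val _ _ _ _ _ _ _ wd').
    by rewrite !mulmxBr => /addrI/oppr_inj.
  exact/l1_subgradient_sign_cone/subdifferential_weighted_l1.
have Mxbar : \forall s \ae (@lebesgue_measure R), 0 <= s -> M *m xbar s = M *m x s.
  by apply: filterS xbar_regular => s + s0 => /(_ s0)[].
split.
- exact: (gradient_convergence M_sym M_psd B0 delta0 wcont wflow wsspan wsint
    sm mu_pinfty L_lam W_w0 c xbarE Mxbar S0).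
- exact: (loss_convergence M_sym M_psd B0 delta0 wcont wflow wsspan wsint
    sm mu_pinfty L_lam W_w0 c xbarE Mxbar S0).
- apply: filterS xbar_regular => s + /andP[s0 _] => /(_ s0)[Mx Kx rs].
  have [_ xmin] := regular_time_argmin c M_sym M_psd rs Kx Mx.
  by split=> //; exists (xbar s).
move=> y eps eps0 eps_cvg xy.
have Xy : \forall s \ae (@lebesgue_measure R), 0 <= s <= S -> forall i,
    mirror_col (mu (eps k)) (L_ (eps k)) (W_ (eps k) s) i 0 @[k --> \oo] --> y s i 0.
  apply: filterS xy => s + s0S i => /(_ s0S) xy.
  apply: (@cvg_trans _ ((fun k => xbar_ (eps k) s i 0) @ \oo)).
    apply: near_eq_cvg; apply: filterS (near_eps eps0 eps_cvg xbarE) => k -> //.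
    by case/andP: s0S.
  exact: cvg_comp xy (@coord_continuous _ _ _ _ _ _).
have My := limit_gradient M_sym M_psd B0 delta0 wcont wflow wsspan wsint
  sm mu_pinfty L_lam W_w0 (ltW S0) eps0 eps_cvg Xy.
apply: filterS3 xbar_regular Xy My => s xr Xys Mys s0S.
have [_ _ rs] : [/\ M *m xbar s = M *m x s, sign_cone lam (w s) (xbar s) &
  regular_time M z lam w x B s] by apply: xr; case/andP: s0S.
apply: regular_time_argmin rs _ _ => //; last exact: Mys.
exact: (limit_sign_cone M_sym M_psd B0 delta0 wcont wflow wsspan wsint lam0
  sm mu_pinfty L_lam W_w0 (ltW S0) eps0 eps_cvg s0S (Xys s0S)).
Qed.
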